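(* Let $T>0$. For the empirical measures $\mu^n_t$ generated by the solutions of the Kuramoto model $$\dot\theta_{ni}=\omega_i+Kn^{-1}\sum_{j=1}^nW(\xi_{ni},\xi_{nj})\sin(\theta_{nj}-\theta_{ni}),\qquad\theta_{ni}(0)=\theta_i^0,\quad i\in[n],$$ with randomly sampled initial data as described in the context, and the absolutely continuous measure $\mu_t$ whose density $\hat\rho(t,\cdot)$ is the weak solution of $$\frac{\partial}{\partial t}\hat\rho+\frac{\partial}{\partial\theta}\{\hat\rho V\}=0,\quad V(t,\theta,\omega,x)=\omega+K\int_I\int_{\mathbb R}\int_{\mathbb S}W(x,y)\sin(\phi-\theta)\hat\rho(t,\phi,\lambda,y)\,d\phi\,d\lambda\,dy,$$ $$\hat\rho(0,\theta,\omega,x)=\hat\rho^0_{\theta|\omega}(\theta,\omega,x)g(\omega),$$ we have $$\lim_{n\to\infty}\sup_{t\in[0,T]}d(\mu^n_t,\mu_t)=0\quad\text{almost surely.}$$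
   Context: $I=[0,1]$, $\mathbb S=\mathbb R/2\pi\mathbb Z$ (identified with $[0,2\pi)$) with distance $d_{\mathbb S}(\theta,\theta')=\min\{|\theta-\theta'|,2\pi-|\theta-\theta'|\}$, $G=\mathbb S\times\mathbb R\times I$ with distance $d_G(P,P')=\sqrt{d_{\mathbb S}(\theta,\theta')^2+(\omega-\omega')^2+(x-x')^2}$ for $P=(\theta,\omega,x)$, $P'=(\theta',\omega',x')$; $\mathcal B(G)$ is the Borel $\sigma$-algebra of $G$. $K\in\mathbb R$ is a fixed coupling constant, $[n]=\{1,\dots,n\}$, and $W:I^2\to\mathbb R$ is symmetric and Lipschitz continuous. For each $n$, $X_n=\{\xi_{n1},\dots,\xi_{nn}\}\subset I$ is a given set of points such that $\lim_{n\to\infty}n^{-1}\sum_{i=1}^nf(\xi_{ni})=\int_If(x)\,dx$ for all $f\in C(I)$. The $\omega_1,\omega_2,\dots$ are independent identically distributed real random variables with continuous probability density $g$. The initial phases $\theta_i^0$ (which may depend on $n$) are, given the $\omega_i$'s, sampled independently from the conditional distributions with densities $\hat\rho^0_{\theta|\omega}(\theta,\omega_i,\xi_{ni})$, $i\in[n]$. Here $\hat\rho^0_{\theta|\omega}$ is a nonnegative continuous function on $G$, with $\int_{\mathbb S}\hat\rho^0_{\theta|\omega}(\phi,\omega,\xi)\,d\phi=1$ for all $(\omega,\xi)\in\mathbb R\times I$, and uniformly continuous in $\xi$: for every $\epsilon>0$ there is $\delta>0$ such that $|\xi_1-\xi_2|<\delta$ implies $|\hat\rho^0_{\theta|\omega}(\theta,\omega,\xi_1)-\hat\rho^0_{\theta|\omega}(\theta,\omega,\xi_2)|<\epsilon$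 for all $(\theta,\omega)\in\mathbb S\times\mathbb R$. Empirical measure: $\mu^n_t(A)=n^{-1}\sum_{i=1}^n\delta_{P_{ni}(t)}(A)$, $A\in\mathcal B(G)$, with $P_{ni}(t)=(\theta_{ni}(t),\omega_i,\xi_{ni})$. Also $\mu_t(A)=\int_A\hat\rho(t,P)\,dP$. Bounded Lipschitz distance between Borel probability measures on $G$: $d(\mu,\nu)=\sup_{f\in\mathcal L}\left|\int_Gf\,d\mu-\int_Gf\,d\nu\right|$, where $\mathcal L=\{f:G\to[0,1]:\ |f(P)-f(Q)|\le d_G(P,Q)\ \forall P,Q\in G\}$. Weak solution: a family of probability densities $\hat\rho(t,\cdot)$ on $G$, $t\in[0,T]$, such that $t\mapsto\int_Gf(P)\hat\rho(t,P)\,dP$ is continuous for every bounded continuous $f$ on $G$, and for every compactly supported continuous test function $w$ on $[0,T)\times G$ that is continuously differentiable in $(t,\theta)$, $$\int_0^T\int_G\hat\rho(t,P)\left(\frac{\partial w}{\partial t}(t,P)+V(t,P)\frac{\partial w}{\partial\theta}(t,P)\right)dP\,dt+\int_G\hat\rho(0,P)\,w(0,P)\,dP=0,$$ with $\hat\rho(0,\cdot)$ the prescribed initial density. (Such a weak solution exists and is unique.) *)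

(* Defs.v *)
From HB Require Import structures.
From mathcomp Require Import all_boot all_order all_algebra.
From mathcomp Require Import all_classical all_reals all_analysis.

Set Implicit Arguments.
Unset Strict Implicit.
Unset Printing Implicit Defensive.

Import Order.TTheory GRing.Theory Num.Theory.
Import numFieldNormedType.Exports.

Local Open Scope classical_set_scope.
Local Open Scope ring_scope.

(* A point P = (theta, omega, x) of G = S * R * I is a triple of type
   [R * R * R], i.e. ((theta, omega), x), with theta in [0, 2 pi[ (the
   representative of a class of S = R / 2 pi Z) and x in [0, 1].  Functions on
   G are functions on [R * R * R] of which only the values on [Gset] matter. *)
Section phase_space.
Context {R : realType}.
Implicit Types (P Q : R * R * R) (f : R * R * R -> R).

Definition circle : set R := [set` `[0, 2 * pi[].

Definition Gset : set (R * R * R) :=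
  [set P | circle P.1.1 /\ [set` `[0, 1]] P.2].

(* The quotient map R -> S, read in [0, 2 pi[. *)
Definition circle_repr (theta : R) : R :=
  theta - 2 * pi * (Num.floor (theta / (2 * pi)))%:~R.

Definition G_repr P : R * R * R := (circle_repr P.1.1, P.1.2, P.2).

Definition dS (a b : R) : R := Num.min `|a - b| (2 * pi - `|a - b|).

Definition dG P Q : R :=
  Num.sqrt (dS P.1.1 Q.1.1 ^+ 2 + (P.1.2 - Q.1.2) ^+ 2 + (P.2 - Q.2) ^+ 2).

(* S carries the quotient topology of R: f is continuous on G when
   (theta, omega, x) |-> f (theta mod 2 pi, omega, x) is continuous on
   R * R * I.  Continuity of f itself on [Gset], as a subspace of R^3, would
   miss the gluing of 2 pi with 0. *)
Definition G_continuous f : Prop :=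
  {within [set P : R * R * R | [set` `[0, 1]] P.2], continuous (f \o G_repr)}.

Definition lebesgue3 := ((@lebesgue_measure R \x @lebesgue_measure R)
                          \x @lebesgue_measure R)%E.

Definition G_probability_density f : Prop :=
  [/\ measurable_fun Gset f,
      forall P, Gset P -> 0 <= f P &
      (\int[lebesgue3]_(P in Gset) (f P)%:E = 1)%E].

(* The Borel sigma-algebra of (G, dG) is the trace on [Gset] of the product
   sigma-algebra of [R * R * R]; Borel measures on G are thus represented by
   set functions on [R * R * R] concentrated on [Gset]. *)
Definition density_measure f : set (R * R * R) -> \bar R :=
  fun A => (\int[lebesgue3]_(P in A `&` Gset) (f P)%:E)%E.

Definition empirical_measure n (p : 'I_n -> R * R * R) :
    set (R * R * R) -> \bar R :=
  fun A => ((n%:R^-1)%:E * \sum_(i < n) \d_(p i) A)%E.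

Definition BL_class : set (R * R * R -> R) :=
  [set f | (forall P, Gset P -> 0 <= f P <= 1) /\
           (forall P Q, Gset P -> Gset Q -> `|f P - f Q| <= dG P Q)].

Definition dBL (mu nu : set (R * R * R) -> \bar R) : \bar R :=
  ereal_sup [set `| \int[mu]_(P in Gset) (f P)%:E
                    - \int[nu]_(P in Gset) (f P)%:E |%E | f in BL_class].

End phase_space.

Section model.
Context {R : realType}.
Variables (T K : R) (W : R * R -> R).

(* [th i] is a real-valued lift of the S-valued function theta_{ni}. *)
Definition kuramoto_solution n (xi om th0 : 'I_n -> R) (th : 'I_n -> R -> R) :
    Prop :=
  forall i : 'I_n,
  [/\ circle_repr (th i 0) = th0 i,
      {within `[0, T], continuous (th i)} &
      forall t : R, 0 < t < T ->
        is_derive t (1 : R) (th i)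
          (om i + K * n%:R^-1 *
             \sum_(j < n) W (xi i, xi j) * sin (th j t - th i t))].

Definition velocity (rho : R -> R * R * R -> R) (t : R) (P : R * R * R) : R :=
  P.1.2 + K *
    \int[lebesgue_measure]_(y in `[0, 1])
    \int[lebesgue_measure]_lambda
    \int[lebesgue_measure]_(phi in circle)
      (W (P.2, y) * sin (phi - P.1.1) * rho t (phi, lambda, y)).

Definition test_domain : set (R * (R * R * R)) :=
  [set z | 0 <= z.1 < T /\ [set` `[0, 1]] z.2.2].

(* Continuity on [0, T[ * G, see [G_continuous]. *)
Definition tG_continuous (w : R -> R * R * R -> R) : Prop :=
  {within test_domain, continuous (fun z => w z.1 (G_repr z.2))}.

(* w vanishes outside a compact subset of [0, T[ * G.  The compact set C is
   taken in R * R^3; it may contain points with theta outside [0, 2 pi[, and so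
   may be closed at theta = 2 pi, i.e. reach around the circle. *)
Definition tG_compactly_supported (w : R -> R * R * R -> R) : Prop :=
  exists C : set (R * (R * R * R)),
  [/\ compact C, C `<=` test_domain &
      forall t P, 0 <= t < T -> Gset P -> ~ C (t, P) -> w t P = 0].

(* w is a compactly supported test function on [0, T[ * G with continuous
   partial derivatives wt (in t) and wtheta (in theta).  At t = 0 the continuity
   of w and wt makes wt 0 the right derivative of w. *)
Definition test_function (w wt wtheta : R -> R * R * R -> R) : Prop :=
  [/\ tG_compactly_supported w,
      [/\ tG_continuous w, tG_continuous wt & tG_continuous wtheta],
      forall t P, 0 < t < T -> Gset P ->
        is_derive t (1 : R) (fun s => w s P) (wt t P) &
      forall t P, 0 <= t < T -> Gset P ->
        is_derive P.1.1 (1 : R) (fun theta => w t (G_repr (theta, P.1.2, P.2)))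
          (wtheta t P)].

Definition weak_solution (rho_init : R * R * R -> R)
    (rho : R -> R * R * R -> R) : Prop :=
  [/\ forall t, 0 <= t <= T -> G_probability_density (rho t),
      forall f : R * R * R -> R,
        G_continuous f -> [bounded f P | P in Gset] ->
        {within `[0, T], continuous
          (fun t : R => \int[lebesgue3]_(P in Gset) (f P * rho t P))},
      forall P, Gset P -> rho 0 P = rho_init P &
      forall w wt wtheta, test_function w wt wtheta ->
        \int[lebesgue_measure]_(t in `[0, T[)
          \int[lebesgue3]_(P in Gset)
            (rho t P * (wt t P + velocity rho t P * wtheta t P))
        + \int[lebesgue3]_(P in Gset) (rho 0 P * w 0 P) = 0].

End model.

Section random_data.
Context {R : realType} {d : measure_display} {Omega : measurableType d}.
Variable Pr : probability Omega R.

Definition mutually_independent (X : nat -> Omega -> R) : Prop :=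
  forall (J : seq nat) (B : nat -> set R),
    uniq J -> (forall i, measurable (B i)) ->
    Pr (\bigcap_(i in [set` J]) (X i @^-1` B i)) =
    (\prod_(i <- J) Pr (X i @^-1` B i))%E.

Definition has_density (X : Omega -> R) (g : R -> R) : Prop :=
  forall B : set R, measurable B ->
    Pr (X @^-1` B) = (\int[lebesgue_measure]_(x in B) (g x)%:E)%E.

Definition generated_sigma_algebra (X : nat -> Omega -> R) : set (set Omega) :=
  <<s [set E | exists i, exists2 B : set R, measurable B & E = X i @^-1` B] >>.

(* Given sigma(X_0, X_1, ...), the Y_i are independent and Y_i has conditional
   density phi |-> rho0 (phi, X_i, xi_i) on S: the conditional probability of
   {Y_i \in A_i for all i} is the product over i of the integrals of these
   densities over A_i, conditional probability being characterized by its
   integrals over the events F of the conditioning sigma-algebra. *)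
Definition conditionally_sampled (rho0 : R * R * R -> R) (X : nat -> Omega -> R)
    n (xi : 'I_n -> R) (Y : 'I_n -> Omega -> R) : Prop :=
  forall (F : set Omega) (A : 'I_n -> set R),
    generated_sigma_algebra X F -> (forall i, measurable (A i)) ->
    Pr (F `&` \bigcap_(i in [set: 'I_n]) (Y i @^-1` A i)) =
    (\int[Pr]_(a in F) \prod_(i < n)
       \int[lebesgue_measure]_(phi in A i `&` circle)
         (rho0 (phi, X i a, xi i))%:E)%E.

End random_data.

(* Main.v *)
Require Import Defs.
From HB Require Import structures.
From mathcomp Require Import all_boot all_order all_algebra.
From mathcomp Require Import all_classical all_reals all_analysis.
From mathcomp Require Import measurable_realfun.
From mathcomp Require Import ring lra.

Set Implicit Arguments.
Unset Strict Implicit.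
Unset Printing Implicit Defensive.

Import Order.TTheory GRing.Theory Num.Theory.
Import numFieldNormedType.Exports.

Local Open Scope classical_set_scope.
Local Open Scope ring_scope.

(** The particle system and the mean field equation are the same dynamics applied
    to two different initial measures: both transport a measure [m] along the
    field [mean_field m] that [m] itself generates, and this field depends on [m]
    in a Lipschitz way. Two solutions which are close at time 0 in the bounded
    Lipschitz distance thus stay close on [0, T], by Gronwall's inequality; and
    the empirical measure is close to the limit at time 0 by a law of large
    numbers.

    Stability. The comparison goes through explicit Euler steps of length [h].
    One step applied to both measures multiplies their distance by at most
    [1 + h * growth], up to the mass neglected by a cutoff in [omega]
    ([euler_compare]). The exact dynamics stay close to their own Euler steps:
    for the particles by the mean value theorem ([mu_euler]); for the weak
    solution by testing the equation with the function transported along the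
    straight lines of the step ([nu_transport], [nu_euler]). Since the weak
    formulation only speaks of integrals over time, a du Bois-Reymond argument
    first turns it into a derivative in time of the averages of moving test
    functions ([weak_derivative_is_derive], [nu_phi_derive]); Lipschitz functions
    are handled by mollification in the angle. The frequencies are unbounded and
    so is the field: test functions are first restricted to [|omega| <= M], and
    the price of this cutoff is the mass [tail] of the initial density beyond
    [M], which is constant in time and small for large [M]. Iterating over [N]
    steps gives [bounded_lipschitz_stability], a bound of the distance, uniform
    in time, that is small for large [M], then large [N], then small initial
    distance.

    Initial data. A test function supported in [|omega| <= M] is uniformly close
    to a combination of finitely many cell functions, indicators of intervals in
    [theta] and [omega] times tents in [x] ([grid_close]), hence it is enough to
    treat one cell. The events that the [i]-th particle falls in the cell are
    independent ([cell_events_independent]); a Chernoff bound and the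
    Borel-Cantelli lemma show that the empirical average almost surely
    approaches the average of the probabilities, weighted by the tent
    ([strong_law_rows]). The weighted probabilities are the values at the points
    [xi] of a continuous function, the integral of which is the average of the
    cell function against the initial density, and the equidistribution of the
    points concludes ([cell_lln]). *)

(** * Continuous functions and weak derivatives *)

Section continuous_operations.
Context {R : realType} {X : topologicalType}.
Implicit Types f g : X -> R.

Lemma ctsD f g : continuous f -> continuous g -> continuous (fun x => f x + g x).
Proof. by move=> cf cg x; apply: cvgD; [exact: cf|exact: cg]. Qed.

Lemma ctsB f g : continuous f -> continuous g -> continuous (fun x => f x - g x).
Proof. by move=> cf cg x; apply: cvgB; [exact: cf|exact: cg]. Qed.

Lemma ctsN f : continuous f -> continuous (fun x => - f x).
Proof. by move=> cf x; apply: cvgN; exact: cf. Qed.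

Lemma ctsM f g : continuous f -> continuous g -> continuous (fun x => f x * g x).
Proof. by move=> cf cg x; apply: cvgM; [exact: cf|exact: cg]. Qed.

Lemma cts_cst (c : R) : continuous (fun _ : X => c).
Proof. exact: cst_continuous. Qed.

Lemma cts_comp (Y : topologicalType) (h : X -> Y) (f : Y -> R) :
  continuous f -> continuous h -> continuous (fun x => f (h x)).
Proof. by move=> cf ch x; apply: continuous_comp; [exact: ch|exact: cf]. Qed.

Lemma cts_max f g : continuous f -> continuous g ->
  continuous (fun x => Num.max (f x) (g x)).
Proof. by move=> cf cg x; apply: continuous_max; [exact: cf|exact: cg]. Qed.

Lemma cts_min f g : continuous f -> continuous g ->
  continuous (fun x => Num.min (f x) (g x)).
Proof. by move=> cf cg x; apply: continuous_min; [exact: cf|exact: cg]. Qed.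

Lemma cts_pair (Y Z : topologicalType) (h : X -> Y) (k : X -> Z) :
  continuous h -> continuous k -> continuous (fun x => (h x, k x)).
Proof. by move=> ch ck x; apply: cvg_pair; [exact: ch|exact: ck]. Qed.

(** Precomposing with a continuous map into [A], such as a projection onto [A],
    turns a function which is continuous on [A] only into a continuous one. *)
Lemma cts_within_comp (Y : topologicalType) (A : set Y) (F : Y -> R) (h : X -> Y) :
  {within A, continuous F} -> continuous h -> (forall x, A (h x)) ->
  continuous (fun x => F (h x)).
Proof.
move=> /subspace_continuousP cF ch hA x.
have cl : h @ x --> within A (nbhs (h x)).
  move=> S nS.
  have hS : \forall y \near x, A (h y) -> S (h y) by exact: (ch x _ nS).
  have : \forall y \near x, S (h y).
    by apply: filterS hS => y hS; exact: (hS (hA y)).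
  exact.
exact: (cvg_comp _ _ cl (cF _ (hA x))).
Qed.

End continuous_operations.

Lemma primitive_derive (R : realType) (f : R -> R) (a x : R) :
  continuous f -> a < x ->
  is_derive x (1 : R) (fun y : R => \int[lebesgue_measure]_(t in `[a, y]) f t) (f x).
Proof.
move=> cf ax.
have fi : (@lebesgue_measure R).-integrable `[a, x + 1] (EFin \o f).
  apply: continuous_compact_integrable; first exact: segment_compact.
  exact: continuous_subspaceT.
have x1 : x < x + 1 by rewrite ltrDl.
have [dF Fx] := continuous_FTC1_closed x1 fi ax (cf x).
apply: DeriveDef; first exact: dF.
by rewrite -derive1E; exact: Fx.
Qed.

Lemma is_derive_continuous (R : realType) (f : R -> R) (x df : R) :
  is_derive x (1 : R) f df -> {for x, continuous f}.
Proof. by move=> h; apply/differentiable_continuous/derivable1_diffP. Qed.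

Lemma integral_derive (R : realType) (F f : R -> R) (a b : R) :
  a <= b -> continuous f -> (forall t : R, a <= t -> is_derive t (1 : R) F (f t)) ->
  \int[lebesgue_measure]_(t in `[a, b]) f t = F b - F a.
Proof.
rewrite le_eqVlt => /predU1P[->|ab] cf dF.
  by rewrite subrr set_itv1 Rintegral_set1.
rewrite /Rintegral (@continuous_FTC2 R f F a b) //=.
- exact: continuous_subspaceT.
- have cF (t : R) : a <= t -> {for t, continuous F}.
    by move=> /dF; exact: is_derive_continuous.
  split.
  + by move=> t /[!in_itv]/= /andP[/ltW /dF[]].
  + exact/cvg_at_right_filter/cF.
  + exact/cvg_at_left_filter/cF/ltW.
- by move=> t /[!in_itv]/= /andP[/ltW /dF[? dFt] _]; rewrite derive1E.
Qed.

(** A du Bois-Reymond lemma. Put [D t = Phi t - Phi 0 - \int_0^t H], which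
    vanishes at 0. After an integration by parts the hypothesis says that
    [dchi * D] has integral 0, and [dchi = D * (T - t)] is an admissible choice,
    for which the integrand has a constant sign: hence [D = 0]. *)
Lemma weak_derivative_is_derive (R : realType) (T : R) (Phi H : R -> R) :
  0 < T -> continuous Phi -> continuous H ->
  (forall chi dchi : R -> R,
    (forall t : R, 0 <= t -> is_derive t (1 : R) chi (dchi t)) ->
    continuous dchi ->
    (forall t : R, T <= t -> chi t = 0) -> (forall t : R, T <= t -> dchi t = 0) ->
    \int[lebesgue_measure]_(t in `[0, T]) (dchi t * Phi t + chi t * H t)
      + chi 0 * Phi 0 = 0) ->
  forall t : R, 0 < t < T -> is_derive t (1 : R) Phi (H t).
Proof.
move=> T0 cPhi cH weak.
(* Primitives start at [-1] in order to be differentiable at [0], and composing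
   with [Num.max 0] makes functions continuous on the whole line. *)
pose I (y : R) := \int[lebesgue_measure]_(s in `[-1, y]) H s.
pose D y := Phi y - Phi 0 - (I (Num.max 0 y) - I 0).
have dI (t : R) : 0 <= t -> is_derive t (1 : R) I (H t).
  by move=> t0; apply: primitive_derive => //; lra.
have cmax (c : R) : continuous (fun y : R => Num.max c y).
  by move=> y; apply: (@continuous_max R _ (cst c) id) => //; exact: cst_continuous.
have cImax : continuous (fun y : R => I (Num.max 0 y)).
  move=> y; apply: (@continuous_comp _ _ _ (fun y : R => Num.max 0 y) I).
    exact: cmax.
  by apply: is_derive_continuous (dI _ _); rewrite le_max lexx.
have cD : continuous D.
  by apply: ctsB; apply: ctsB => //; exact: cts_cst.
pose psi (y : R) := D y * Num.max 0 (T - y).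
have cpsi : continuous psi.
  apply: ctsM => //; apply: cts_max; first exact: cts_cst.
  by apply: ctsB; [exact: cts_cst|move=> y; exact: cvg_id].
pose X (y : R) := \int[lebesgue_measure]_(s in `[-1, y]) psi s.
have dX (t : R) : 0 <= t -> is_derive t (1 : R) X (psi t).
  by move=> t0; apply: primitive_derive => //; lra.
have psiT (t : R) : T <= t -> psi t = 0.
  by move=> Tt; rewrite /psi (_ : Num.max _ _ = 0) ?mulr0//; apply/max_idPl; lra.
have XT (t : R) : T <= t -> X t = X T.
  move=> Tt; apply/eqP; rewrite -subr_eq0.
  have dXT (s : R) : T <= s -> is_derive s (1 : R) X (psi s).
    by move=> Ts; apply: dX; lra.
  rewrite -(integral_derive Tt cpsi dXT).
  rewrite (@eq_Rintegral _ _ _ _ _ (cst 0)) ?Rintegral_cst ?mul0r//.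
  by move=> s /[!inE]/= /[!in_itv]/= /andP[/psiT].
pose chi (y : R) := X y - X T.
have dchi (t : R) : 0 <= t -> is_derive t (1 : R) chi (psi t).
  move=> t0; rewrite /chi; have := dX _ t0 => ?.
  by apply: is_derive_eq; rewrite subr0.
have chiT (t : R) : T <= t -> chi t = 0 by move=> /XT; rewrite /chi => ->; rewrite subrr.
have := weak chi psi dchi cpsi chiT psiT.
(* Integration by parts: [G] is a primitive of the integrand, and [J] one of the
   nonnegative function [Q = psi * D]. *)
have cchi : forall t : R, 0 <= t -> {for t, continuous chi}.
  by move=> t /dchi; exact: is_derive_continuous.
have cmaxc (f : R -> R) : (forall t : R, 0 <= t -> {for t, continuous f}) ->
    continuous (fun y : R => f (Num.max 0 y)).
  move=> cf y; apply: (@continuous_comp _ _ _ (fun y : R => Num.max 0 y) f).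
    exact: cmax.
  by apply: cf; rewrite le_max lexx.
pose Q (y : R) := D y ^+ 2 * Num.max 0 (T - y).
have cQ : continuous Q.
  rewrite (_ : Q = (fun y : R => D y * psi y)); first exact: ctsM.
  by apply/funext => z; rewrite /Q /psi /= mulrA expr2.
pose J (y : R) := \int[lebesgue_measure]_(s in `[-1, y]) Q s.
have dJ (t : R) : 0 <= t -> is_derive t (1 : R) J (Q t).
  by move=> t0; apply: primitive_derive => //; lra.
pose G (y : R) := J y + chi y * (I y - I 0 + Phi 0).
have dG (t : R) : 0 <= t -> is_derive t (1 : R) G
    (psi t * Phi t + chi (Num.max 0 t) * H t).
  move=> t0; have := dJ _ t0 => ?; have := dI _ t0 => ?; have := dchi _ t0 => ?.
  apply: is_derive_eq.
  rewrite /Q /psi /D (max_idPr t0) /GRing.scale /=; ring.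
have -> : \int[lebesgue_measure]_(t in `[0, T]) (psi t * Phi t + chi t * H t)
   = G T - G 0.
  rewrite -(integral_derive _ _ dG); last 2 first.
  - exact: ltW.
  - by apply: ctsD; apply: ctsM => //; exact: (cmaxc chi).
  apply: eq_Rintegral => t /[!inE]/= /[!in_itv]/= /andP[t0 _].
  by rewrite (max_idPr t0).
rewrite /G chiT// mul0r addr0 subrr add0r opprD addrA subrK => JT0.
have Jmono (s t : R) : 0 <= s -> s <= t -> J s <= J t.
  move=> s0 st; rewrite -subr_ge0.
  have dJs (u : R) : s <= u -> is_derive u (1 : R) J (Q u).
    by move=> su; apply: dJ; lra.
  rewrite -(integral_derive st cQ dJs).
  by apply: Rintegral_ge0 => u _; rewrite mulr_ge0 ?sqr_ge0// le_max lexx.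
have JE (t : R) : 0 <= t <= T -> J t = J 0.
  move=> /andP[t0 tT]; have := Jmono _ _ t0 tT; have := Jmono _ _ (lexx 0) t0.
  lra.
have near01 (t : R) : 0 < t < T -> \forall y \near t, 0 < y < T.
  move=> tT; have : t \in `]0, T[ by rewrite in_itv.
  by move=> /near_in_itvoo; apply: filterS => y /[!in_itv].
have QE (t : R) : 0 < t < T -> Q t = 0.
  move=> tT; have : is_derive t (1 : R) (cst (J 0)) (Q t).
    apply: near_eq_is_derive (dJ t _); last lra.
    near=> y; apply/JE; suff : 0 < y < T by lra.
    by near: y; exact: near01.
  by case=> _ <-; rewrite derive_cst.
have DE (t : R) : 0 < t < T -> D t = 0.
  move=> tT; have := QE _ tT; rewrite /Q => /eqP; rewrite mulf_eq0 sqrf_eq0.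
  case/orP => [/eqP//|/eqP]; have -> : Num.max 0 (T - t) = T - t by apply/max_idPr; lra.
  lra.
move=> t tT.
have dIt : is_derive t (1 : R) I (H t) by apply: dI; lra.
have : is_derive t (1 : R) (fun y : R => I y - I 0 + Phi 0) (H t).
  by apply: is_derive_eq; rewrite subr0 addr0.
apply: near_eq_is_derive; near=> y.
have yT : 0 < y < T by near: y; exact: near01.
have := DE _ yT; rewrite /D (_ : Num.max 0 y = y); first lra.
by apply/max_idPr; lra.
Unshelve. all: by end_near. Qed.

(** * Measurability and iterated integrals *)

Lemma cvg_seq_pair (X Y : topologicalType) (u : nat -> X) (v : nat -> Y)
    (a : X) (b : Y) :
  u @ \oo --> a -> v @ \oo --> b -> (u m, v m) @[m --> \oo] --> (a, b).
Proof. by move=> ua vb; apply: cvg_pair; [exact: ua|exact: vb]. Qed.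

Section rounding.
Context {R : realType}.

Definition grid_round (m : nat) (x : R) : R :=
  (Num.floor (x * m.+1%:R))%:~R / m.+1%:R.

Lemma grid_round_dist m (x : R) : `|x - grid_round m x| <= m.+1%:R^-1.
Proof.
have m0 : (0 : R) < m.+1%:R by rewrite ltr0n.
rewrite -(ler_pM2r m0) mulVf ?gt_eqF// -[X in _ * X](gtr0_norm m0) -normrM mulrBl.
rewrite /grid_round divfK ?gt_eqF//.
have := floor_le (x * m.+1%:R); have := floorD1_gt (x * m.+1%:R).
by rewrite intrD ler_norml; lra.
Qed.

Lemma grid_round_cvg (x : R) : grid_round ^~ x @ \oo --> x.
Proof.
apply/cvgrPdist_le => e e0; near=> m; apply: le_trans (grid_round_dist m x) _.
near: m; have /cvgrPdist_le /(_ e e0) := @cvg_harmonic R.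
by apply: filterS => m /=; rewrite sub0r normrN ger0_norm ?invr_ge0.
Unshelve. all: by end_near. Qed.

Lemma measurable_floor_fiber m (k : int) :
  measurable [set x : R | Num.floor (x * m.+1%:R) = k].
Proof.
have m0 : (0 : R) < m.+1%:R by rewrite ltr0n.
rewrite (_ : [set _ | _] = `[k%:~R / m.+1%:R, (k + 1)%:~R / m.+1%:R[%classic) //.
apply/seteqP; split => x /=.
  move=> <-; rewrite in_itv/= ler_pdivrMr// ltr_pdivlMr//.
  by rewrite floor_le floorD1_gt.
rewrite in_itv/= ler_pdivrMr// ltr_pdivlMr//.
exact: floor_def.
Qed.

(** Rounding the arguments down to a grid turns [f] into functions with countably
    many values, each taken on a union of boxes; they converge to [f]. *)
Lemma continuous_measurable3 (f : R * R * R -> R) :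
  continuous f -> measurable_fun setT f.
Proof.
move=> cf.
apply: (@measurable_fun_cvg _ _ _ setT (fun m (P : R * R * R) =>
  f (grid_round m P.1.1, grid_round m P.1.2, grid_round m P.2))).
  move=> m _ Y mY; rewrite setTI.
  pose pt (k : int * int * int) : R * R * R :=
    (k.1.1%:~R / m.+1%:R, k.1.2%:~R / m.+1%:R, k.2%:~R / m.+1%:R).
  pose fiber (k : int) := [set x : R | Num.floor (x * m.+1%:R) = k].
  pose cell (k : int * int * int) : set (R * R * R) :=
    (fiber k.1.1 `*` fiber k.1.2) `*` fiber k.2.
  rewrite (_ : _ @^-1` Y = \bigcup_k if `[< Y (f (pt k)) >] then cell k else set0).
    apply: countable_bigcupT_measurable => // k.
    case: ifPn => _ //; apply: measurableX; first apply: measurableX;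
      exact: measurable_floor_fiber.
  apply/seteqP; split => P /=.
    move=> YP; exists (Num.floor (P.1.1 * m.+1%:R), Num.floor (P.1.2 * m.+1%:R),
      Num.floor (P.2 * m.+1%:R)) => //.
    by case: ifPn => [_|/asboolPn].
  move=> [k _]; case: ifPn => // /asboolP + [[]]; rewrite /fiber /pt /=.
  by move=> Yk k1 k2 k3; rewrite /grid_round k1 k2 k3.
move=> [[a b] c] _ /=.
have cq : (grid_round m a, grid_round m b, grid_round m c) @[m --> \oo] -->
    (a, b, c).
  by apply: cvg_seq_pair (cvg_seq_pair _ _) _; exact: grid_round_cvg.
exact: (cvg_comp _ _ cq (cf (a, b, c))).
Qed.

End rounding.

Section fubini_real.
Context d1 d2 (T1 : measurableType d1) (T2 : measurableType d2) (R : realType).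
Variables (m1 : {sigma_finite_measure set T1 -> \bar R})
          (m2 : {sigma_finite_measure set T2 -> \bar R}).

Lemma Rfubini (F : T1 * T2 -> R) :
  (m1 \x m2)%E.-integrable setT (EFin \o F) ->
  m2.-integrable setT (EFin \o (fun y => \int[m1]_x F (x, y))) /\
  \int[(m1 \x m2)%E]_z F z = \int[m2]_y \int[m1]_x F (x, y).
Proof.
move=> iF.
have mF : measurable_fun setT (EFin \o F) := measurable_int _ iF.
have mG0 := measurable_fubini_G iF.
have iG : m2.-integrable setT (fubini_G m1 (EFin \o F)).
  apply/integrableP; split=> //; have := (integrable21ltyP m1 m2 mF).1 iF; apply: le_lt_trans.
  have mabs : measurable_fun setT (abse \o (EFin \o F)) by exact: measurableT_comp.
  apply: ge0_le_integral => //.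
  - exact: measurableT_comp.
  - by apply: (measurable_fun_fubini_tonelli_G (abse \o (EFin \o F)) mabs) => z /=.
  - move=> y _; apply: le_abse_integral => //.
    exact: measurableT_comp mF (measurable_pair2 _).
have GE : ae_eq m2 setT (fubini_G m1 (EFin \o F))
    (EFin \o (fun y => \int[m1]_x F (x, y))).
  have := integrable_ae measurableT iG; apply: filterS => y /(_ I) Gy _.
  by rewrite /= /Rintegral fineK.
have mG : measurable_fun setT (fun y => \int[m1]_x F (x, y)).
  exact: (measurableT_comp (fine_measurable measurableT) mG0).
split.
  apply/integrableP; split; first exact/measurable_EFinP.
  case/integrableP : iG => m; apply: le_lt_trans.
  rewrite le_eqVlt; apply/orP; left; apply/eqP; apply: ae_eq_integral => //.
  - by apply: measurableT_comp => //; exact/measurable_EFinP.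
  - by apply: measurableT_comp.
  - by apply: filterS GE => y GEy yT; congr (abse _); exact/esym/GEy.
rewrite /Rintegral -(integral21_prod_meas1 iF); congr fine.
by apply: ae_eq_integral => //; exact/measurable_EFinP.
Qed.

End fubini_real.

(** The product of two sigma-finite measures under a name of its own: this is
    what makes its sigma-finiteness available to Fubini's theorem, hence makes
    it possible to iterate products. *)
Definition sigma_product d1 d2 (T1 : measurableType d1) (T2 : measurableType d2)
    (R : realType) (m1 : {sigma_finite_measure set T1 -> \bar R})
    (m2 : {sigma_finite_measure set T2 -> \bar R}) : set (T1 * T2) -> \bar R :=
  (m1 \x m2)%E.

Section sigma_product.
Context d1 d2 (T1 : measurableType d1) (T2 : measurableType d2) (R : realType).
Variables (m1 : {sigma_finite_measure set T1 -> \bar R})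
          (m2 : {sigma_finite_measure set T2 -> \bar R}).

HB.instance Definition _ := Measure.copy (sigma_product m1 m2) (m1 \x m2)%E.

Lemma sigma_product_sigma_finite : sigma_finite setT (sigma_product m1 m2).
Proof.
have [F1 [T1F ndF1 F1oo]] := (sigma_finiteP _ _).1 (sigma_finiteT m1).
have [F2 [T2F ndF2 F2oo]] := (sigma_finiteP _ _).1 (sigma_finiteT m2).
exists (fun n => F1 n `*` F2 n).
  apply/esym; rewrite -subTset => -[x y] _.
  have [n1 _ xn1] : (\bigcup_n F1 n) x by rewrite -T1F.
  have [n2 _ yn2] : (\bigcup_n F2 n) y by rewrite -T2F.
  exists (maxn n1 n2) => //; split => /=.
    by have /subsetPset := ndF1 _ _ (leq_maxl n1 n2); exact.
  by have /subsetPset := ndF2 _ _ (leq_maxr n1 n2); exact.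
move=> n; have [mF1 F1n] := F1oo n; have [mF2 F2n] := F2oo n.
split; first exact: measurableX.
by rewrite /sigma_product product_measure1E// lte_mul_pinfty// ge0_fin_numE.
Qed.

HB.instance Definition _ := Measure_isSigmaFinite.Build _ _ _
  (sigma_product m1 m2) sigma_product_sigma_finite.

End sigma_product.

Section fubini_assoc.
Context d1 d2 d3 (T1 : measurableType d1) (T2 : measurableType d2)
  (T3 : measurableType d3) (R : realType).
Variables (m1 : {sigma_finite_measure set T1 -> \bar R})
          (m2 : {sigma_finite_measure set T2 -> \bar R})
          (m3 : {sigma_finite_measure set T3 -> \bar R}).
Local Open Scope ereal_scope.

Let assoc (z : T1 * (T2 * T3)) : T1 * T2 * T3 := (z.1, z.2.1, z.2.2).

Let measurable_assoc : measurable_fun setT assoc.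
Proof.
apply: measurable_fun_pair; last first.
  exact: measurableT_comp measurable_snd measurable_snd.
apply: measurable_fun_pair; first exact: measurable_fst.
exact: measurableT_comp measurable_fst measurable_snd.
Qed.

Notation m12 := (sigma_product m1 m2).
Notation m23 := (sigma_product m2 m3).

(** Both sides are the same iterated integral. *)
Lemma tonelli_assoc (f : T1 * T2 * T3 -> \bar R) :
  measurable_fun setT f -> (forall z, 0 <= f z) ->
  \int[m12 \x m3]_z f z = \int[m1 \x m23]_z f (assoc z).
Proof.
move=> mf f0.
have mfa : measurable_fun setT (f \o assoc) by exact: measurableT_comp.
have fa0 z : 0 <= (f \o assoc) z by exact: f0.
have mH := @measurable_fun_fubini_tonelli_G _ _ _ _ R m1 (f \o assoc) mfa fa0.
have H0 z : 0 <= fubini_G m1 (f \o assoc) z.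
  by apply: integral_ge0 => x _; exact: f0.
have e1 := @fubini_tonelli2 _ _ _ _ R m12 m3 f mf f0.
have e2 := @fubini_tonelli2 _ _ _ _ R m1 m23 (f \o assoc) mfa fa0.
have e3 := @fubini_tonelli2 _ _ _ _ R m2 m3 (fubini_G m1 (f \o assoc)) mH H0.
apply: (etrans e1); apply/esym; apply: (etrans e2); apply: (etrans e3).
apply: eq_integral => y _.
have mfy : measurable_fun setT (fun z : T1 * T2 => f (z, y)).
  exact: measurableT_comp mf (measurable_pair2 _).
exact/esym/(@fubini_tonelli2 _ _ _ _ R m1 m2 (fun z => f (z, y)) mfy).
Qed.

Lemma fubini_assoc (F : T1 * T2 * T3 -> R) :
  (m12 \x m3).-integrable setT (EFin \o F) ->
  (m1 \x m23).-integrable setT (EFin \o (F \o assoc)) /\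
  (\int[(m12 \x m3)%E]_z F z = \int[(m1 \x m23)%E]_z F (assoc z))%R.
Proof.
move=> iF; have mF := measurable_int _ iF.
split.
  apply/integrableP; split.
    exact: (measurableT_comp mF measurable_assoc).
  have ma : measurable_fun setT (fun z => `|(F z)%:E|) by exact: measurableT_comp.
  have := tonelli_assoc ma (fun=> abse_ge0 _) => /= <-.
  by case/integrableP : iF.
have mp : measurable_fun setT (EFin \o F)^\+ by exact: measurable_funepos.
have mn : measurable_fun setT (EFin \o F)^\- by exact: measurable_funeneg.
rewrite /Rintegral; congr fine; rewrite integralE [RHS]integralE.
have ep := tonelli_assoc mp (funepos_ge0 _).
have en := tonelli_assoc mn (funeneg_ge0 _).
have pE : (fun z => (F (assoc z))%:E)^\+ = (EFin \o F)^\+ \o assoc.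
  exact: (funepos_comp (EFin \o F) assoc).
have nE : (fun z => (F (assoc z))%:E)^\- = (EFin \o F)^\- \o assoc.
  exact: (funeneg_comp (EFin \o F) assoc).
by rewrite pE nE; congr (_ - _); [exact: ep|exact: en].
Qed.

End fubini_assoc.

(** * Averages against a density *)

Section Gset_measurable.
Context {R : realType}.

Lemma GsetE : @Gset R = (circle `*` setT) `*` `[0, 1]%classic.
Proof. by apply/seteqP; split => -[[a b] c] /= [H ?]; split => //=; case: H. Qed.

Lemma measurable_Gset : measurable (@Gset R).
Proof.
rewrite GsetE; apply: measurableX; last exact: measurable_itv.
by apply: measurableX; [exact: measurable_itv|exact: measurableT].
Qed.

End Gset_measurable.

Section density_integral.
Context d (T : measurableType d) (R : realType).
Variables (mu : {measure set T -> \bar R}) (G : set T).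
Hypothesis mG : measurable G.
Implicit Types (u v r : T -> R).

Definition bounded_measurable_on u :=
  measurable_fun setT u /\ exists b, forall P, G P -> `|u P| <= b.
Local Notation bm := bounded_measurable_on.

Definition weighted_integral r u : R := \int[mu]_(P in G) (u P * r P).
Local Notation wint := weighted_integral.

Variable r : T -> R.
Hypothesis mr : measurable_fun G r.
Hypothesis r0 : forall P, G P -> 0 <= r P.
Hypothesis r1 : (\int[mu]_(P in G) (r P)%:E = 1)%E.

Lemma density_integrable : mu.-integrable G (EFin \o r).
Proof.
apply/integrableP; split; first exact/measurable_EFinP.
rewrite (eq_integral (EFin \o r)) => [|P /[!inE] GP]; last first.
  by rewrite /= ger0_norm// r0.
by rewrite r1 ltry.
Qed.

Lemma wint_integrable u : bm u ->
  mu.-integrable G (EFin \o (fun P => u P * r P)).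
Proof.
move=> [mfu [b ub]].
apply: (@integrableMr _ _ _ _ G mG u (EFin \o r)).
- exact: measurable_funTS.
- exists b; split; first exact: num_real.
  by move=> c bc P GP; apply: le_trans (ltW bc); exact: ub.
- exact: density_integrable.
Qed.

Lemma wintD u v : bm u -> bm v ->
  wint r (fun P => u P + v P) = wint r u + wint r v.
Proof.
move=> bu bv; rewrite /weighted_integral -(RintegralD mG).
- by apply: eq_Rintegral => P _; rewrite mulrDl.
- exact: wint_integrable.
- exact: wint_integrable.
Qed.

Lemma wintZ (c : R) u : bm u ->
  wint r (fun P => c * u P) = c * wint r u.
Proof.
move=> bu; rewrite /weighted_integral -(RintegralZl _ mG).
- by apply: eq_Rintegral => P _; rewrite mulrA.
- exact: wint_integrable.
Qed.

Lemma wintB u v : bm u -> bm v ->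
  wint r (fun P => u P - v P) = wint r u - wint r v.
Proof.
move=> bu bv; rewrite /weighted_integral -(RintegralB mG).
- by apply: eq_Rintegral => P _; rewrite mulrBl.
- exact: wint_integrable.
- exact: wint_integrable.
Qed.

Lemma le_wint u v : bm u -> bm v ->
  (forall P, G P -> u P <= v P) -> wint r u <= wint r v.
Proof.
move=> bu bv uv; apply: (le_Rintegral mG).
- exact: wint_integrable.
- exact: wint_integrable.
- by move=> P GP; rewrite ler_wpM2r ?uv//; exact: r0.
Qed.

Lemma wint_cst c : wint r (cst c) = c.
Proof.
rewrite /weighted_integral (RintegralZl _ mG); last exact: density_integrable.
by rewrite /Rintegral; rewrite r1; rewrite mulr1.
Qed.

Lemma bmo_cst c : bm (cst c).
Proof. by split; [exact: measurable_cst | exists `|c|]. Qed.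

Lemma wint_norm_le u b : bm u ->
  (forall P, G P -> `|u P| <= b) -> `|wint r u| <= b.
Proof.
move=> bu ub; rewrite ler_norml -[X in - X](wint_cst b) -[X in _ && (_ <= X)](wint_cst b).
rewrite -mulN1r -wintZ; last exact: bmo_cst.
have bc := bmo_cst b.
have bN : bm (fun _ => -1 * b) by exact: (bmo_cst (-1 * b)).
by apply/andP; split; apply: le_wint => // P GP; have := ub _ GP;
   rewrite ler_norml /cst; lra.
Qed.

End density_integral.

Lemma Rfubini3 d1 d2 d3 (T1 : measurableType d1) (T2 : measurableType d2)
    (T3 : measurableType d3) (R : realType)
    (m1 : {sigma_finite_measure set T1 -> \bar R})
    (m2 : {sigma_finite_measure set T2 -> \bar R})
    (m3 : {sigma_finite_measure set T3 -> \bar R})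
    (A : set T1) (C : set T3) (f : T1 * T2 * T3 -> R) :
  measurable A -> measurable C ->
  (sigma_product m1 m2 \x m3)%E.-integrable ((A `*` setT) `*` C) (EFin \o f) ->
  \int[(sigma_product m1 m2 \x m3)%E]_(P in (A `*` setT) `*` C) f P =
  \int[m3]_(y in C) \int[m2]_l \int[m1]_(x in A) f (x, l, y).
Proof.
move=> mA mC intf; rewrite Rintegral_mkcond [RHS]Rintegral_mkcond.
pose F := f \_ ((A `*` setT) `*` C).
have mACT : measurable ((A `*` [set: T2]) `*` C).
  by apply: measurableX => //; exact: measurableX.
have iF : (sigma_product m1 m2 \x m3)%E.-integrable setT (EFin \o F).
  rewrite -restrict_EFin.
  by apply/(integrable_restrict _ mACT measurableT _); rewrite setTI.
have [iF' FE] := fubini_assoc iF.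
have [iH HE] := Rfubini iF'.
have [_ HE2] := Rfubini iH.
transitivity (\int[m3]_y \int[m2]_l \int[m1]_x F (x, l, y)).
  by rewrite -HE2 -HE -FE.
apply: eq_Rintegral => y _; rewrite patchE; case: ifPn => yC.
  apply: eq_Rintegral => l _; rewrite [RHS]Rintegral_mkcond.
  apply: eq_Rintegral => x _; rewrite /F !patchE.
  congr (if _ then _ else _); apply/idP/idP; rewrite !inE.
    by case=> -[].
  by move=> Ax; split => //; move: yC; rewrite inE.
rewrite (@eq_Rintegral _ _ _ _ _ (cst 0)) ?Rintegral_cst ?mul0r// => l _.
rewrite (@eq_Rintegral _ _ _ _ _ (cst 0)) ?Rintegral_cst ?mul0r// => x _.
rewrite /F patchE ifF//; apply/negbTE; apply: contra yC.
by rewrite !inE => -[].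
Qed.

Section pairing.
Context {R : realType}.
Implicit Types (u v r : R * R * R -> R).

Definition bounded_measurable u :=
  measurable_fun setT u /\ exists b, forall P, Gset P -> `|u P| <= b.

Definition pairing r u : R := \int[lebesgue3]_(P in Gset) (u P * r P).

Lemma bounded_measurable_cst (c : R) : bounded_measurable (cst c).
Proof. exact: bmo_cst. Qed.

Lemma bounded_measurableZ (c : R) u :
  bounded_measurable u -> bounded_measurable (fun P => c * u P).
Proof.
move=> [mu [b ub]]; split; first exact: measurable_funM (measurable_cst _) mu.
by exists (`|c| * b) => P GP; rewrite normrM ler_wpM2l// ub.
Qed.

Lemma bounded_measurableD u v : bounded_measurable u -> bounded_measurable v ->
  bounded_measurable (fun P => u P + v P).
Proof.
move=> [mu [b ub]] [mv [c vc]]; split; first exact: measurable_funD.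
by exists (b + c) => P GP; apply: le_trans (ler_normD _ _) _; rewrite lerD ?ub ?vc.
Qed.

Lemma bounded_measurableB u v : bounded_measurable u -> bounded_measurable v ->
  bounded_measurable (fun P => u P - v P).
Proof.
move=> [mu [b ub]] [mv [c vc]]; split; first exact: measurable_funB.
by exists (b + c) => P GP; apply: le_trans (ler_normB _ _) _; rewrite lerD ?ub ?vc.
Qed.

Lemma bounded_measurableM u v : bounded_measurable u -> bounded_measurable v ->
  bounded_measurable (fun P => u P * v P).
Proof.
move=> [mu [b ub]] [mv [c vc]]; split; first exact: measurable_funM.
exists (b * c) => P GP; rewrite normrM.
by rewrite ler_pM ?ub ?vc.
Qed.

Section density.
Variable r : R * R * R -> R.
Hypothesis r_density : G_probability_density r.

Let mr := let: And3 mr _ _ := r_density in mr.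
Let r0 := let: And3 _ r0 _ := r_density in r0.
Let r1 := let: And3 _ _ r1 := r_density in r1.

Lemma pairing_integrable u : bounded_measurable u ->
  (@lebesgue3 R).-integrable Gset (EFin \o (fun P => u P * r P)).
Proof. exact: (@wint_integrable _ _ R (@lebesgue3 R) Gset measurable_Gset r mr r0 r1). Qed.

Lemma pairingD u v : bounded_measurable u -> bounded_measurable v ->
  pairing r (fun P => u P + v P) = pairing r u + pairing r v.
Proof. exact: (@wintD _ _ R (@lebesgue3 R) Gset measurable_Gset r mr r0 r1). Qed.

Lemma pairingZ (c : R) u : bounded_measurable u ->
  pairing r (fun P => c * u P) = c * pairing r u.
Proof. exact: (@wintZ _ _ R (@lebesgue3 R) Gset measurable_Gset r mr r0 r1). Qed.

Lemma pairingB u v : bounded_measurable u -> bounded_measurable v ->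
  pairing r (fun P => u P - v P) = pairing r u - pairing r v.
Proof. exact: (@wintB _ _ R (@lebesgue3 R) Gset measurable_Gset r mr r0 r1). Qed.

Lemma le_pairing u v : bounded_measurable u -> bounded_measurable v ->
  (forall P, Gset P -> u P <= v P) -> pairing r u <= pairing r v.
Proof. exact: (@le_wint _ _ R (@lebesgue3 R) Gset measurable_Gset r mr r0 r1). Qed.

Lemma pairing_cst c : pairing r (cst c) = c.
Proof. exact: (@wint_cst _ _ R (@lebesgue3 R) Gset measurable_Gset r mr r0 r1). Qed.

Lemma pairing_norm_le u b : bounded_measurable u ->
  (forall P, Gset P -> `|u P| <= b) -> `|pairing r u| <= b.
Proof. exact: (@wint_norm_le _ _ R (@lebesgue3 R) Gset measurable_Gset r mr r0 r1). Qed.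

(** The order of integration is the one of [velocity]. *)
Lemma pairing_fubini u : bounded_measurable u ->
  \int[lebesgue_measure]_(y in `[0, 1]) \int[lebesgue_measure]_lambda
    \int[lebesgue_measure]_(phi in circle)
      (u (phi, lambda, y) * r (phi, lambda, y)) = pairing r u.
Proof.
move=> bu; have := pairing_integrable bu; rewrite /pairing GsetE => iu.
have mc : measurable (@circle R) by exact: measurable_itv.
have m01 : measurable (`[0, 1]%classic : set R) by exact: measurable_itv.
exact/esym/(@Rfubini3 _ _ _ _ _ _ R lebesgue_measure lebesgue_measure
  lebesgue_measure circle `[0, 1]%classic (fun P => u P * r P) mc m01 iu).
Qed.

End density.
End pairing.

(** * The circle and bounded Lipschitz test functions *)

Lemma is_derive_chain (R : realType) (f g : R -> R) (x df dg : R) :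
  is_derive (g x) (1 : R) f df -> is_derive x (1 : R) g dg ->
  is_derive x (1 : R) (fun u : R => f (g u)) (df * dg).
Proof. exact: is_derive1_comp. Qed.

Section derivation_rules.
Context {R : realType}.
Implicit Types (f g : R -> R) (x c df dg : R).

Lemma derM f g x df dg : is_derive x (1 : R) f df -> is_derive x (1 : R) g dg ->
  is_derive x (1 : R) (fun u : R => f u * g u) (f x * dg + g x * df).
Proof. exact: is_deriveM. Qed.

Lemma derD f g x df dg : is_derive x (1 : R) f df -> is_derive x (1 : R) g dg ->
  is_derive x (1 : R) (fun u : R => f u + g u) (df + dg).
Proof. exact: is_deriveD. Qed.

Lemma derB f g x df dg : is_derive x (1 : R) f df -> is_derive x (1 : R) g dg ->
  is_derive x (1 : R) (fun u : R => f u - g u) (df - dg).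
Proof. exact: is_deriveB. Qed.

Lemma der_cst x c : is_derive x (1 : R) (fun=> c) 0.
Proof. exact: is_derive_cst. Qed.

Lemma der_id x : is_derive x (1 : R) (fun u : R => u) 1.
Proof. exact: is_derive_id. Qed.

Lemma derZ c f x df : is_derive x (1 : R) f df ->
  is_derive x (1 : R) (fun u : R => c * f u) (c * df).
Proof.
move=> dfx; have := derM (der_cst x c) dfx.
by rewrite mulr0 addr0.
Qed.

End derivation_rules.

Section circle_facts.
Context {R : realType}.
Implicit Types (f : R * R * R -> R) (P Q : R * R * R).

(** Angles move along the real line, and functions on the circle are functions of
    a real angle. *)
Definition theta_periodic f :=
  forall a b c : R, f (a + 2 * pi, b, c) = f (a, b, c).

Lemma twopi_gt0 : 0 < 2 * pi :> R.
Proof. by rewrite mulr_gt0// pi_gt0. Qed.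

Lemma theta_periodic_nat f (n : nat) a b c : theta_periodic f ->
  f (a + 2 * pi * n%:R, b, c) = f (a, b, c).
Proof.
move=> pf; elim: n => [|n IH]; first by rewrite mulr0 addr0.
by rewrite -[n.+1]addn1 natrD mulrDr mulr1 addrA pf.
Qed.

Lemma theta_periodic_int f (k : int) a b c : theta_periodic f ->
  f (a + 2 * pi * k%:~R, b, c) = f (a, b, c).
Proof.
move=> pf; case: k => n; first exact: theta_periodic_nat.
rewrite NegzE mulrNz mulrN.
by rewrite -(theta_periodic_nat n.+1 _ _ _ pf) subrK.
Qed.

Lemma theta_periodic_repr f P : theta_periodic f -> f (G_repr P) = f P.
Proof.
case: P => -[a b] c pf; rewrite /G_repr /circle_repr /=.
by rewrite -mulrN -mulrNz theta_periodic_int.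
Qed.

Lemma circle_repr_circle (a : R) : circle (circle_repr a).
Proof.
rewrite /circle /circle_repr /= in_itv/=.
have p0 := twopi_gt0.
have := floor_le (a / (2 * pi)); have := floorD1_gt (a / (2 * pi)).
rewrite ler_pdivlMr// ltr_pdivrMr// intrD; lra.
Qed.

Lemma circle_repr_id (a : R) : circle a -> circle_repr a = a.
Proof.
rewrite /circle /= in_itv/= => /andP[a0 a2].
rewrite /circle_repr (floor_def (m := 0)) ?mulr0 ?subr0//.
by rewrite add0r mulr0z mulr1z divr_ge0 ?ltr_pdivrMr ?mul1r ?twopi_gt0// ltW ?twopi_gt0.
Qed.

Lemma G_continuousW f : continuous f -> theta_periodic f -> G_continuous f.
Proof.
move=> cf pf; rewrite /G_continuous (_ : f \o G_repr = f).
  exact: continuous_subspaceT.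
by apply/funext => P /=; rewrite theta_periodic_repr.
Qed.

Definition clamp01 (x : R) : R := Num.max 0 (Num.min x 1).

Lemma clamp01_itv x : 0 <= clamp01 x <= 1.
Proof. by rewrite /clamp01 le_max lexx ge_max ler01 ge_min lexx orbT. Qed.

Lemma clamp01_id x : 0 <= x <= 1 -> clamp01 x = x.
Proof. by move=> /andP[x0 x1]; rewrite /clamp01 (min_idPl x1) (max_idPr x0). Qed.

Lemma clamp01_lip x y : `|clamp01 x - clamp01 y| <= `|x - y|.
Proof.
rewrite /clamp01.
case: (leP x 1) => x1; case: (leP y 1) => y1;
  rewrite ?(minElt x) ?(minElt y) /Num.max; do ?case: ifPn; rewrite -?leNgt; move=> *;
  rewrite ler_norml; have := ler_norm (x - y); have := ler_norm (y - x);
  rewrite distrC; lra.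
Qed.

Lemma clamp01_continuous : continuous clamp01.
Proof.
by apply: cts_max; [exact: cts_cst|apply: cts_min; [move=> x; exact: cvg_id|exact: cts_cst]].
Qed.

(** Functions on [Gset] become periodic functions on the whole space. *)
Definition G_extension f P : R := f (G_repr (P.1.1, P.1.2, clamp01 P.2)).

Lemma G_extensionE f a b x : circle a -> 0 <= x <= 1 ->
  G_extension f (a, b, x) = f (a, b, x).
Proof.
by move=> ca x01; rewrite /G_extension /G_repr /= circle_repr_id// clamp01_id.
Qed.

(** Easier to handle than the distance [dG] of the phase space, which it
    dominates, also after the angles are reduced modulo [2 pi]. *)
Definition dist1 P Q : R :=
  `|P.1.1 - Q.1.1| + `|P.1.2 - Q.1.2| + `|P.2 - Q.2|.

Lemma dist1_ge0 P Q : 0 <= dist1 P Q.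
Proof. by rewrite /dist1 !addr_ge0. Qed.

Lemma lipschitz_continuous3 f (C : R) :
  (forall P Q, `|f P - f Q| <= C * dist1 P Q) -> continuous f.
Proof.
move=> fC.
have C0 : 0 <= C.
  have := fC (0, 0, 0) (1, 0, 0); rewrite /dist1 /= !subrr !normr0 !addr0 sub0r normrN1 mulr1.
  exact: le_trans.
move=> P; apply/cvgrPdist_lt => e e0.
have d0 : 0 < e / (C + 1) / 3 by rewrite !divr_gt0// ltr_wpDl.
have : \forall Q \near P, ball P (e / (C + 1) / 3) Q by exact: nbhsx_ballx.
apply: filterS => Q [[/= b1 b2] b3].
rewrite /ball/= in b1 b2 b3.
apply: le_lt_trans (fC P Q) _.
have : dist1 P Q < e / (C + 1) by rewrite /dist1; lra.
rewrite ltr_pdivlMr; last by rewrite ltr_wpDl.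
have := dist1_ge0 P Q; nra.
Qed.

End circle_facts.

Section test_class.
Context {R : realType}.
Implicit Types (f : R * R * R -> R) (P Q : R * R * R).

(** The supports in [omega] are bounded, which makes the (otherwise unbounded)
    velocity field bounded on them. *)
Definition vanishes_beyond (M : R) f := forall P, M <= `|P.1.2| -> f P = 0.

Definition BL_cutoff (M : R) f :=
  [/\ forall P, `|f P| <= 1, forall P Q, `|f P - f Q| <= dist1 P Q,
      theta_periodic f & vanishes_beyond M f].

Lemma BL_cutoff_continuous M f : BL_cutoff M f -> continuous f.
Proof.
by case=> _ fl _ _; apply: (@lipschitz_continuous3 _ _ 1) => P Q; rewrite mul1r.
Qed.

(** The angles range over a closed interval to make the box compact. *)
Definition Gbox (M : R) : set (R * R * R) :=
  (`[0, 2 * pi] `*` `[- M, M]) `*` `[0, 1].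

Lemma compact_Gbox M : compact (Gbox M).
Proof.
by apply: compact_setX; first apply: compact_setX; exact: segment_compact.
Qed.

Lemma Gset_Gbox M P : Gset P -> `|P.1.2| <= M -> Gbox M P.
Proof.
case: P => -[a b] c [/= + c01]; rewrite /circle /= in_itv/= => /andP[a0 a2] bM.
split => //=; split => //=; rewrite in_itv/= ?a0 ?(ltW a2)//.
by rewrite -ler_norml.
Qed.

Lemma vanishes_bounded M f : continuous f -> vanishes_beyond M f ->
  exists b, forall P, Gset P -> `|f P| <= b.
Proof.
move=> cf vf.
have : compact (f @` Gbox M).
  by apply: continuous_compact; [exact: continuous_subspaceT|exact: compact_Gbox].
move=> /compact_bounded [b [_ fb]]; exists (Num.max 0 (b + 1)) => P GP.
have [PM|/ltW PM] := leP `|P.1.2| M; last by rewrite vf// normr0 le_max lexx.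
rewrite le_max; apply/orP; right; apply: fb; first by rewrite ltrDl.
by exists P => //; exact: Gset_Gbox.
Qed.

Lemma vanishes_bounded_measurable M f : continuous f -> vanishes_beyond M f ->
  bounded_measurable f.
Proof.
move=> cf vf; split; first exact: continuous_measurable3.
exact: vanishes_bounded cf vf.
Qed.

Lemma BL_cutoff_bounded_measurable M f : BL_cutoff M f -> bounded_measurable f.
Proof.
move=> Bf; split.
  exact: continuous_measurable3 (BL_cutoff_continuous Bf).
by exists 1 => P _; case: Bf.
Qed.

End test_class.

Section mollifier.
Context {R : realType}.
Implicit Types (f : R * R * R -> R) (P Q : R * R * R).

Lemma norm_integral01_le (h : R -> R) (b : R) : continuous h ->
  (forall u, 0 <= u <= 1 -> `|h u| <= b) ->
  `|\int[lebesgue_measure]_(u in `[0, 1]) h u| <= b.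
Proof.
move=> ch hb.
have ih : (@lebesgue_measure R).-integrable `[0, 1] (EFin \o h).
  apply: continuous_compact_integrable; first exact: segment_compact.
  exact: continuous_subspaceT.
have ib : (@lebesgue_measure R).-integrable `[0, 1] (EFin \o cst b).
  apply: continuous_compact_integrable; first exact: segment_compact.
  by apply: continuous_subspaceT; exact: cts_cst.
have h1 : `|\int[lebesgue_measure]_(u in `[0, 1]) h u| <=
    \int[lebesgue_measure]_(u in `[0, 1]) `|h u|.
  by apply: le_normr_Rintegral.
apply: (le_trans h1).
have h2 : \int[lebesgue_measure]_(u in `[0, 1]) `|h u| <=
    \int[lebesgue_measure]_(u in `[0, 1]) cst b u.
  by apply: le_Rintegral => //; exact: (integrable_norm ih).
apply: (le_trans h2).
by rewrite Rintegral_cst//= lebesgue_measure_itv/= lte_fin ltr01 sube0 /= mulr1.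
Qed.

(** A one-sided average, the derivative of which is a difference quotient of [f]:
    it inherits the Lipschitz constant of [f] in the angle. *)
Definition mollify (e : R) f P : R :=
  \int[lebesgue_measure]_(u in `[0, 1]) f (P.1.1 + e * u, P.1.2, P.2).

Variables (f : R * R * R -> R) (M e : R).
Hypotheses (e0 : 0 < e) (Bf : BL_cutoff M f).

Let csec P : continuous (fun u : R => f (P.1.1 + e * u, P.1.2, P.2)).
Proof.
apply: (cts_comp (BL_cutoff_continuous Bf)).
apply: cts_pair; last exact: cst_continuous.
apply: cts_pair; last exact: cst_continuous.
apply: ctsD; first exact: cts_cst.
by apply: ctsM; [exact: cts_cst|move=> x; exact: cvg_id].
Qed.

Lemma mollify_BL : BL_cutoff M (mollify e f).
Proof.
have [f1 fl fp fM] := Bf; split.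
- by move=> P; apply: norm_integral01_le.
- move=> P Q; rewrite /mollify -RintegralB//.
  + apply: norm_integral01_le => [|u _]; first exact: ctsB.
    apply: le_trans (fl _ _) _; rewrite /dist1/= opprD addrACA subrr addr0//.
  + apply: continuous_compact_integrable; first exact: segment_compact.
    exact: continuous_subspaceT.
  + apply: continuous_compact_integrable; first exact: segment_compact.
    exact: continuous_subspaceT.
- by move=> a b c; apply: eq_Rintegral => u _ /=; rewrite addrAC fp.
- move=> P PM; rewrite /mollify (@eq_Rintegral _ _ _ _ _ (cst 0)).
    by rewrite Rintegral_cst// mul0r.
  by move=> u _; rewrite fM.
Qed.

Lemma mollify_close P : `|mollify e f P - f P| <= e.
Proof.
have [f1 fl fp fM] := Bf.
have -> : f P = \int[lebesgue_measure]_(u in `[0, 1]) cst (f P) u.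
  rewrite Rintegral_cst//= lebesgue_measure_itv/= lte_fin ltr01 sube0 /=.
  by rewrite mulr1.
rewrite /mollify -RintegralB//.
- apply: norm_integral01_le => [|u /andP[u0 u1]].
    by apply: ctsB => //; exact: cts_cst.
  apply: le_trans (fl _ _) _; rewrite /dist1/= !subrr !normr0 !addr0.
  by rewrite addrAC subrr add0r ger0_norm ?mulr_ge0 ?(ltW e0)// ler_piMr// ltW.
- apply: continuous_compact_integrable; first exact: segment_compact.
  exact: continuous_subspaceT.
- apply: continuous_compact_integrable; first exact: segment_compact.
  by apply: continuous_subspaceT; exact: cts_cst.
Qed.

Definition dmollify P : R :=
  e^-1 * (f (P.1.1 + e, P.1.2, P.2) - f P).

Lemma mollify_derive P :
  is_derive P.1.1 (1 : R) (fun a => mollify e f (a, P.1.2, P.2)) (dmollify P).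
Proof.
case: P => -[a0 b] c /=.
pose h (y : R) := f (y, b, c).
have ch : continuous h.
  apply: (cts_comp (BL_cutoff_continuous Bf)).
  apply: cts_pair; last exact: cst_continuous.
  by apply: cts_pair; [move=> x; exact: cvg_id|exact: cst_continuous].
pose F (y : R) := \int[lebesgue_measure]_(s in `[a0 - 1, y]) h s.
have dF (y : R) : a0 - 1 < y -> is_derive y (1 : R) F (h y).
  exact: primitive_derive.
have mE (a : R) : a0 - 1 < a -> e^-1 * (F (a + e) - F a) = mollify e f (a, b, c).
  move=> a01; rewrite /mollify /=.
  have dG (u : R) : 0 <= u -> is_derive u (1 : R) (fun u => e^-1 * F (a + e * u)) (h (a + e * u)).
    move=> u0.
    have : is_derive (a + e * u) (1 : R) F (h (a + e * u)).
      by apply: dF; apply: lt_le_trans a01 _; rewrite lerDl mulr_ge0// ltW.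
    move=> ?.
    have dl : is_derive u (1 : R) (fun u : R => a + e * u) e.
      by have := derD (der_cst u a) (derZ e (der_id u)); rewrite add0r mulr1.
    have dFc : is_derive u (1 : R) (fun u : R => F (a + e * u)) (h (a + e * u) * e).
      exact: is_derive_chain.
    by have := derZ e^-1 dFc; rewrite mulrCA mulVf ?mulr1 ?gt_eqF.
  rewrite (integral_derive ler01 _ dG) ?mulr1 ?mulr0 ?addr0 ?mulrBr//.
  exact: (@csec (a, b, c)).
have : is_derive a0 (1 : R) (fun a => e^-1 * (F (a + e) - F a)) (dmollify (a0, b, c)).
  have d1 : is_derive a0 (1 : R) F (h a0) by apply: dF; rewrite ltrBlDr ltrDl.
  have d2 : is_derive (a0 + e) (1 : R) F (h (a0 + e)).
    by apply: dF; rewrite ltrBlDr -addrA ltrDl addr_gt0.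
  have ds : is_derive a0 (1 : R) (fun a : R => a + e) 1.
    by have := derD (der_id a0) (der_cst a0 e); rewrite addr0.
  have d3 : is_derive a0 (1 : R) (fun a : R => F (a + e)) (h (a0 + e) * 1).
    exact: is_derive_chain.
  by have := derZ e^-1 (derB d3 d1); rewrite mulr1.
apply: near_eq_is_derive; near=> a; apply: mE.
by near: a; apply: lt_nbhsr; rewrite ltrBlDr ltrDl.
Unshelve. all: by end_near. Qed.

Lemma dmollify_continuous : continuous dmollify.
Proof.
apply: ctsM; first exact: cts_cst.
apply: ctsB; last exact: BL_cutoff_continuous Bf.
apply: (cts_comp (BL_cutoff_continuous Bf)).
apply: cts_pair; last by move=> x; exact: cvg_snd.
apply: cts_pair; last by move=> x; apply: cvg_comp; [exact: cvg_fst|exact: cvg_snd].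
apply: ctsD; last exact: cts_cst.
by move=> x; apply: cvg_comp; [exact: cvg_fst|exact: cvg_fst].
Qed.

Lemma dmollify_periodic : theta_periodic dmollify.
Proof. by case: Bf => _ _ fp _ a b c; rewrite /dmollify /= addrAC !fp. Qed.

Lemma dmollify_vanishes : vanishes_beyond M dmollify.
Proof. by case: Bf => _ _ _ fM P PM; rewrite /dmollify !fM// subrr mulr0. Qed.

Lemma dmollify_bound (l : R) P :
  (forall a a' b c, `|f (a, b, c) - f (a', b, c)| <= l * `|a - a'|) ->
  `|dmollify P| <= l.
Proof.
case: P => -[a b] c fl; rewrite /dmollify /= normrM gtr0_norm ?invr_gt0//.
rewrite ler_pdivrMl//; apply: le_trans (fl _ _ _ _) _.
by rewrite addrAC subrr add0r gtr0_norm// mulrC.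
Qed.

End mollifier.

(** * The field generated by the limit density *)

Section projections_continuous.
Context {R : realType}.

Lemma cts_theta : continuous (fun P : R * R * R => P.1.1).
Proof. by move=> x; apply: cvg_comp; [exact: cvg_fst|exact: cvg_fst]. Qed.

Lemma cts_omega : continuous (fun P : R * R * R => P.1.2).
Proof. by move=> x; apply: cvg_comp; [exact: cvg_fst|exact: cvg_snd]. Qed.

Lemma cts_pos : continuous (fun P : R * R * R => P.2).
Proof. by move=> x; exact: cvg_snd. Qed.

End projections_continuous.

(** Continuity in time is uniform over the compact box. *)
Lemma near_Gbox (R : realType) (u : R -> R * R * R -> R) (M t0 e : R) :
  continuous (fun z : R * (R * R * R) => u z.1 z.2) -> 0 < e ->
  \forall t \near t0, forall P, Gbox M P -> `|u t P - u t0 P| < e.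
Proof.
move=> cu e0.
have nc := (compact_near_coveringP (Gbox M)).1 (@compact_Gbox R M).
have := nc R (nbhs t0) (fun t P => `|u t P - u t0 P| < e) _.
apply => P _.
have e20 : 0 < e / 2 by lra.
have /cvgrPdist_lt /(_ (e / 2) e20) := cu (t0, P).
case=> -[A B] /= [At0 BP] AB.
exists (B, A) => // -[Q t] /= [BQ At].
have h1 := AB (t, Q) (conj At BQ).
have h2 := AB (t0, Q) (conj (nbhs_singleton At0) BQ).
rewrite /= in h1 h2.
have -> : u t Q - u t0 Q = (u t0 P - u t0 Q) - (u t0 P - u t Q) by lra.
by apply: le_lt_trans (ler_normB _ _) _; lra.
Qed.

Section mean_field.
Context {R : realType}.
Variables (T K : R) (W : R * R -> R) (rho : R -> R * R * R -> R).
Variables (rho_init : R * R * R -> R) (B L : R).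
Hypothesis T0 : 0 < T.
Hypothesis WB : forall x y, 0 <= x <= 1 -> 0 <= y <= 1 -> `|W (x, y)| <= B.
Hypothesis WL : forall x y x' y', 0 <= x <= 1 -> 0 <= y <= 1 ->
  0 <= x' <= 1 -> 0 <= y' <= 1 ->
  `|W (x, y) - W (x', y')| <= L * (`|x - x'| + `|y - y'|).
Hypothesis L0 : 0 <= L.
Hypothesis rho_weak : weak_solution T K W rho_init rho.

Definition Wclamp (x y : R) : R := W (clamp01 x, clamp01 y).

Lemma Wclamp_bound x y : `|Wclamp x y| <= B.
Proof. by apply: WB; exact: clamp01_itv. Qed.

Lemma Wclamp_lip x y x' y' :
  `|Wclamp x y - Wclamp x' y'| <= L * (`|x - x'| + `|y - y'|).
Proof.
apply: le_trans (WL (clamp01_itv _) (clamp01_itv _) (clamp01_itv _) (clamp01_itv _)) _.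
by rewrite ler_wpM2l// lerD ?clamp01_lip.
Qed.

Lemma Wclamp_continuous x : continuous (Wclamp x).
Proof.
move=> y; apply/cvgrPdist_lt => e e0.
have d0 : 0 < e / (L + 1) by rewrite divr_gt0// ltr_wpDl.
have : \forall z \near y, ball y (e / (L + 1)) z by exact: nbhsx_ballx.
apply: filterS => z; rewrite /ball/= => yz.
apply: le_lt_trans (Wclamp_lip _ _ _ _) _; rewrite subrr normr0 add0r.
move: yz; rewrite ltr_pdivlMr; last by rewrite ltr_wpDl.
by have := normr_ge0 (y - z); nra.
Qed.

(** Freezing time outside [0, T] extends the averages of the weak solution to
    continuous functions of a real variable. *)
Definition clampT (t : R) : R := Num.max 0 (Num.min t T).

Lemma clampT_itv t : 0 <= clampT t <= T.
Proof.
by rewrite /clampT le_max lexx ge_max (ltW T0) ge_min lexx orbT.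
Qed.

Lemma clampT_id t : 0 <= t <= T -> clampT t = t.
Proof. by move=> /andP[t0 tT]; rewrite /clampT (min_idPl tT) (max_idPr t0). Qed.

Lemma clampT_continuous : continuous clampT.
Proof.
by apply: cts_max; [exact: cts_cst|apply: cts_min; [move=> x; exact: cvg_id|exact: cts_cst]].
Qed.

Local Notation nu t := (pairing (rho (clampT t))).

Lemma rho_density t : G_probability_density (rho (clampT t)).
Proof. by case: rho_weak => + _ _ _; apply; exact: clampT_itv. Qed.

Lemma nu_weakly_continuous f : continuous f -> theta_periodic f ->
  (exists b, forall P, Gset P -> `|f P| <= b) ->
  continuous (fun t => nu t f).
Proof.
move=> cf pf [b fb]; case: rho_weak => _ wc _ _.
have bf : [bounded f P | P in Gset].
  exists b; split; first exact: num_real.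
  by move=> c bc P GP; apply: le_trans (ltW bc); exact: fb.
apply: (cts_within_comp (wc f (G_continuousW cf pf) bf) clampT_continuous) => t.
by rewrite /= in_itv/= clampT_itv.
Qed.

(** Weak continuity in time survives when the test function itself moves
    continuously, because it moves uniformly on the compact support. *)
Lemma nu_continuous (u : R -> R * R * R -> R) M :
  continuous (fun z : R * (R * R * R) => u z.1 z.2) ->
  (forall t, theta_periodic (u t)) -> (forall t, vanishes_beyond M (u t)) ->
  continuous (fun t => nu t (u t)).
Proof.
move=> cu pu vu t0.
have cut t : continuous (u t).
  apply: (cts_comp (h := fun P => (t, P)) cu).
  by apply: cts_pair; [exact: cst_continuous|move=> x; exact: cvg_id].
have but t := vanishes_bounded_measurable (cut t) (vu t).
apply/cvgrPdist_lt => e e0; have e20 : 0 < e / 2 by lra.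
have n1 := near_Gbox M t0 cu e20.
have cnu : continuous (fun t => nu t (u t0)).
  apply: nu_weakly_continuous => //; exact: vanishes_bounded (vu t0).
have /cvgrPdist_lt /(_ (e / 2) e20) n2 := cnu t0.
near=> t.
have -> : nu t0 (u t0) - nu t (u t) =
    (nu t0 (u t0) - nu t (u t0)) + nu t (fun P => u t0 P - u t P).
  by rewrite pairingB ?subrKA//; exact: rho_density.
apply: le_lt_trans (ler_normD _ _) _.
have h1 : `|nu t0 (u t0) - nu t (u t0)| < e / 2 by near: t; exact: n2.
have h2 : `|nu t (fun P => u t0 P - u t P)| <= e / 2.
  apply: pairing_norm_le; first exact: rho_density.
    apply: (@vanishes_bounded_measurable _ M); first exact: ctsB.
    by move=> P PM; rewrite !vu// subrr.
  move=> P GP; have [PM|/ltW PM] := leP `|P.1.2| M.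
    rewrite distrC; apply/ltW; move: (Gset_Gbox GP PM); move: P {GP PM}.
    by near: t.
  by rewrite !vu// subrr normr0 ltW.
lra.
Unshelve. all: by end_near. Qed.

(** By the addition formula for the sine, the field depends on the limit density
    through the moments for [q = sin] and [q = cos] only: continuity and
    derivatives in the angle can be read off. *)
Definition coupling_moment (q : R -> R) (t x : R) : R :=
  nu t (fun Q => Wclamp x Q.2 * q Q.1.1).

Section coupling_moment.
Variable q : R -> R.
Hypotheses (cq : continuous q) (q1 : forall a, `|q a| <= 1)
  (qp : forall a, q (a + 2 * pi) = q a).

Let kerc x : continuous (fun Q : R * R * R => Wclamp x Q.2 * q Q.1.1).
Proof.
apply: ctsM; first exact: (cts_comp (@Wclamp_continuous x) cts_pos).
exact: (cts_comp cq cts_theta).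
Qed.

Lemma coupling_kernel_bm x :
  bounded_measurable (fun Q : R * R * R => Wclamp x Q.2 * q Q.1.1).
Proof.
split; first exact: continuous_measurable3.
exists B => P _; rewrite normrM; apply: le_trans (Wclamp_bound x P.2).
by rewrite ler_piMr.
Qed.

Lemma coupling_moment_lip t x y :
  `|coupling_moment q t x - coupling_moment q t y| <= L * `|x - y|.
Proof.
rewrite /coupling_moment -pairingB; first last.
- exact: coupling_kernel_bm.
- exact: coupling_kernel_bm.
- exact: rho_density.
apply: pairing_norm_le; first exact: rho_density.
  by apply: bounded_measurableB; exact: coupling_kernel_bm.
move=> P _; rewrite -mulrBl normrM.
apply: le_trans (_ : `|Wclamp x P.2 - Wclamp y P.2| <= _); first by rewrite ler_piMr.
by have := Wclamp_lip x P.2 y P.2; rewrite subrr normr0 addr0.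
Qed.

Lemma coupling_moment_continuous :
  continuous (fun z : R * R => coupling_moment q z.1 z.2).
Proof.
move=> [t0 x0]; apply/cvgrPdist_lt => e e0.
have e20 : 0 < e / 2 by lra.
have d0 : 0 < e / 2 / (L + 1) by rewrite divr_gt0// ltr_wpDl.
have cnu : continuous (fun t => coupling_moment q t x0).
  apply: nu_weakly_continuous; [exact: kerc| |exact: (coupling_kernel_bm x0).2].
  by move=> a b c /=; rewrite qp.
have /cvgrPdist_lt /(_ (e / 2) e20) nt := cnu t0.
have nx : \forall x \near x0, ball x0 (e / 2 / (L + 1)) x by exact: nbhsx_ballx.
exists ([set t | `|coupling_moment q t0 x0 - coupling_moment q t x0| < e / 2],
        ball x0 (e / 2 / (L + 1))) => //= -[t x] /= [ht].
rewrite /ball/= => hx; have hl := coupling_moment_lip t x0 x.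
have -> : coupling_moment q t0 x0 - coupling_moment q t x =
  (coupling_moment q t0 x0 - coupling_moment q t x0) +
  (coupling_moment q t x0 - coupling_moment q t x) by lra.
apply: le_lt_trans (ler_normD _ _) _.
move: hx; rewrite ltr_pdivlMr; last by rewrite ltr_wpDl.
by have := normr_ge0 (x0 - x); nra.
Qed.

End coupling_moment.

Definition field (t : R) (P : R * R * R) : R :=
  P.1.2 + K * (coupling_moment sin t P.2 * cos P.1.1
               - coupling_moment cos t P.2 * sin P.1.1).

Definition dfield (t : R) (P : R * R * R) : R :=
  - (K * (coupling_moment sin t P.2 * sin P.1.1
          + coupling_moment cos t P.2 * cos P.1.1)).

Lemma abs_sin_le1 (a : R) : `|sin a| <= 1.
Proof. by rewrite ler_norml sin_geN1 trigo.sin_le1. Qed.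

Lemma abs_cos_le1 (a : R) : `|cos a| <= 1.
Proof. by rewrite ler_norml cos_geN1 trigo.cos_le1. Qed.

Lemma sin_2pi (a : R) : sin (a + 2 * pi) = sin a.
Proof. by rewrite mulr_natl sinD2pi. Qed.

Lemma cos_2pi (a : R) : cos (a + 2 * pi) = cos a.
Proof. by rewrite mulr_natl cosD2pi. Qed.

Lemma field_continuous : continuous (fun z : R * (R * R * R) => field z.1 z.2).
Proof.
have ct : continuous (fun z : R * (R * R * R) => z.2.1.1).
  exact: (cts_comp (h := snd) cts_theta (fun x => cvg_snd)).
have cp : continuous (fun z : R * (R * R * R) => (z.1, z.2.2)).
  apply: cts_pair; first by move=> x; exact: cvg_fst.
  exact: (cts_comp (h := snd) cts_pos (fun x => cvg_snd)).
apply: ctsD; first exact: (cts_comp (h := snd) cts_omega (fun x => cvg_snd)).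
apply: ctsM; first exact: cts_cst.
apply: ctsB; apply: ctsM.
- exact: (cts_comp (coupling_moment_continuous (@continuous_sin R) abs_sin_le1 sin_2pi) cp).
- exact: (cts_comp (@continuous_cos R) ct).
- exact: (cts_comp (coupling_moment_continuous (@continuous_cos R) abs_cos_le1 cos_2pi) cp).
- exact: (cts_comp (@continuous_sin R) ct).
Qed.

Lemma dfield_continuous : continuous (fun z : R * (R * R * R) => dfield z.1 z.2).
Proof.
have ct : continuous (fun z : R * (R * R * R) => z.2.1.1).
  exact: (cts_comp (h := snd) cts_theta (fun x => cvg_snd)).
have cp : continuous (fun z : R * (R * R * R) => (z.1, z.2.2)).
  apply: cts_pair; first by move=> x; exact: cvg_fst.
  exact: (cts_comp (h := snd) cts_pos (fun x => cvg_snd)).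
apply: ctsN; apply: ctsM; first exact: cts_cst.
apply: ctsD; apply: ctsM.
- exact: (cts_comp (coupling_moment_continuous (@continuous_sin R) abs_sin_le1 sin_2pi) cp).
- exact: (cts_comp (@continuous_sin R) ct).
- exact: (cts_comp (coupling_moment_continuous (@continuous_cos R) abs_cos_le1 cos_2pi) cp).
- exact: (cts_comp (@continuous_cos R) ct).
Qed.

Lemma field_periodic t : theta_periodic (field t).
Proof. by move=> a b c; rewrite /field /= sin_2pi cos_2pi. Qed.

Lemma dfield_periodic t : theta_periodic (dfield t).
Proof. by move=> a b c; rewrite /dfield /= sin_2pi cos_2pi. Qed.

Lemma field_derive t P :
  is_derive P.1.1 (1 : R) (fun a => field t (a, P.1.2, P.2)) (dfield t P).
Proof.
case: P => -[a b] c; rewrite /field /dfield /=.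
have h := derD (der_cst a b) (derZ K (derB
  (derZ (coupling_moment sin t c) (is_derive_cos a))
  (derZ (coupling_moment cos t c) (is_derive_sin a)))).
by apply: (is_derive_eq h); ring.
Qed.

(** The interaction part of the field, as a single average. *)
Definition interaction (t : R) (a x : R) : R :=
  nu t (fun Q => Wclamp x Q.2 * sin (Q.1.1 - a)).

Lemma interactionE t a x : interaction t a x =
  coupling_moment sin t x * cos a - coupling_moment cos t x * sin a.
Proof.
have bs := coupling_kernel_bm (@continuous_sin R) abs_sin_le1 x.
have bc := coupling_kernel_bm (@continuous_cos R) abs_cos_le1 x.
have rd := rho_density t.
rewrite /coupling_moment [X in X - _]mulrC [X in _ - X]mulrC.
rewrite -(pairingZ rd _ bs) -(pairingZ rd _ bc) -(pairingB rd); last 2 first.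
- exact: bounded_measurableZ.
- exact: bounded_measurableZ.
by apply: eq_Rintegral => Q _; rewrite sinB; ring.
Qed.

Lemma fieldE t P : field t P = P.1.2 + K * interaction t P.1.1 P.2.
Proof. by rewrite interactionE. Qed.

Lemma interaction_kernel_bm x a :
  bounded_measurable (fun Q : R * R * R => Wclamp x Q.2 * sin (Q.1.1 - a)).
Proof.
apply: (@coupling_kernel_bm (fun s => sin (s - a))) => [|s]; last exact: abs_sin_le1.
apply: (cts_comp (@continuous_sin R)).
by apply: ctsB; [move=> s; exact: cvg_id|exact: cts_cst].
Qed.

Lemma interaction_bound t a x : `|interaction t a x| <= B.
Proof.
apply: pairing_norm_le; [exact: rho_density|exact: interaction_kernel_bm|].
move=> P _; rewrite normrM; apply: le_trans (Wclamp_bound x P.2).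
by rewrite ler_piMr// abs_sin_le1.
Qed.

(** Differentiating the sine is a shift by a quarter turn, so the bound on the
    interaction also bounds its derivative. *)
Lemma dfieldE t P : dfield t P = - (K * interaction t (P.1.1 - pi / 2) P.2).
Proof. by rewrite /dfield interactionE cosBpihalf sinBpihalf; ring. Qed.

Lemma dfield_bound t P : `|dfield t P| <= `|K| * B.
Proof. by rewrite dfieldE normrN normrM ler_wpM2l// interaction_bound. Qed.

Lemma velocityE t P : 0 <= t <= T -> Gset P ->
  velocity K W rho t P = field t P.
Proof.
move=> tT [_ P01]; rewrite /velocity fieldE; congr (_ + _ * _).
rewrite /interaction -(pairing_fubini (rho_density t)); last exact: interaction_kernel_bm.
apply: eq_Rintegral => y; rewrite inE/= in_itv/= => y01.
apply: eq_Rintegral => l _; apply: eq_Rintegral => phi _ /=.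
rewrite clampT_id// /Wclamp !clamp01_id//.
Qed.

End mean_field.

(** * Transport by the weak solution *)

Section transport.
Context {R : realType}.
Variables (T K : R) (W : R * R -> R) (rho : R -> R * R * R -> R).
Variables (rho_init : R * R * R -> R) (B L : R).
Hypothesis T0 : 0 < T.
Hypothesis WB : forall x y, 0 <= x <= 1 -> 0 <= y <= 1 -> `|W (x, y)| <= B.
Hypothesis WL : forall x y x' y', 0 <= x <= 1 -> 0 <= y <= 1 ->
  0 <= x' <= 1 -> 0 <= y' <= 1 ->
  `|W (x, y) - W (x', y')| <= L * (`|x - x'| + `|y - y'|).
Hypothesis L0 : 0 <= L.
Hypothesis rho_weak : weak_solution T K W rho_init rho.

Local Notation nu t := (pairing (rho (clampT T t))).
Local Notation field := (field T K W rho).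

Let rd t := rho_density T0 rho_weak t.

Section smooth_transport.
Variables (f df U dU : R * R * R -> R) (M tau : R).
Hypotheses (cf : continuous f) (cdf : continuous df)
  (pf : theta_periodic f) (pdf : theta_periodic df)
  (vf : vanishes_beyond M f) (vdf : vanishes_beyond M df)
  (dfE : forall P, is_derive P.1.1 (1 : R) (fun a => f (a, P.1.2, P.2)) (df P)).
Hypotheses (cU : continuous U) (cdU : continuous dU)
  (pU : theta_periodic U) (pdU : theta_periodic dU)
  (dUE : forall P, is_derive P.1.1 (1 : R) (fun a => U (a, P.1.2, P.2)) (dU P)).

(** [phi t P] is the value of [f] reached at time [tau] when leaving [P] at time
    [t] with the constant speed [U P]; [phit] and [phith] are its derivatives in
    [t] and in the angle. *)
Let shift t (P : R * R * R) := (P.1.1 + (tau - t) * U P, P.1.2, P.2).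
Let phi t P := f (shift t P).
Let phit t P := - (df (shift t P) * U P).
Let phith t P := df (shift t P) * (1 + (tau - t) * dU P).

Let cts_snd3 (g : R * R * R -> R) : continuous g ->
  continuous (fun z : R * (R * R * R) => g z.2).
Proof. by move=> cg; apply: (cts_comp (h := snd) cg) => x; exact: cvg_snd. Qed.

Let cts_tau : continuous (fun z : R * (R * R * R) => tau - z.1).
Proof. by apply: ctsB; [exact: cts_cst|move=> x; exact: cvg_fst]. Qed.

Let cshift : continuous (fun z : R * (R * R * R) => shift z.1 z.2).
Proof.
apply: cts_pair; last exact: (cts_snd3 cts_pos).
apply: cts_pair; last exact: (cts_snd3 cts_omega).
apply: ctsD; first exact: (cts_snd3 cts_theta).
by apply: ctsM => //; exact: cts_snd3.
Qed.

Let cphi : continuous (fun z : R * (R * R * R) => phi z.1 z.2).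
Proof. exact: (cts_comp cf cshift). Qed.

Let cphit : continuous (fun z : R * (R * R * R) => phit z.1 z.2).
Proof.
apply: ctsN; apply: ctsM; last exact: cts_snd3.
exact: (cts_comp cdf cshift).
Qed.

Let cphith : continuous (fun z : R * (R * R * R) => phith z.1 z.2).
Proof.
apply: ctsM; first exact: (cts_comp cdf cshift).
apply: ctsD; first exact: cts_cst.
by apply: ctsM => //; exact: cts_snd3.
Qed.

Let pshift t a b c : shift t (a + 2 * pi, b, c) =
  ((shift t (a, b, c)).1.1 + 2 * pi, b, c).
Proof. by rewrite /shift /= pU addrAC. Qed.

Let pphi t : theta_periodic (phi t).
Proof. by move=> a b c; rewrite /phi pshift pf. Qed.

Let pphit t : theta_periodic (phit t).
Proof. by move=> a b c; rewrite /phit pshift pdf pU. Qed.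

Let pphith t : theta_periodic (phith t).
Proof. by move=> a b c; rewrite /phith pshift pdf pdU. Qed.

Let vphi t : vanishes_beyond M (phi t).
Proof. by move=> P PM; rewrite /phi vf. Qed.

Let vphit t : vanishes_beyond M (phit t).
Proof. by move=> P PM; rewrite /phit vdf// mul0r oppr0. Qed.

Let vphith t : vanishes_beyond M (phith t).
Proof. by move=> P PM; rewrite /phith vdf// mul0r. Qed.

Let dphit t P : is_derive t (1 : R) (phi ^~ P) (phit t P).
Proof.
case: P => -[a b] c; rewrite /phi /phit.
have ds : is_derive t (1 : R) (fun s => a + (tau - s) * U (a, b, c)) (- U (a, b, c)).
  have := derD (der_cst t a)
    (derM (derB (der_cst t tau) (der_id t)) (der_cst t (U (a, b, c)))).
  by move=> h; apply: (is_derive_eq h); ring.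
have := @is_derive_chain R (fun a => f (a, b, c))
  (fun s => a + (tau - s) * U (a, b, c)) _ _ _ (dfE (shift t (a, b, c))) ds.
by move=> h; apply: (is_derive_eq h); rewrite mulrN.
Qed.

Let dphith t P :
  is_derive P.1.1 (1 : R) (fun a => phi t (a, P.1.2, P.2)) (phith t P).
Proof.
case: P => -[a b] c; rewrite /phi /phith /=.
have ds : is_derive a (1 : R) (fun y => y + (tau - t) * U (y, b, c))
    (1 + (tau - t) * dU (a, b, c)).
  exact: (derD (der_id a) (derZ (tau - t) (dUE (a, b, c)))).
exact: (@is_derive_chain R (fun a => f (a, b, c))
  (fun y => y + (tau - t) * U (y, b, c)) _ _ _ (dfE (shift t (a, b, c))) ds).
Qed.

Let cts_sec (u : R -> R * R * R -> R) t :
  continuous (fun z : R * (R * R * R) => u z.1 z.2) -> continuous (u t).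
Proof.
move=> cu; apply: (cts_comp (h := fun P => (t, P)) cu).
by apply: cts_pair; [exact: cst_continuous|move=> x; exact: cvg_id].
Qed.

Let H t P := phit t P + field t P * phith t P.

Let cH : continuous (fun z : R * (R * R * R) => H z.1 z.2).
Proof.
apply: ctsD => //; apply: ctsM => //.
exact: field_continuous T0 WB WL L0 rho_weak.
Qed.

Let pH t : theta_periodic (H t).
Proof. by move=> a b c; rewrite /H pphit field_periodic pphith. Qed.

Let vH t : vanishes_beyond M (H t).
Proof. by move=> P PM; rewrite /H (vphit _ PM) (vphith _ PM) mulr0 addr0. Qed.

Let bphi t : bounded_measurable (phi t).
Proof. exact: vanishes_bounded_measurable (@cts_sec phi t cphi) (vphi t). Qed.

Let bH t : bounded_measurable (H t).
Proof. exact: vanishes_bounded_measurable (@cts_sec H t cH) (vH t). Qed.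

(** Testing the weak formulation with [chi t * phi t P], where [chi] is a cutoff
    in time, shows that the average of [phi] has the derivative suggested by a
    formal integration by parts. *)
Lemma nu_phi_derive t : 0 < t < T ->
  is_derive t (1 : R) (fun s => nu s (phi s)) (nu t (H t)).
Proof.
(* The cutoff [chi] vanishes beyond [T1 < T] for the test function to have a
   compact support in [0, T[. *)
move=> /andP[t0 tT]; pose T1 := (t + T) / 2.
have [tT1 T1T] : t < T1 /\ T1 < T by rewrite /T1; split; lra.
apply: (@weak_derivative_is_derive R T1 (fun s => nu s (phi s)) (fun s => nu s (H s))).
- lra.
- exact: (nu_continuous T0 rho_weak cphi pphi vphi).
- exact: (nu_continuous T0 rho_weak cH pH vH).
- move=> chi dchi chiE cdchi chi0 dchi0.
  pose w s P := chi s * phi s P.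
  pose wt s P := dchi s * phi s P + chi s * phit s P.
  pose wth s P := chi s * phith s P.
  have cchi (z : R * (R * R * R)) : 0 <= z.1 -> {for z, continuous (fun z : R * (R * R * R) => chi z.1)}.
    move=> z0; apply: (continuous_comp (f := fst)); first exact: cvg_fst.
    exact: is_derive_continuous (chiE _ z0).
  have within_dom (u : R -> R * R * R -> R) :
      (forall z : R * (R * R * R), 0 <= z.1 -> {for z, continuous (fun z => u z.1 z.2)}) ->
      (forall s, theta_periodic (u s)) -> tG_continuous T u.
    move=> cu pu; rewrite /tG_continuous.
    rewrite (_ : (fun z => _) = (fun z : R * (R * R * R) => u z.1 z.2)); last first.
      by apply/funext => z; rewrite theta_periodic_repr.
    by apply: continuous_in_subspaceT => z /[!inE] -[/andP[z0 _] _]; exact: cu.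
  have tw : test_function T w wt wth.
    split.
    + exists (`[0, T1]%classic `*` Gbox M); split.
      * by apply: compact_setX; [exact: segment_compact|exact: compact_Gbox].
      * move=> [s P] [/=]; rewrite in_itv/= => /andP[s0 sT1] [_ P01].
        by split => //=; rewrite s0 (le_lt_trans sT1).
      * move=> s P /andP[s0 sT] GP nC; rewrite /w.
        have [sT1|/ltW/chi0 ->] := leP s T1; last by rewrite mul0r.
        have [PM|/ltW PM] := leP `|P.1.2| M; last by rewrite (vphi s PM) mulr0.
        exfalso; apply: nC; split => /=; first by rewrite in_itv/= s0.
        exact: Gset_Gbox.
    + split; apply: within_dom => [z z0|s a b c].
      * by apply: cvgM; [exact: cchi|exact: cphi].
      * by rewrite /w pphi.
      * apply: cvgD; apply: cvgM; [|exact: cphi|exact: cchi|exact: cphit].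
        by apply: (continuous_comp (f := fst)); [exact: cvg_fst|exact: cdchi].
      * by rewrite /wt pphi pphit.
      * by apply: cvgM; [exact: cchi|exact: cphith].
      * by rewrite /wth pphith.
    + move=> s P /andP[s0 _] _; rewrite /w /wt.
      have := derM (chiE _ (ltW s0)) (dphit s P).
      by move=> h; apply: (is_derive_eq h); rewrite addrC; congr (_ + _); rewrite mulrC.
    + move=> s P _ _; rewrite /w /wth.
      have := derZ (chi s) (dphith s P).
      rewrite (_ : (fun u => _) = (fun th => chi s * phi s (G_repr (th, P.1.2, P.2))))//.
      by apply/funext => th; rewrite theta_periodic_repr.
  case: rho_weak => _ _ _ /(_ _ _ _ tw).
  rewrite (_ : \int[lebesgue3]_(P in Gset) (rho 0 P * w 0 P) = chi 0 * nu 0 (phi 0)); last first.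
    rewrite -pairingZ// /pairing clampT_id ?lexx ?ltW//.
    by apply: eq_Rintegral => P _; rewrite /w mulrC.
  move=> weak0; rewrite -[RHS]weak0; congr (_ + _).
  rewrite Rintegral_mkcond [RHS]Rintegral_mkcond; apply: eq_Rintegral => s _.
  rewrite !patchE.
  have innerE : s \in `[0, T[%classic ->
      dchi s * nu s (phi s) + chi s * nu s (H s) =
      \int[lebesgue3]_(P in Gset)
        (rho s P * (wt s P + velocity K W rho s P * wth s P)).
    rewrite inE/= in_itv/= => /andP[s0 sT].
    rewrite -!pairingZ// -pairingD//; last 2 first.
    + exact: bounded_measurableZ.
    + exact: bounded_measurableZ.
    rewrite /pairing clampT_id ?s0 ?ltW//.
    apply: eq_Rintegral => P; rewrite inE => GP.
    rewrite (velocityE T0 WB WL L0 rho_weak)//; last by rewrite s0 ltW.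
    by rewrite /wt /wth /H; ring.
  case: ifPn => sT1; case: ifPn => sT'.
  + exact: innerE.
  + exfalso; move: sT' sT1; rewrite notin_setE inE/= !in_itv/= => nT /andP[s0 sT1].
    by apply: nT; rewrite s0 (le_lt_trans sT1).
  + rewrite -innerE//.
    have : T1 <= s.
      move: sT' sT1; rewrite notin_setE inE/= !in_itv/= => /andP[s0 _] /negP.
      by rewrite s0 /= -ltNge => /ltW.
    by move=> sT1'; rewrite chi0 ?dchi0// !mul0r addr0.
  + by [].
- by rewrite t0.
Qed.

(** The derivative of [phi] along the flow is the slope of [f] times the mismatch
    between [U] and the field, so the mean value theorem applies. *)
Lemma nu_transport_smooth s l b : 0 <= s -> s <= tau -> tau <= T -> 0 <= b ->
  (forall P, `|df P| <= l) ->
  (forall t P, s <= t <= tau -> Gset P -> `|P.1.2| <= M ->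
    `|field t P * (1 + (tau - t) * dU P) - U P| <= b) ->
  `|nu tau f - nu s (phi s)| <= (tau - s) * (l * b).
Proof.
move=> s0 stau tauT b0 dfl Ub.
have l0 : 0 <= l by apply: le_trans (dfl (0, 0, 0)).
have phitau : nu tau f = nu tau (phi tau).
  by apply: eq_Rintegral => -[[a y] c] _; rewrite /phi /shift subrr mul0r addr0.
rewrite phitau.
have [||c] := @MVT_segment R (fun t => nu t (phi t)) (fun t => nu t (H t)) s tau stau.
- by move=> t; rewrite in_itv/= => /andP[st tt]; apply: nu_phi_derive; lra.
- apply: continuous_subspaceT.
  exact: (nu_continuous T0 rho_weak cphi pphi vphi).
rewrite in_itv/= => /andP[sc ctau] ->.
rewrite normrM mulrC (ger0_norm (x := tau - s)) ?subr_ge0//.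
rewrite ler_wpM2l ?subr_ge0//.
apply: (pairing_norm_le (rd c)) => // P GP.
have [PM|/ltW PM] := leP `|P.1.2| M; last by rewrite (vH c PM) normr0 mulr_ge0.
have -> : H c P = df (shift c P) * (field c P * (1 + (tau - c) * dU P) - U P).
  by rewrite /H /phit /phith; ring.
by rewrite normrM ler_pM// Ub// sc.
Qed.

End smooth_transport.

(** The bound for differentiable functions only involves their Lipschitz constant
    in the angle, which mollification preserves. *)
Lemma nu_transport (f U dU : R * R * R -> R) M s tau l b :
  BL_cutoff M f -> continuous U -> continuous dU ->
  theta_periodic U -> theta_periodic dU ->
  (forall P, is_derive P.1.1 (1 : R) (fun a => U (a, P.1.2, P.2)) (dU P)) ->
  0 <= s -> s <= tau -> tau <= T -> 0 <= b ->
  (forall a a' y c, `|f (a, y, c) - f (a', y, c)| <= l * `|a - a'|) ->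
  (forall t P, s <= t <= tau -> Gset P -> `|P.1.2| <= M ->
    `|field t P * (1 + (tau - t) * dU P) - U P| <= b) ->
  `|nu tau f - nu s (fun P => f (P.1.1 + (tau - s) * U P, P.1.2, P.2))|
    <= (tau - s) * (l * b).
Proof.
move=> Bf cU cdU pU pdU dUE s0 stau tauT b0 fl Ub.
apply/ler_addgt0Pr => e e0; have e20 : 0 < e / 2 by lra.
have Bm := mollify_BL (e / 2) Bf; have [_ _ pm vm] := Bm.
have [_ _ pf vf] := Bf.
have cm := BL_cutoff_continuous Bm; have cf := BL_cutoff_continuous Bf.
have cd : continuous (dmollify f (e / 2)) by exact: (dmollify_continuous Bf).
have pd : theta_periodic (dmollify f (e / 2)) by exact: (@dmollify_periodic R f M (e / 2) Bf).
have vd : vanishes_beyond M (dmollify f (e / 2)) by exact: (@dmollify_vanishes R f M (e / 2) Bf).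
have h := nu_transport_smooth cm cd pm pd vm vd (mollify_derive e20 Bf)
  cU cdU pU pdU dUE s0 stau tauT b0 (fun P => dmollify_bound e20 P fl) Ub.
set E := fun P : R * R * R => (P.1.1 + (tau - s) * U P, P.1.2, P.2).
have cE : continuous E.
  apply: cts_pair; last exact: cts_pos.
  apply: cts_pair; last exact: cts_omega.
  by apply: ctsD; [exact: cts_theta|apply: ctsM => //; exact: cts_cst].
have bE g : continuous g -> vanishes_beyond M g -> bounded_measurable (g \o E).
  move=> cg vg; apply: (@vanishes_bounded_measurable _ M).
    exact: (cts_comp cg cE).
  by move=> P PM; rewrite /= vg.
have close t g : (forall P, `|g P| <= e / 2) -> bounded_measurable g ->
    `|nu t g| <= e / 2.
  by move=> gb bg; apply: (pairing_norm_le (rd t)).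
have bf := BL_cutoff_bounded_measurable Bf.
have bm := BL_cutoff_bounded_measurable Bm.
have c1 : `|nu tau (fun P => mollify (e / 2) f P - f P)| <= e / 2.
  apply: close; first by move=> P; exact: (mollify_close e20 Bf).
  exact: bounded_measurableB.
have c2 : `|nu s (fun P => (mollify (e / 2) f \o E) P - (f \o E) P)| <= e / 2.
  apply: close; first by move=> P; exact: (mollify_close e20 Bf).
  by apply: bounded_measurableB; exact: bE.
rewrite (pairingB (rd tau))// in c1.
rewrite (pairingB (rd s)) in c2; [|exact: bE|exact: bE].
move: c1 c2 h; rewrite -/(E _) !ler_norml /comp => /andP[? ?] /andP[? ?] /andP[? ?].
by apply/andP; split; lra.
Qed.

End transport.

(** * Averaging functionals and their Euler steps *)

Section averaging.
Context {R : realType}.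
Implicit Types (u v : R * R * R -> R) (m : (R * R * R -> R) -> R).
Local Notation bm := bounded_measurable.

(** Both the empirical averages and the averages against the limit density have
    these properties, which are all that the comparison of the two uses. *)
Definition averaging m :=
  [/\ forall u v, bm u -> bm v -> m (fun P => u P - v P) = m u - m v,
      forall c u, bm u -> m (fun P => c * u P) = c * m u,
      forall u v, bm u -> bm v -> (forall P, Gset P -> u P <= v P) -> m u <= m v &
      m (cst 1) = 1].

Lemma averaging_pairing (r : R * R * R -> R) :
  G_probability_density r -> averaging (pairing r).
Proof.
move=> rd; split.
- exact: pairingB.
- exact: pairingZ.
- exact: le_pairing.
- exact: pairing_cst.
Qed.

Definition sample_mean n (p : 'I_n -> R * R * R) u : R :=
  n%:R^-1 * \sum_(i < n) u (p i).

Lemma averaging_sample_mean n (p : 'I_n -> R * R * R) :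
  (0 < n)%N -> (forall i, Gset (p i)) -> averaging (sample_mean p).
Proof.
move=> n0 pG; have n0' : (0 : R) < n%:R by rewrite ltr0n.
split.
- by move=> u v _ _; rewrite /sample_mean sumrB mulrBr.
- by move=> c u _; rewrite /sample_mean -mulr_sumr mulrCA.
- move=> u v _ _ uv; apply: ler_wpM2l; first by rewrite invr_ge0 ltW.
  by apply: ler_sum => i _; exact/uv/pG.
- by rewrite /sample_mean /= sumr_const card_ord mulVf// gt_eqF.
Qed.

Section averaging_theory.
Variable m : (R * R * R -> R) -> R.
Hypothesis am : averaging m.

Lemma averaging_cst c : m (cst c) = c.
Proof.
case: am => _ mZ _ m1.
have := mZ c (cst 1) (bounded_measurable_cst 1).
by rewrite m1 mulr1 => mc; rewrite -[RHS]mc; congr m; apply/funext => P; rewrite /cst mulr1.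
Qed.

Lemma averaging_norm_le u v : bm u -> bm v ->
  (forall P, Gset P -> `|u P| <= v P) -> `|m u| <= m v.
Proof.
case: am => _ mZ mle _ bu bv uv; rewrite ler_norml -mulN1r -(mZ _ v bv).
apply/andP; split; apply: mle => //; first exact: bounded_measurableZ.
  by move=> P /uv; rewrite mulN1r ler_norml => /andP[].
by move=> P /uv; rewrite ler_norml => /andP[].
Qed.

Lemma averaging_bound u b : bm u -> (forall P, Gset P -> `|u P| <= b) -> `|m u| <= b.
Proof.
move=> bu ub; rewrite -[X in _ <= X](averaging_cst b).
by apply: averaging_norm_le => //; exact: bounded_measurable_cst.
Qed.

End averaging_theory.

Definition cutoff (M : R) (P : R * R * R) : R := clamp01 (M - `|P.1.2|).

(** An upper bound for the mass of [|omega| >= M]: what is lost by restricting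
    to test functions supported in [|omega| <= M]. *)
Definition tail (m : (R * R * R -> R) -> R) (M : R) : R := 1 - m (cutoff M).

Lemma cutoff_itv M P : 0 <= cutoff M P <= 1.
Proof. exact: clamp01_itv. Qed.

Lemma cutoff_BL M : BL_cutoff M (cutoff M).
Proof.
split.
- by move=> P; have := cutoff_itv M P; rewrite ler_norml; lra.
- move=> P Q; apply: le_trans (clamp01_lip _ _) _.
  rewrite (_ : _ - _ = `|Q.1.2| - `|P.1.2|); last by ring.
  apply: le_trans (ler_dist_dist _ _) _; rewrite distrC /dist1.
  by have := normr_ge0 (P.1.1 - Q.1.1); have := normr_ge0 (P.2 - Q.2); lra.
- by [].
- move=> P PM; rewrite /cutoff /clamp01; apply/max_idPl.
  by rewrite ge_min subr_le0 PM.
Qed.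

Lemma cutoff_bm M : bm (cutoff M).
Proof. exact: BL_cutoff_bounded_measurable (cutoff_BL M). Qed.

Lemma tail_ge0 m M : averaging m -> 0 <= tail m M.
Proof.
move=> am; rewrite subr_ge0 -(averaging_cst am 1); case: am => _ _ mle _.
apply: mle; [exact: cutoff_bm|exact: bounded_measurable_cst|].
by move=> P _; case/andP: (cutoff_itv M P).
Qed.

Lemma tailE m M : averaging m -> m (fun P => 1 - cutoff M P) = tail m M.
Proof.
move=> am; have m1 := averaging_cst am 1; case: am => mB _ _ _.
rewrite (mB (cst 1))//; first by rewrite m1.
  exact: bounded_measurable_cst.
exact: cutoff_bm.
Qed.

(** [BL_close M D m1 m2] bounds by [D] the bounded Lipschitz distance of [m1]
    and [m2], restricted to test functions supported in [|omega| <= M]. *)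
Definition BL_close (M D : R) m1 m2 :=
  forall f, BL_cutoff M f -> `|m1 f - m2 f| <= D.

Lemma BL_close_scale M D m1 m2 (c : R) f : averaging m1 -> averaging m2 ->
  0 < c -> BL_close M D m1 m2 -> BL_cutoff M (fun P => c^-1 * f P) ->
  `|m1 f - m2 f| <= c * D.
Proof.
move=> [_ m1Z _ _] [_ m2Z _ _] c0 cl Bf.
have fE : f = (fun P => c * (c^-1 * f P)).
  by apply/funext => P; rewrite mulrA mulfV ?mul1r// gt_eqF.
have bf := BL_cutoff_bounded_measurable Bf.
rewrite fE m1Z// m2Z// -mulrBr normrM gtr0_norm// ler_pM2l//.
exact: cl.
Qed.

End averaging.

Section interaction.
Context {R : realType}.
Variables (K : R) (W : R * R -> R) (B L : R).
Hypothesis WB : forall x y, 0 <= x <= 1 -> 0 <= y <= 1 -> `|W (x, y)| <= B.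
Hypothesis WL : forall x y x' y', 0 <= x <= 1 -> 0 <= y <= 1 ->
  0 <= x' <= 1 -> 0 <= y' <= 1 ->
  `|W (x, y) - W (x', y')| <= L * (`|x - x'| + `|y - y'|).
Hypotheses (B0 : 0 < B) (L0 : 0 <= L).
Implicit Types (m : (R * R * R -> R) -> R) (P Q : R * R * R).

Definition kernel (a x : R) Q : R := Wclamp W x Q.2 * sin (Q.1.1 - a).

Lemma kernel_bm a x : bounded_measurable (kernel a x).
Proof. exact: interaction_kernel_bm WB WL L0 x a. Qed.

Lemma kernel_bound a x Q : `|kernel a x Q| <= B.
Proof.
rewrite normrM; apply: le_trans (Wclamp_bound WB x Q.2).
by rewrite ler_piMr// abs_sin_le1.
Qed.

Lemma sin_lip (a b : R) : `|sin a - sin b| <= `|a - b|.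
Proof.
wlog ab : a b / a <= b.
  move=> h; have [/h//|/ltW/h] := leP a b.
  by rewrite distrC (distrC a).
have csin : {within `[a, b], continuous (@sin R)}.
  by apply: continuous_subspaceT; exact: continuous_sin.
have [c _] := @MVT_segment R sin cos a b ab (fun x _ => is_derive_sin x) csin.
rewrite distrC => ->; rewrite normrM (distrC a) ler_piMl//.
exact: abs_cos_le1.
Qed.

Lemma kernel_lip_theta a b x Q : `|kernel a x Q - kernel b x Q| <= B * `|a - b|.
Proof.
rewrite /kernel -mulrBr normrM ler_pM// ?Wclamp_bound//.
by apply: le_trans (sin_lip _ _) _; rewrite opprB addrC addrA subrK distrC.
Qed.

Lemma kernel_lip_pos a x y Q : `|kernel a x Q - kernel a y Q| <= L * `|x - y|.
Proof.
rewrite /kernel -mulrBl normrM.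
apply: le_trans (_ : `|Wclamp W x Q.2 - Wclamp W y Q.2| <= _).
  by rewrite ler_piMr// abs_sin_le1.
by have := Wclamp_lip WL L0 x Q.2 y Q.2; rewrite subrr normr0 addr0.
Qed.

Lemma kernel_cutoff_BL a x M :
  BL_cutoff M (fun Q => (B + L)^-1 * (kernel a x Q * cutoff M Q)).
Proof.
have BL0 : 0 < B + L by rewrite ltr_wpDr.
have [c1 cl cp cv] := cutoff_BL M.
split.
- move=> Q; rewrite normrM gtr0_norm ?invr_gt0// ler_pdivrMl// mulr1 normrM.
  apply: le_trans (_ : B * 1 <= _); last by rewrite mulr1 lerDl.
  by rewrite ler_pM// kernel_bound.
- move=> P Q; rewrite -mulrBr normrM gtr0_norm ?invr_gt0// ler_pdivrMl//.
  have -> : kernel a x P * cutoff M P - kernel a x Q * cutoff M Q =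
      (Wclamp W x P.2 - Wclamp W x Q.2) * (sin (P.1.1 - a) * cutoff M P) +
      Wclamp W x Q.2 * ((sin (P.1.1 - a) - sin (Q.1.1 - a)) * cutoff M P) +
      kernel a x Q * (cutoff M P - cutoff M Q) by rewrite /kernel; ring.
  have h1 : `|(Wclamp W x P.2 - Wclamp W x Q.2) * (sin (P.1.1 - a) * cutoff M P)|
      <= L * `|P.2 - Q.2|.
    rewrite normrM; apply: le_trans (_ : `|Wclamp W x P.2 - Wclamp W x Q.2| * 1 <= _).
      by rewrite ler_wpM2l// normrM mulr_ile1// abs_sin_le1.
    by have := Wclamp_lip WL L0 x P.2 x Q.2; rewrite subrr normr0 add0r mulr1.
  have h2 : `|Wclamp W x Q.2 * ((sin (P.1.1 - a) - sin (Q.1.1 - a)) * cutoff M P)|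
      <= B * `|P.1.1 - Q.1.1|.
    rewrite normrM ler_pM// ?Wclamp_bound// normrM.
    apply: le_trans (_ : `|sin (P.1.1 - a) - sin (Q.1.1 - a)| * 1 <= _).
      by rewrite ler_wpM2l.
    rewrite mulr1; apply: le_trans (sin_lip _ _) _.
    by rewrite opprB addrA subrK.
  have h3 : `|kernel a x Q * (cutoff M P - cutoff M Q)| <= B * `|P.1.2 - Q.1.2|.
    rewrite normrM ler_pM// ?kernel_bound//.
    have := cl (0, P.1.2, 0) (0, Q.1.2, 0).
    by rewrite /dist1 /= !subrr !normr0 add0r addr0.
  have comb (u v w p q r : R) : 0 <= p -> 0 <= q -> 0 <= r ->
      `|u| <= L * r -> `|v| <= B * p -> `|w| <= B * q ->
      `|u + v + w| <= (B + L) * (p + q + r).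
    move=> p0 q0 r0 hu hv hw.
    apply: le_trans (ler_normD _ _) _; have := ler_normD u v.
    have := mulr_ge0 L0 p0; have := mulr_ge0 L0 q0; have := mulr_ge0 (ltW B0) r0.
    lra.
  by apply: comb.
- by move=> b c d; rewrite /kernel /= -addrAC sin_2pi cp.
- by move=> P PM; rewrite cv// !mulr0.
Qed.

(** The kernel is a multiple of a test function once it is cut off in [omega]; the
    remainder is charged to the tails. *)
Lemma kernel_diff m1 m2 M D a x : averaging m1 -> averaging m2 ->
  BL_close M D m1 m2 ->
  `|m1 (kernel a x) - m2 (kernel a x)| <= (B + L) * D + B * (tail m1 M + tail m2 M).
Proof.
move=> a1 a2 cl.
have BL0 : 0 < B + L by rewrite ltr_wpDr.
pose psi Q := kernel a x Q * cutoff M Q.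
have bk := kernel_bm a x; have bc := cutoff_bm M.
have bpsi : bounded_measurable psi by exact: bounded_measurableM.
have h := BL_close_scale a1 a2 BL0 cl (kernel_cutoff_BL a x M).
have rest m : averaging m -> `|m (kernel a x) - m psi| <= B * tail m M.
  move=> am; have [mB mZ _ _] := am.
  have b1c : bounded_measurable (fun P => 1 - cutoff M P).
    by apply: (bounded_measurableB (bounded_measurable_cst 1)).
  rewrite -mB// -(tailE M am) -mZ//; apply: averaging_norm_le => //.
  - exact: bounded_measurableB.
  - exact: bounded_measurableZ.
  - move=> P _; rewrite /psi.
    have -> : kernel a x P - kernel a x P * cutoff M P =
      kernel a x P * (1 - cutoff M P) by ring.
    have c0 : 0 <= 1 - cutoff M P by case/andP: (cutoff_itv M P); lra.
    by rewrite normrM (ger0_norm c0) ler_wpM2r// kernel_bound.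
have h1 := rest _ a1; have h2 := rest _ a2.
move: h h1 h2; rewrite -/psi !ler_norml => /andP[? ?] /andP[? ?] /andP[? ?].
by apply/andP; split; lra.
Qed.

Definition mean_field m P : R := P.1.2 + K * m (kernel P.1.1 P.2).

Definition field_lip : R := 1 + `|K| * (B + L).

Lemma field_lip_ge0 : 0 <= field_lip.
Proof. by rewrite addr_ge0// mulr_ge0// addr_ge0// ltW. Qed.

Lemma mean_field_lip m P Q : averaging m ->
  `|mean_field m P - mean_field m Q| <= field_lip * dist1 P Q.
Proof.
move=> am; have [mB _ _ _] := am.
have -> : mean_field m P - mean_field m Q =
   (P.1.2 - Q.1.2) + K * ((m (kernel P.1.1 P.2) - m (kernel Q.1.1 P.2)) +
   (m (kernel Q.1.1 P.2) - m (kernel Q.1.1 Q.2))) by rewrite /mean_field; ring.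
have h1 : `|m (kernel P.1.1 P.2) - m (kernel Q.1.1 P.2)| <= B * `|P.1.1 - Q.1.1|.
  rewrite -mB; [|exact: kernel_bm|exact: kernel_bm].
  apply: averaging_bound => //.
    by apply: bounded_measurableB; exact: kernel_bm.
  by move=> Z _; exact: kernel_lip_theta.
have h2 : `|m (kernel Q.1.1 P.2) - m (kernel Q.1.1 Q.2)| <= L * `|P.2 - Q.2|.
  rewrite -mB; [|exact: kernel_bm|exact: kernel_bm].
  apply: averaging_bound => //.
    by apply: bounded_measurableB; exact: kernel_bm.
  by move=> Z _; exact: kernel_lip_pos.
apply: le_trans (ler_normD _ _) _; rewrite normrM.
have h3 := le_trans (ler_normD _ _) (lerD h1 h2).
have h4 := ler_wpM2l (normr_ge0 K) h3.
apply: le_trans (lerD (lexx _) h4) _.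
have a0 := normr_ge0 (P.1.1 - Q.1.1); have b0 := normr_ge0 (P.1.2 - Q.1.2).
have c0 := normr_ge0 (P.2 - Q.2); have K0 := normr_ge0 K.
rewrite /field_lip /dist1 mulrDl mul1r -mulrA.
have : B * `|P.1.1 - Q.1.1| + L * `|P.2 - Q.2| <=
  (B + L) * (`|P.1.1 - Q.1.1| + `|P.1.2 - Q.1.2| + `|P.2 - Q.2|).
  have := mulr_ge0 L0 a0; have := mulr_ge0 L0 b0; have := mulr_ge0 (ltW B0) c0.
  have := mulr_ge0 (ltW B0) b0; rewrite !mulrDr !mulrDl; lra.
by move=> /(ler_wpM2l K0); lra.
Qed.

Definition euler (m : (R * R * R -> R) -> R) (h : R) P : R * R * R :=
  (P.1.1 + h * mean_field m P, P.1.2, P.2).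

Lemma kernel_periodic a x Q : kernel (a + 2 * pi) x Q = kernel a x Q.
Proof.
rewrite /kernel -[in RHS](subrK (2 * pi) (Q.1.1 - a)) sin_2pi.
by congr (_ * sin _); ring.
Qed.

Lemma mean_field_periodic m : theta_periodic (mean_field m).
Proof.
move=> a b c; rewrite /mean_field /=; congr (_ + _ * m _).
by apply/funext => Q; exact: kernel_periodic.
Qed.

Lemma euler_lip m h P Q : averaging m -> 0 <= h ->
  dist1 (euler m h P) (euler m h Q) <= (1 + h * field_lip) * dist1 P Q.
Proof.
move=> am h0; rewrite /dist1 /=.
have := mean_field_lip P Q am => /(ler_wpM2l h0).
have -> : P.1.1 + h * mean_field m P - (Q.1.1 + h * mean_field m Q) =
  (P.1.1 - Q.1.1) + h * (mean_field m P - mean_field m Q) by ring.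
have h2 := ler_normD (P.1.1 - Q.1.1) (h * (mean_field m P - mean_field m Q)).
rewrite normrM (ger0_norm h0) in h2.
by rewrite /dist1; lra.
Qed.

Lemma euler_BL m h M f : averaging m -> 0 <= h -> BL_cutoff M f ->
  BL_cutoff M (fun P => (1 + h * field_lip)^-1 * f (euler m h P)).
Proof.
move=> am h0 [f1 fl fp fv].
have c1 : 1 <= 1 + h * field_lip by rewrite lerDl mulr_ge0// field_lip_ge0.
have c0 : 0 < 1 + h * field_lip by exact: lt_le_trans c1.
split.
- move=> P; rewrite normrM gtr0_norm ?invr_gt0// ler_pdivrMl// mulr1.
  exact: le_trans c1.
- move=> P Q; rewrite -mulrBr normrM gtr0_norm ?invr_gt0// ler_pdivrMl//.
  apply: le_trans (fl _ _) _; exact: euler_lip.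
- move=> a b c; rewrite /euler /= mean_field_periodic.
  by rewrite addrAC fp.
- by move=> P PM; rewrite fv ?mulr0.
Qed.

Lemma euler_bm m h M f : averaging m -> 0 <= h -> BL_cutoff M f ->
  bounded_measurable (fun P => f (euler m h P)).
Proof.
move=> am h0 Bf; have c1 : 0 < 1 + h * field_lip.
  by rewrite ltr_wpDr// mulr_ge0// field_lip_ge0.
have := BL_cutoff_bounded_measurable (euler_BL am h0 Bf).
move=> /(bounded_measurableZ (1 + h * field_lip)).
rewrite (_ : (fun P => _) = (fun P => f (euler m h P)))//.
by apply/funext => P; rewrite mulrA mulfV ?mul1r// gt_eqF.
Qed.

(** One Euler step of the two flows, each driven by its own measure: the
    distance grows by the Lipschitz constant of the flow and by the difference
    of the two velocity fields, itself controlled by the distance. *)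
Lemma euler_compare m1 m2 h M D f : averaging m1 -> averaging m2 -> 0 <= h ->
  BL_close M D m1 m2 -> BL_cutoff M f ->
  `|m1 (fun P => f (euler m1 h P)) - m2 (fun P => f (euler m2 h P))| <=
  (1 + h * field_lip) * D +
  h * (`|K| * ((B + L) * D + B * (tail m1 M + tail m2 M))).
Proof.
move=> a1 a2 h0 cl Bf; have [f1 fl fp fv] := Bf.
have c1 : 0 < 1 + h * field_lip.
  by rewrite ltr_wpDr// mulr_ge0// field_lip_ge0.
have e1 := BL_close_scale a1 a2 c1 cl (euler_BL a2 h0 Bf).
have [m1B _ _ _] := a1.
have b1 := euler_bm a1 h0 Bf; have b2 := euler_bm a2 h0 Bf.
have e2 : `|m1 (fun P => f (euler m1 h P) - f (euler m2 h P))| <=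
    h * (`|K| * ((B + L) * D + B * (tail m1 M + tail m2 M))).
  apply: averaging_bound => //; first exact: bounded_measurableB.
  move=> P _; apply: le_trans (fl _ _) _; rewrite /dist1 /= !subrr !normr0 !addr0.
  rewrite opprD addrACA subrr add0r -mulrBr normrM (ger0_norm h0) ler_wpM2l//.
  rewrite /mean_field opprD addrACA subrr add0r -mulrBr normrM ler_wpM2l//.
  exact: kernel_diff.
rewrite m1B// in e2.
move: e1 e2; rewrite !ler_norml => /andP[? ?] /andP[? ?].
by apply/andP; split; lra.
Qed.

End interaction.

(** * Euler steps of the limit equation *)

Section limit_flow.
Context {R : realType}.
Variables (T K : R) (W : R * R -> R) (rho : R -> R * R * R -> R).
Variables (rho_init : R * R * R -> R) (B L : R).
Hypothesis T0 : 0 < T.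
Hypothesis WB : forall x y, 0 <= x <= 1 -> 0 <= y <= 1 -> `|W (x, y)| <= B.
Hypothesis WL : forall x y x' y', 0 <= x <= 1 -> 0 <= y <= 1 ->
  0 <= x' <= 1 -> 0 <= y' <= 1 ->
  `|W (x, y) - W (x', y')| <= L * (`|x - x'| + `|y - y'|).
Hypotheses (B0 : 0 < B) (L0 : 0 <= L).
Hypothesis rho_weak : weak_solution T K W rho_init rho.

Local Notation nu t := (pairing (rho (clampT T t))).
Local Notation field := (field T K W rho).

Let rd t := rho_density T0 rho_weak t.
Let anu t : averaging (nu t) := averaging_pairing (rd t).

Lemma field_mean_field t P : field t P = mean_field K W (nu t) P.
Proof. exact: (fieldE T0 WB WL L0 rho_weak). Qed.

Lemma mean_field_bound m P : averaging m ->
  `|mean_field K W m P| <= `|P.1.2| + `|K| * B.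
Proof.
move=> am; apply: le_trans (ler_normD _ _) _; rewrite lerD2l normrM ler_wpM2l//.
apply: averaging_bound => //; first exact: kernel_bm WB WL L0 _ _.
by move=> Q _; exact: kernel_bound.
Qed.

(** Transport along constant lines: the mismatch is the whole field. *)
Lemma nu_time M s t : 0 <= M -> 0 <= s -> s <= t -> t <= T ->
  BL_close M ((t - s) * (M + `|K| * B)) (nu t) (nu s).
Proof.
move=> M0 s0 st tT f Bf.
have V0 : 0 <= M + `|K| * B by rewrite addr_ge0// mulr_ge0// ltW.
have [_ fl _ _] := Bf.
have := @nu_transport R T K W rho rho_init B L T0 WB WL L0 rho_weak f (cst 0) (cst 0)
  M s t 1 (M + `|K| * B) Bf (@cts_cst _ _ 0) (@cts_cst _ _ 0)
  (fun _ _ _ => erefl) (fun _ _ _ => erefl) (fun P => der_cst _ _) s0 st tT V0.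
rewrite mul1r (_ : (fun P => f _) = f); last first.
  by apply/funext => -[[a b] c]; rewrite /= mulr0 addr0.
apply.
  move=> a a' y c; apply: le_trans (fl _ _) _.
  by rewrite /dist1 /= !subrr !normr0 !addr0 mul1r.
move=> u P _ GP PM; rewrite /cst mulr0 addr0 mulr1 subr0 field_mean_field.
by apply: le_trans (mean_field_bound _ (anu u)) _; rewrite lerD2r.
Qed.

(** The frequencies do not move: [cutoff M] depends on [omega] only, so that its
    Lipschitz constant in the angle is 0. *)
Lemma nu_cutoff_time M t : 0 <= M -> 0 <= t <= T ->
  nu t (cutoff M) = nu 0 (cutoff M).
Proof.
move=> M0 /andP[t0 tT].
have V0 : 0 <= M + `|K| * B by rewrite addr_ge0// mulr_ge0// ltW.
have := @nu_transport R T K W rho rho_init B L T0 WB WL L0 rho_weak (cutoff M)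
  (cst 0) (cst 0) M 0 t 0 (M + `|K| * B) (cutoff_BL M) (@cts_cst _ _ 0) (@cts_cst _ _ 0)
  (fun _ _ _ => erefl) (fun _ _ _ => erefl) (fun P => der_cst _ _) (lexx _) t0 tT V0.
rewrite mul0r mulr0 (_ : (fun P => cutoff M (_, _)) = cutoff M); last first.
  by apply/funext => -[[a b] c].
move=> h; apply/eqP; rewrite -subr_eq0 -normr_le0; apply: h.
  by move=> a a' y c; rewrite /cutoff subrr normr0 mul0r.
move=> u P _ GP PM; rewrite /cst mulr0 addr0 mulr1 subr0 field_mean_field.
by apply: le_trans (mean_field_bound _ (anu u)) _; rewrite lerD2r.
Qed.

Lemma nu_tail_time M t : 0 <= M -> 0 <= t <= T -> tail (nu t) M = tail (nu 0) M.
Proof. by move=> M0 tT; rewrite /tail nu_cutoff_time. Qed.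

Definition nu_euler_error (M h : R) : R :=
  `|K| * ((B + L) * (h * (M + `|K| * B)) + B * (tail (nu 0) M + tail (nu 0) M))
  + h * (M + `|K| * B) * (`|K| * B).

(** Transport along the field frozen at time [s]: the mismatch consists of the
    change of the field between [s] and [t] and of a second order term. *)
Lemma nu_euler M s t f : 0 <= M -> 0 <= s -> s <= t -> t <= T -> BL_cutoff M f ->
  `|nu t f - nu s (fun P => f (euler K W (nu s) (t - s) P))| <=
  (t - s) * nu_euler_error M (t - s).
Proof.
move=> M0 s0 st tT Bf.
have V0 : 0 <= M + `|K| * B by rewrite addr_ge0// mulr_ge0// ltW.
have KB0 : 0 <= `|K| * B by rewrite mulr_ge0// ltW.
have [_ fl _ _] := Bf.
have ts0 : 0 <= t - s by rewrite subr_ge0.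
have tl0 : 0 <= tail (nu 0) M by apply: tail_ge0.
have err0 : 0 <= nu_euler_error M (t - s).
  have hV := mulr_ge0 ts0 V0; have BL := addr_ge0 (ltW B0) L0.
  exact: (addr_ge0 (mulr_ge0 (normr_ge0 K) (addr_ge0 (mulr_ge0 BL hV)
    (mulr_ge0 (ltW B0) (addr_ge0 tl0 tl0)))) (mulr_ge0 hV KB0)).
have cF : continuous (field s).
  apply: (cts_comp (h := fun P => (s, P)) (field_continuous T0 WB WL L0 rho_weak)).
  by apply: cts_pair; [exact: cst_continuous|move=> x; exact: cvg_id].
have cdF : continuous (dfield T K W rho s).
  apply: (cts_comp (h := fun P => (s, P)) (dfield_continuous T0 WB WL L0 rho_weak)).
  by apply: cts_pair; [exact: cst_continuous|move=> x; exact: cvg_id].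
have h := @nu_transport R T K W rho rho_init B L T0 WB WL L0 rho_weak f (field s)
  (dfield T K W rho s) M s t 1 (nu_euler_error M (t - s)) Bf cF cdF
  (field_periodic _ _ _ _ _) (dfield_periodic _ _ _ _ _) (field_derive _ _ _ _ _)
  s0 st tT err0.
rewrite mul1r in h.
rewrite (_ : (fun P => f (euler K W (nu s) (t - s) P)) =
  (fun P => f (P.1.1 + (t - s) * field s P, P.1.2, P.2))); last first.
  by apply/funext => P; rewrite /euler field_mean_field.
apply: h.
  move=> a a' y c; apply: le_trans (fl _ _) _.
  by rewrite /dist1 /= !subrr !normr0 !addr0 mul1r.
move=> u P /andP[su ut] GP PM.
have -> : field u P * (1 + (t - u) * dfield T K W rho s P) - field s P =
  (field u P - field s P) + (t - u) * (field u P * dfield T K W rho s P) by ring.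
apply: le_trans (ler_normD _ _) _; apply: lerD.
  rewrite !field_mean_field /mean_field opprD addrACA subrr add0r -mulrBr normrM.
  rewrite ler_wpM2l//.
  have uT : 0 <= u <= T by lra.
  have sT : 0 <= s <= T by lra.
  have cl : BL_close M ((t - s) * (M + `|K| * B)) (nu u) (nu s).
    move=> g Bg; apply: le_trans (nu_time M0 s0 su _ Bg) _; first lra.
    by rewrite ler_wpM2r// lerD2r.
  have := kernel_diff WB WL B0 L0 P.1.1 P.2 (anu u) (anu s) cl.
  by rewrite (nu_tail_time M0 uT) (nu_tail_time M0 sT).
rewrite normrM (ger0_norm (x := t - u)) ?subr_ge0// normrM -mulrA.
apply: ler_pM => //; first lra.
  lra.
apply: ler_pM => //.
  rewrite field_mean_field; apply: le_trans (mean_field_bound _ (anu u)) _.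
  by rewrite lerD2r.
exact: (dfield_bound T0 WB WL L0 rho_weak).
Qed.

End limit_flow.

(** * Euler steps of the particle system *)

Section particle_flow.
Context {R : realType}.
Variables (T K : R) (W : R * R -> R) (B L : R).
Hypothesis T0 : 0 < T.
Hypothesis WB : forall x y, 0 <= x <= 1 -> 0 <= y <= 1 -> `|W (x, y)| <= B.
Hypothesis WL : forall x y x' y', 0 <= x <= 1 -> 0 <= y <= 1 ->
  0 <= x' <= 1 -> 0 <= y' <= 1 ->
  `|W (x, y) - W (x', y')| <= L * (`|x - x'| + `|y - y'|).
Hypotheses (B0 : 0 < B) (L0 : 0 <= L).
Variables (n : nat) (xi om th0 : 'I_n -> R) (th : 'I_n -> R -> R).
Hypothesis n0 : (0 < n)%N.
Hypothesis xi01 : forall i, 0 <= xi i <= 1.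
Hypothesis sol : kuramoto_solution T K W xi om th0 th.

Definition particle t (i : 'I_n) : R * R * R := (th i t, om i, xi i).
Local Notation mu t := (sample_mean (fun i => G_repr (particle t i))).

Lemma particle_Gset t i : Gset (G_repr (particle t i)).
Proof. by split; [exact: circle_repr_circle|rewrite /= in_itv/= xi01]. Qed.

Let amu t : averaging (mu t).
Proof. by apply: averaging_sample_mean => // i; exact: particle_Gset. Qed.

Lemma sample_mean_periodic t u : theta_periodic u ->
  mu t u = n%:R^-1 * \sum_(i < n) u (particle t i).
Proof.
by move=> pu; congr (_ * _); apply: eq_bigr => i _; rewrite theta_periodic_repr.
Qed.

Lemma kernel_periodic_right a x : theta_periodic (kernel W a x).
Proof. by move=> b c e; rewrite /kernel /= -addrAC sin_2pi. Qed.

Lemma particle_derive i t : 0 < t < T ->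
  is_derive t (1 : R) (th i) (mean_field K W (mu t) (particle t i)).
Proof.
move=> tT; have [_ _ /(_ t tT) h] := sol i.
apply: (is_derive_eq h); rewrite /mean_field (sample_mean_periodic _ (kernel_periodic_right _ _)).
rewrite /= mulrA; congr (_ + _ * _); apply: eq_bigr => j _.
by rewrite /kernel /Wclamp /= !clamp01_id.
Qed.

Lemma particle_MVT i s t : 0 <= s -> s <= t -> t <= T ->
  exists2 c, s <= c <= t &
    th i t - th i s = (t - s) * mean_field K W (mu c) (particle c i).
Proof.
move=> s0 st tT; have [_ ci _] := sol i.
have [||c] := @MVT_segment R (th i)
  (fun c => mean_field K W (mu c) (particle c i)) s t st.
- by move=> u; rewrite in_itv/= => /andP[su ut]; apply: particle_derive; lra.
- apply: (continuous_subspaceW _ ci) => u /=; rewrite !in_itv/=; lra.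
by rewrite in_itv/= => cst ->; exists c => //; rewrite mulrC.
Qed.

Lemma particle_move i s t : 0 <= s -> s <= t -> t <= T ->
  `|th i t - th i s| <= (t - s) * (`|om i| + `|K| * B).
Proof.
move=> s0 st tT; have [c _ ->] := particle_MVT i s0 st tT.
rewrite normrM (ger0_norm (x := t - s)) ?subr_ge0// ler_wpM2l ?subr_ge0//.
exact: (mean_field_bound K WB WL L0 (particle c i) (amu c)).
Qed.

Lemma mu_tail_time M s t : tail (mu t) M = tail (mu s) M.
Proof. by []. Qed.

Definition mu_euler_error (M h : R) : R :=
  `|K| * (B * (h * (M + `|K| * B) *+ 2 + tail (mu 0) M *+ 2)).

(** During the step, the angles of the particles with [|omega| < M] move little;
    the other particles are few, hence contribute little to the field. *)
Lemma mu_euler M s t f : 0 <= M -> 0 <= s -> s <= t -> t <= T -> BL_cutoff M f ->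
  `|mu t f - mu s (fun P => f (euler K W (mu s) (t - s) P))| <=
  (t - s) * mu_euler_error M (t - s).
Proof.
move=> M0 s0 st tT Bf; have [f1 fl fp fv] := Bf.
have ts0 : 0 <= t - s by rewrite subr_ge0.
have V0 : 0 <= M + `|K| * B by rewrite addr_ge0// mulr_ge0// ltW.
have n0' : (0 : R) < n%:R by rewrite ltr0n.
have invn0 : (0 : R) <= n%:R^-1 by rewrite invr_ge0 ltW.
have tl0 : 0 <= tail (mu 0) M by apply: tail_ge0.
have err0 : 0 <= mu_euler_error M (t - s).
  exact: (mulr_ge0 (normr_ge0 K) (mulr_ge0 (ltW B0)
    (addr_ge0 (mulrn_wge0 2 (mulr_ge0 ts0 V0)) (mulrn_wge0 2 tl0)))).
rewrite (sample_mean_periodic _ fp) (@sample_mean_periodic s); last first.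
  by move=> a b c; rewrite /euler /= mean_field_periodic addrAC fp.
rewrite -mulrBr -sumrB normrM (ger0_norm invn0) ler_pdivrMl//.
apply: le_trans (ler_norm_sum _ _ _) _.
have -> : n%:R * ((t - s) * mu_euler_error M (t - s)) =
    \sum_(i < n) ((t - s) * mu_euler_error M (t - s)).
  by rewrite sumr_const card_ord mulr_natl.
apply: ler_sum => i _.
have [oM|oM] := leP M `|om i|.
  by rewrite !fv// subrr normr0 mulr_ge0.
apply: le_trans (fl _ _) _; rewrite /dist1 /= !subrr !normr0 !addr0 opprD addrA.
have [c /andP[sc ct] ->] := particle_MVT i s0 st tT.
rewrite -mulrBr normrM (ger0_norm ts0) ler_wpM2l//.
rewrite /mean_field opprD addrACA subrr add0r -mulrBr normrM ler_wpM2l//=.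
rewrite !(sample_mean_periodic _ (kernel_periodic_right _ _)) -mulrBr -sumrB.
rewrite normrM (ger0_norm invn0) ler_pdivrMl//.
apply: le_trans (ler_norm_sum _ _ _) _.
have -> : n%:R * (B * ((t - s) * (M + `|K| * B) *+ 2 + tail (mu 0) M *+ 2)) =
   \sum_(j < n) (B * ((t - s) * (M + `|K| * B) *+ 2 + (1 - cutoff M (particle 0 j)) *+ 2)).
  rewrite -mulr_sumr big_split /= sumr_const card_ord sumrMnl sumrB sumr_const card_ord.
  rewrite /tail (sample_mean_periodic _ _); last by case: (cutoff_BL M).
  rewrite mulrCA; congr (_ * _); rewrite mulrDr mulr_natl; congr (_ + _).
  by rewrite mulrnAr mulrBr mulrA mulfV ?gt_eqF// mul1r mulr1.
apply: ler_sum => j _; rewrite /kernel -mulrBr normrM.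
rewrite ler_pM// ?Wclamp_bound//.
have c0 := cutoff_itv M (particle 0 j).
have [oMj|oMj] := leP M `|om j|.
  have -> : cutoff M (particle 0 j) = 0 by case: (cutoff_BL M) => _ _ _; apply.
  rewrite subr0; apply: le_trans (ler_normB _ _) _.
  have := abs_sin_le1 (th j c - th i c); have := abs_sin_le1 (th j s - th i s).
  have : 0 <= (t - s) * (M + `|K| * B) by rewrite mulr_ge0.
  rewrite /=; lra.
apply: le_trans (sin_lip _ _) _ => /=.
have -> : th j c - th i c - (th j s - th i s) =
  (th j c - th j s) - (th i c - th i s) by ring.
apply: le_trans (ler_normB _ _) _.
have cT : c <= T by lra.
have bnd k : `|om k| < M -> `|th k c - th k s| <= (t - s) * (M + `|K| * B).
  move=> kM; apply: le_trans (particle_move k s0 sc cT) _.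
  have KB0 : 0 <= `|K| * B by rewrite mulr_ge0// ltW.
  apply: ler_pM; [by rewrite subr_ge0|by rewrite addr_ge0|by rewrite lerD2r|].
  by rewrite lerD2r ltW.
have := bnd _ oM; have := bnd _ oMj; lra.
Qed.

End particle_flow.

(** * Stability of the bounded Lipschitz distance *)

Section stability.
Context {R : realType}.
Variables (T K : R) (W : R * R -> R) (rho : R -> R * R * R -> R).
Variables (rho_init : R * R * R -> R) (B L : R).
Hypothesis T0 : 0 < T.
Hypothesis WB : forall x y, 0 <= x <= 1 -> 0 <= y <= 1 -> `|W (x, y)| <= B.
Hypothesis WL : forall x y x' y', 0 <= x <= 1 -> 0 <= y <= 1 ->
  0 <= x' <= 1 -> 0 <= y' <= 1 ->
  `|W (x, y) - W (x', y')| <= L * (`|x - x'| + `|y - y'|).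
Hypotheses (B0 : 0 < B) (L0 : 0 <= L).
Hypothesis rho_weak : weak_solution T K W rho_init rho.
Variables (n : nat) (xi om th0 : 'I_n -> R) (th : 'I_n -> R -> R).
Hypothesis n0 : (0 < n)%N.
Hypothesis xi01 : forall i, 0 <= xi i <= 1.
Hypothesis sol : kuramoto_solution T K W xi om th0 th.
Variables (M D : R).
Hypothesis M0 : 0 <= M.

Local Notation nu t := (pairing (rho (clampT T t))).
Local Notation mu t := (sample_mean (fun i => G_repr (particle xi om th t i))).

Hypothesis D0 : BL_close M D (mu 0) (nu 0).

Let anu t : averaging (nu t) := averaging_pairing (rho_density T0 rho_weak t).

Let amu t : averaging (mu t).
Proof. by apply: averaging_sample_mean => // i; exact: particle_Gset. Qed.

Local Notation eta := (tail (nu 0) M).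
Local Notation V := (M + `|K| * B).

Lemma mu_tail_le : tail (mu 0) M <= eta + D.
Proof. by have := D0 (cutoff_BL M); rewrite /tail ler_norml; lra. Qed.

Definition growth : R := field_lip K B L + `|K| * (B + L).

(** The error that one step adds to the distance, per unit of time: the
    consistency errors of the two Euler steps and the tails in their
    comparison. *)
Definition drift (h : R) : R :=
  `|K| * (B * (eta *+ 2 + D)) + `|K| * (B * (h * V *+ 2 + (eta + D) *+ 2))
  + (`|K| * ((B + L) * (h * V) + B * (eta *+ 2)) + h * V * (`|K| * B)).

Let D_ge0 : 0 <= D.
Proof. exact: le_trans (normr_ge0 _) (D0 (cutoff_BL M)). Qed.

Let eta0 : 0 <= eta. Proof. exact: tail_ge0. Qed.

Let V0 : 0 <= V. Proof. by rewrite addr_ge0// mulr_ge0// ltW. Qed.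

Lemma growth_ge0 : 0 <= growth.
Proof.
by rewrite addr_ge0 ?field_lip_ge0// mulr_ge0// addr_ge0// ltW.
Qed.

Lemma drift_mono h h' : h <= h' -> drift h <= drift h'.
Proof.
move=> hh; have hV := ler_wpM2r V0 hh.
have KB0 : 0 <= `|K| * B by rewrite mulr_ge0// ltW.
have KL0 : 0 <= `|K| * (B + L) by rewrite mulr_ge0// addr_ge0// ltW.
have := ler_wpM2l KB0 hV; have := ler_wpM2l KL0 hV.
by rewrite /drift; lra.
Qed.

Lemma drift_ge0 h : 0 <= h -> 0 <= drift h.
Proof.
move=> h0; have hV := mulr_ge0 h0 V0; have BL := addr_ge0 (ltW B0) L0.
have KB0 : 0 <= `|K| * B by rewrite mulr_ge0// ltW.
have e2 := mulrn_wge0 2 eta0.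
exact: (addr_ge0 (addr_ge0
  (mulr_ge0 (normr_ge0 K) (mulr_ge0 (ltW B0) (addr_ge0 e2 D_ge0)))
  (mulr_ge0 (normr_ge0 K) (mulr_ge0 (ltW B0)
    (addr_ge0 (mulrn_wge0 2 hV) (mulrn_wge0 2 (addr_ge0 eta0 D_ge0))))))
  (addr_ge0 (mulr_ge0 (normr_ge0 K)
    (addr_ge0 (mulr_ge0 BL hV) (mulr_ge0 (ltW B0) e2))) (mulr_ge0 hV KB0))).
Qed.

Lemma close_step s h Ds : 0 <= s -> 0 <= h -> s + h <= T ->
  BL_close M Ds (mu s) (nu s) ->
  BL_close M ((1 + h * growth) * Ds + h * drift h) (mu (s + h)) (nu (s + h)).
Proof.
move=> s0 h0 shT cl f Bf.
have ssh : s <= s + h by rewrite lerDl.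
have sT : 0 <= s <= T by lra.
have shE : s + h - s = h by ring.
have e1 := mu_euler WB WL B0 L0 n0 xi01 sol M0 s0 ssh shT Bf.
have e2 := nu_euler T0 WB WL B0 L0 rho_weak M0 s0 ssh shT Bf.
have e3 := euler_compare K WB WL B0 L0 (amu s) (anu s) h0 cl Bf.
rewrite shE /mu_euler_error in e1; rewrite shE /nu_euler_error in e2.
rewrite (nu_tail_time T0 WB WL B0 L0 rho_weak M0 sT) (mu_tail_time _ _ _ _ 0) in e3.
have tm := mu_tail_le.
have KB0 : 0 <= `|K| * B by rewrite mulr_ge0// ltW.
have hKB0 := mulr_ge0 h0 KB0.
have := ler_wpM2l hKB0 tm.
move: e1 e2 e3; rewrite !ler_norml => /andP[? ?] /andP[? ?] /andP[? ?] ?.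
rewrite /drift /growth.
by apply/andP; split; lra.
Qed.

(** Discrete Gronwall inequality. *)
Lemma close_iterate h k : 0 <= h -> k%:R * h <= T ->
  BL_close M ((D + k%:R * h * drift h) * (1 + h * growth) ^+ k)
    (mu (k%:R * h)) (nu (k%:R * h)).
Proof.
move=> h0; elim: k => [|k IH] kT.
  by rewrite mul0r mul0r addr0 expr0 mulr1.
have kE : k.+1%:R * h = k%:R * h + h by rewrite -natr1 mulrDl mul1r.
rewrite kE in kT *.
have kh0 : 0 <= k%:R * h by rewrite mulr_ge0.
have kT' : k%:R * h <= T by lra.
move=> f Bf; apply: le_trans (close_step kh0 h0 kT (IH kT') Bf) _.
have d0 := drift_ge0 h0.
have g1 : 1 <= 1 + h * growth by rewrite lerDl mulr_ge0// growth_ge0.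
have p1 : 1 <= (1 + h * growth) ^+ k.+1 by rewrite exprn_ege1.
have := ler_wpM2l (mulr_ge0 h0 d0) p1.
by rewrite exprS; lra.
Qed.

Lemma close_estimate t N : 0 <= t <= T -> (0 < N)%N ->
  BL_close M ((D + T * drift (T / N%:R)) * expR (T * growth)) (mu t) (nu t).
Proof.
move=> /andP[t0 tT] N0; have N0' : (0 : R) < N%:R by rewrite ltr0n.
pose h := t / N%:R; have h0 : 0 <= h by rewrite divr_ge0// ltW.
have Nh : N%:R * h = t by rewrite /h mulrC divfK// gt_eqF.
have hT : h <= T / N%:R by rewrite ler_pM2r ?invr_gt0.
move=> f Bf; have := close_iterate (h := h) (k := N) h0.
rewrite Nh => /(_ tT f Bf) /le_trans; apply.
have g0 := growth_ge0.
apply: ler_pM.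
- by rewrite addr_ge0// mulr_ge0// drift_ge0.
- by rewrite exprn_ge0// addr_ge0// mulr_ge0.
- rewrite lerD2l; apply: ler_pM => //; [exact: drift_ge0|exact: drift_mono].
- apply: le_trans (_ : expR (h * growth) ^+ N <= _).
    by rewrite lerXn2r ?nnegrE ?expR_ge0 ?expR_ge1Dx// addr_ge0// mulr_ge0.
  by rewrite -expRM_natl mulrA Nh ler_expR ler_wpM2r.
Qed.

(** Multiplying by the cutoff, which doubles the Lipschitz constant, gives a test
    function supported in [|omega| <= M]; the remainder costs the mass beyond
    [M]. *)
Lemma bounded_lipschitz_stability t N f : 0 <= t <= T -> (0 < N)%N ->
  (forall P, `|f P| <= 1) -> (forall P Q, `|f P - f Q| <= dist1 P Q) ->
  theta_periodic f ->
  `|mu t f - nu t f| <=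
    2 * ((D + T * drift (T / N%:R)) * expR (T * growth)) + (eta *+ 2 + D).
Proof.
move=> tT N0 f1 fl fp.
have cf : continuous f by apply: (@lipschitz_continuous3 _ _ 1) => P Q; rewrite mul1r.
have bf : bounded_measurable f.
  by split; [exact: continuous_measurable3|exists 1 => P _].
have [c1 cl cp cv] := cutoff_BL M; have bc := cutoff_bm M.
have Bf : BL_cutoff M (fun P => 2^-1 * (f P * cutoff M P)).
  split.
  - move=> P; rewrite normrM normrM gtr0_norm ?invr_gt0//.
    have := ler_pM (normr_ge0 _) (normr_ge0 _) (f1 P) (c1 P).
    by have := mulr_ge0 (normr_ge0 (f P)) (normr_ge0 (cutoff M P)); lra.
  - move=> P Q; rewrite -mulrBr normrM gtr0_norm ?invr_gt0// ler_pdivrMl//.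
    have -> : f P * cutoff M P - f Q * cutoff M Q =
      (f P - f Q) * cutoff M P + f Q * (cutoff M P - cutoff M Q) by ring.
    apply: le_trans (ler_normD _ _) _; rewrite !normrM.
    have := ler_pM (normr_ge0 _) (normr_ge0 _) (fl P Q) (c1 P).
    by have := ler_pM (normr_ge0 _) (normr_ge0 _) (f1 Q) (cl P Q); lra.
  - by move=> a b c; rewrite fp cp.
  - by move=> P PM; rewrite cv// !mulr0.
have two0 : (0 : R) < 2 by [].
have h := BL_close_scale (amu t) (anu t) two0 (close_estimate tT N0) Bf.
have bfc := bounded_measurableM bf bc.
have rest m : averaging m -> `|m f - m (fun P => f P * cutoff M P)| <= tail m M.
  move=> am; have [mB _ _ _] := am; rewrite -mB// -(tailE M am).
  have b1c : bounded_measurable (fun P => 1 - cutoff M P).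
    by apply: (bounded_measurableB (bounded_measurable_cst 1)).
  apply: averaging_norm_le => //; first exact: bounded_measurableB.
  move=> P _; have -> : f P - f P * cutoff M P = f P * (1 - cutoff M P) by ring.
  have c0 : 0 <= 1 - cutoff M P by case/andP: (cutoff_itv M P); lra.
  by rewrite normrM (ger0_norm c0) ler_piMl.
have h1 := rest _ (amu t); have h2 := rest _ (anu t).
rewrite (nu_tail_time T0 WB WL B0 L0 rho_weak M0 tT) in h2.
rewrite (mu_tail_time _ _ _ _ 0) in h1.
have tm := mu_tail_le.
move: h h1 h2; rewrite !ler_norml => /andP[? ?] /andP[? ?] /andP[? ?].
by apply/andP; split; lra.
Qed.

End stability.

(** * Expectations and independence *)

Section expectation.
Context {R : realType} {d : measure_display} {Omega : measurableType d}.
Variable Pr : probability Omega R.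
Implicit Types (u v : Omega -> R) (A : set Omega).

Definition mean u : R := \int[Pr]_a u a.

Definition bounded_rv u := measurable_fun setT u /\ exists b, forall a, `|u a| <= b.

Let bm_brv u : bounded_rv u -> bounded_measurable_on setT u.
Proof. by case=> mu [b ub]; split => //; exists b => a _. Qed.

Let meanE u : mean u = weighted_integral Pr setT (cst 1) u.
Proof. by apply: eq_Rintegral => a _; rewrite mulr1. Qed.

Let m1 : measurable_fun (setT : set Omega) (cst (1 : R)).
Proof. exact: measurable_cst. Qed.

Let one0 (a : Omega) : [set: Omega] a -> 0 <= cst (1 : R) a.
Proof. by move=> _; exact: ler01. Qed.

Let int1 : (\int[Pr]_(a in setT) (cst (1 : R) a)%:E = 1)%E.
Proof.
transitivity (\int[Pr]_(a in setT) cst 1 a)%E; first by [].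
by rewrite integral_cst// mul1e; exact: probability_setT.
Qed.

Lemma meanD u v : bounded_rv u -> bounded_rv v -> mean (fun a => u a + v a) = mean u + mean v.
Proof. by move=> /bm_brv bu /bm_brv bv; rewrite !meanE (wintD measurableT m1 one0 int1). Qed.

Lemma meanZ c u : bounded_rv u -> mean (fun a => c * u a) = c * mean u.
Proof. by move=> /bm_brv bu; rewrite !meanE (wintZ measurableT m1 one0 int1). Qed.

Lemma le_mean u v : bounded_rv u -> bounded_rv v -> (forall a, u a <= v a) -> mean u <= mean v.
Proof.
by move=> /bm_brv bu /bm_brv bv uv; rewrite !meanE (le_wint measurableT m1 one0 int1).
Qed.

Lemma mean_cst c : mean (cst c) = c.
Proof. by rewrite meanE (wint_cst measurableT m1 one0 int1). Qed.

Lemma mean_norm_le u b : bounded_rv u -> (forall a, `|u a| <= b) -> `|mean u| <= b.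
Proof.
by move=> /bm_brv bu ub; rewrite meanE (wint_norm_le measurableT m1 one0 int1).
Qed.

Lemma brv_cst c : bounded_rv (cst c).
Proof. by split; [exact: measurable_cst|exists `|c|]. Qed.

Lemma brvD u v : bounded_rv u -> bounded_rv v -> bounded_rv (fun a => u a + v a).
Proof.
move=> [mu [b ub]] [mv [c vc]]; split; first exact: measurable_funD.
by exists (b + c) => a; apply: le_trans (ler_normD _ _) _; rewrite lerD.
Qed.

Lemma brvB u v : bounded_rv u -> bounded_rv v -> bounded_rv (fun a => u a - v a).
Proof.
move=> [mu [b ub]] [mv [c vc]]; split; first exact: measurable_funB.
by exists (b + c) => a; apply: le_trans (ler_normB _ _) _; rewrite lerD.
Qed.

Lemma brvM u v : bounded_rv u -> bounded_rv v -> bounded_rv (fun a => u a * v a).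
Proof.
move=> [mu [b ub]] [mv [c vc]]; split; first exact: measurable_funM.
by exists (b * c) => a; rewrite normrM ler_pM.
Qed.

Lemma brv_sum (I : Type) (r : seq I) (P : pred I) (F : I -> Omega -> R) :
  (forall i, bounded_rv (F i)) -> bounded_rv (fun a => \sum_(i <- r | P i) F i a).
Proof.
move=> bF; elim: r => [|i r IH].
  by under eq_fun do rewrite big_nil; exact: brv_cst.
under eq_fun do rewrite big_cons.
by case: (P i) => //; exact: brvD.
Qed.

Lemma brv_prod (I : Type) (r : seq I) (P : pred I) (F : I -> Omega -> R) :
  (forall i, bounded_rv (F i)) -> bounded_rv (fun a => \prod_(i <- r | P i) F i a).
Proof.
move=> bF; elim: r => [|i r IH].
  by under eq_fun do rewrite big_nil; exact: brv_cst.
under eq_fun do rewrite big_cons.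
by case: (P i) => //; exact: brvM.
Qed.

Lemma mean_sum (I : Type) (r : seq I) (P : pred I) (F : I -> Omega -> R) :
  (forall i, bounded_rv (F i)) ->
  mean (fun a => \sum_(i <- r | P i) F i a) = \sum_(i <- r | P i) mean (F i).
Proof.
move=> bF; elim: r => [|i r IH].
  by under eq_fun do rewrite big_nil; rewrite big_nil mean_cst.
under eq_fun do rewrite big_cons; rewrite big_cons.
by case: (P i) => //; rewrite meanD// ?IH//; exact: brv_sum.
Qed.

Lemma brv_indic A : measurable A -> bounded_rv (\1_A : Omega -> R).
Proof.
move=> mA; split; first exact: measurable_indic.
by exists 1 => a; rewrite indicE; case: (_ \in _); rewrite ?normr1 ?normr0.
Qed.

Lemma mean_indic A : measurable A -> mean (\1_A : Omega -> R) = fine (Pr A).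
Proof. by move=> mA; rewrite /mean /Rintegral integral_indic// setIT. Qed.

End expectation.

Section layers.
Context {R : realType}.

(** A function with values in [0, 1] is, up to [1 / m], an average of [m]
    indicators of its superlevel sets. *)
Lemma layer_approx (m : nat) (y : R) : 0 <= y <= 1 ->
  `|y - m.+1%:R^-1 * \sum_(j < m.+1) (j.+1%:R / m.+1%:R <= y)%R%:R| <= m.+1%:R^-1.
Proof.
move=> /andP[y0 y1]; have m0 : (0 : R) < m.+1%:R by rewrite ltr0n.
have f0 : (0 <= Num.floor (y * m.+1%:R))%R by rewrite floor_ge0 mulr_ge0// ltW.
pose k := `|Num.floor (y * m.+1%:R)|%N.
have kE : k%:R = (Num.floor (y * m.+1%:R))%:~R :> R.
  by rewrite /k natr_absz ger0_norm.
have kle : k%:R <= y * m.+1%:R by rewrite kE floor_le.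
have klt : y * m.+1%:R < k%:R + 1.
  by rewrite kE; have := floorD1_gt (y * m.+1%:R); rewrite intrD.
have km : (k <= m.+1)%N.
  rewrite -(ler_nat R); apply: le_trans kle _; by rewrite ler_piMl// ltW.
have -> : \sum_(j < m.+1) (j.+1%:R / m.+1%:R <= y)%R%:R = k%:R :> R.
  rewrite (eq_bigr (fun j : 'I_m.+1 => ((j < k)%N)%:R)); last first.
    move=> j _; congr (_%:R); congr nat_of_bool.
    rewrite ler_pdivrMr//; apply/idP/idP => [jy|jk].
      by rewrite -(ltr_nat R) -(ltrD2r 1) natr1; exact: le_lt_trans klt.
    by apply: le_trans kle; rewrite ler_nat.
  rewrite -natr_sum; congr (_%:R); rewrite -(big_mkord xpredT (fun j => (j < k)%N : nat)).
  rewrite (big_cat_nat (n := k))//= (eq_big_nat _ _ (F2 := fun=> 1%N)); last first.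
    by move=> j /andP[_ ->].
  have -> : (\sum_(k <= j < m.+1) (j < k)%N = 0)%N.
    by rewrite big_nat_cond big1// => j /andP[/andP[kj _] _]; rewrite ltnNge kj.
  by rewrite sum_nat_const_nat subn0 muln1 addn0.
have -> : y - m.+1%:R^-1 * k%:R = m.+1%:R^-1 * (y * m.+1%:R - k%:R).
  by rewrite mulrBr mulrCA mulVf ?mulr1// gt_eqF.
rewrite normrM (ger0_norm (x := m.+1%:R^-1)) ?invr_ge0 ?(ltW m0)//.
rewrite ler_piMr ?invr_ge0 ?(ltW m0)// ler_norml; lra.
Qed.

End layers.

Section bounded_functional.
Context {R : realType} {d : measure_display} {T : measurableType d}.
Implicit Types (u v f : T -> R).

Definition bounded_functional (m : (T -> R) -> R) :=
  [/\ forall u v, bounded_rv u -> bounded_rv v -> m (fun a => u a + v a) = m u + m v,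
      forall k u, bounded_rv u -> m (fun a => k * u a) = k * m u &
      forall u b, bounded_rv u -> (forall a, `|u a| <= b) -> `|m u| <= b].

Lemma bounded_functional_sum m (k : nat) (F : 'I_k -> T -> R) :
  bounded_functional m -> (forall i, bounded_rv (F i)) ->
  m (fun a => \sum_(i < k) F i a) = \sum_(i < k) m (F i).
Proof.
move=> [mD mZ _] bF; elim: k F bF => [|k IH] F bF.
  under eq_fun do rewrite big_ord0; rewrite big_ord0.
  by have := mZ 0 (cst 0) (brv_cst 0); under eq_fun do rewrite mul0r; rewrite mul0r.
under eq_fun do rewrite big_ord_recr /=; rewrite big_ord_recr /= mD//.
  by rewrite IH.
exact: brv_sum.
Qed.

(** Bounded functions are uniform limits of combinations of indicators of their
    superlevel sets, so that indicators determine such functionals. *)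
Lemma bounded_functional_ext m1 m2 f :
  bounded_functional m1 -> bounded_functional m2 ->
  (forall B, measurable B -> m1 \1_B = m2 \1_B) ->
  measurable_fun setT f -> (forall x, 0 <= f x <= 1) -> m1 f = m2 f.
Proof.
move=> bf1 bf2 m12 mf f01.
pose g (m : nat) (x : T) : R := m.+1%:R^-1 *
  \sum_(j < m.+1) \1_(f @^-1` `[j.+1%:R / m.+1%:R, +oo[) x.
have gf m x : `|f x - g m x| <= m.+1%:R^-1.
  rewrite /g (eq_bigr (fun j : 'I_m.+1 => (j.+1%:R / m.+1%:R <= f x)%R%:R)).
    exact: layer_approx.
  move=> j _; rewrite indicE; congr (nat_of_bool _)%:R.
  by apply/idP/idP; rewrite inE /= in_itv/= andbT.
have mlev m (j : 'I_m.+1) : measurable (f @^-1` `[j.+1%:R / m.+1%:R, +oo[).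
  by rewrite -[X in measurable X]setTI; apply: mf => //; exact: measurable_itv.
have bind m (j : 'I_m.+1) :
    bounded_rv (\1_(f @^-1` `[j.+1%:R / m.+1%:R, +oo[) : T -> R) by exact: brv_indic.
have bs m : bounded_rv (fun x => \sum_(j < m.+1) (\1_(f @^-1` `[j.+1%:R / m.+1%:R, +oo[) x : R)).
  exact: brv_sum.
have bg m : bounded_rv (g m) by apply: brvM; [exact: brv_cst|exact: bs].
have bf : bounded_rv f.
  by split => //; exists 1 => x; have := f01 x; rewrite ler_norml; lra.
have Eg m : m1 (g m) = m2 (g m).
  have [_ Z1 _] := bf1; have [_ Z2 _] := bf2.
  rewrite /g Z1// Z2//; congr (_ * _).
  rewrite !bounded_functional_sum//.
  by apply: eq_bigr => j _; exact: m12.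
have close (m : (T -> R) -> R) n : bounded_functional m -> `|m f - m (g n)| <= n.+1%:R^-1.
  move=> [mD mZ mN].
  have -> : m f - m (g n) = m (fun x => f x + -1 * g n x).
    rewrite mD//; first by rewrite (mZ (-1) (g n))// mulN1r.
    by apply: brvM => //; exact: brv_cst.
  apply: mN; first by apply: brvD => //; apply: brvM => //; exact: brv_cst.
  by move=> x; rewrite mulN1r.
apply/eqP; rewrite -subr_eq0 -normr_le0; apply/ler_addgt0Pr => e e0; rewrite add0r.
have e20 : 0 < e / 2 by lra.
have /cvgrPdist_le /(_ (e / 2) e20) [n _ /(_ n (leqnn n))] := @cvg_harmonic R.
rewrite /= sub0r normrN ger0_norm ?invr_ge0// => ne.
have := le_trans (close _ n bf1) ne; have := le_trans (close _ n bf2) ne.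
rewrite Eg; move: (m1 f) (m2 f) (m2 (g n)) => x y z.
by rewrite !ler_norml => /andP[? ?] /andP[? ?]; apply/andP; split; lra.
Qed.

End bounded_functional.

Lemma bounded_functional_weighted d (T : measurableType d) (R : realType)
    (mu : {measure set T -> \bar R}) (G : set T) (r : T -> R) :
  measurable G -> measurable_fun G r -> (forall P, G P -> 0 <= r P) ->
  (\int[mu]_(P in G) (r P)%:E = 1)%E ->
  bounded_functional (weighted_integral mu G r).
Proof.
move=> mG mr r0 r1; have bm u : bounded_rv u -> bounded_measurable_on G u.
  by move=> [mu_ [b ub]]; split => //; exists b => P _.
split.
- by move=> u v /bm bu /bm bv; exact: wintD.
- by move=> k u /bm bu; exact: wintZ.
- by move=> u b /bm bu ub; apply: wint_norm_le.
Qed.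

Section independence.
Context {R : realType} {d : measure_display} {Omega : measurableType d}.
Variable Pr : probability Omega R.
Local Notation E := (mean Pr).

Lemma brv_comp (X : Omega -> R) (f : R -> R) : measurable_fun setT X ->
  measurable_fun setT f -> (forall x, 0 <= f x <= 1) -> bounded_rv (fun a => f (X a)).
Proof.
move=> mX mf f01; split; first exact: measurableT_comp.
by exists 1 => a; have := f01 (X a); rewrite ler_norml; lra.
Qed.

Lemma measurable_preimage (X : Omega -> R) (B : set R) :
  measurable_fun setT X -> measurable B -> measurable (X @^-1` B).
Proof. by move=> mX mB; rewrite -[X in measurable X]setTI; exact: mX. Qed.

(** Both sides are bounded functionals of [f], and they agree on indicators by
    hypothesis. *)
Lemma mean_factor (X Y : Omega -> R) (c : R) (f : R -> R) :
  measurable_fun setT X -> bounded_rv Y -> (forall a, `|Y a| <= 1) -> `|c| <= 1 ->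
  (forall B, measurable B ->
    E (fun a => \1_(X @^-1` B) a * Y a) = fine (Pr (X @^-1` B)) * c) ->
  measurable_fun setT f -> (forall x, 0 <= f x <= 1) ->
  E (fun a => f (X a) * Y a) = E (fun a => f (X a)) * c.
Proof.
move=> mX bY Y1 c1 XY mf f01.
have bX (u : R -> R) : bounded_rv u -> bounded_rv (fun a => u (X a)).
  move=> [mu [b ub]]; split; first exact: measurableT_comp.
  by exists b => a.
apply: (@bounded_functional_ext _ _ _ (fun u => E (fun a => u (X a) * Y a))
  (fun u => E (fun a => u (X a)) * c)) => //.
- split.
  + move=> u v bu bv; rewrite -meanD; [|by apply: brvM => //; exact: bX..].
    by congr (mean Pr _); apply/funext => a; rewrite mulrDl.
  + move=> k u bu; rewrite -meanZ; last by apply: brvM => //; exact: bX.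
    by congr (mean Pr _); apply/funext => a; rewrite mulrA.
  + move=> u b bu ub; apply: mean_norm_le; first by apply: brvM => //; exact: bX.
    move=> a; rewrite normrM; apply: le_trans (ub (X a)).
    by rewrite ler_piMr.
- split.
  + by move=> u v bu bv; rewrite meanD ?mulrDl//; exact: bX.
  + by move=> k u bu; rewrite meanZ ?mulrA//; exact: bX.
  + move=> u b bu ub; rewrite normrM.
    have h : `|E (fun a => u (X a))| <= b by apply: mean_norm_le; [exact: bX|].
    by apply: le_trans h; rewrite ler_piMr.
- move=> B mB; have := XY B mB.
  by rewrite -(mean_indic Pr (measurable_preimage mX mB)).
Qed.

Lemma prod_indic (I : eqType) (J : seq I) (A : I -> set Omega) a :
  \prod_(j <- J) \1_(A j) a = \1_(\bigcap_(j in [set` J]) A j) a :> R.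
Proof.
have [h|h] := pselect (forall j, j \in J -> A j a).
  rewrite big1_seq => [|j /andP[_ jJ]]; last by rewrite indicE mem_set//; exact: h.
  by rewrite indicE mem_set.
rewrite [RHS]indicE memNset; last by move=> c; apply: h => j jJ; exact: c.
move/existsNP : h => [j /not_implyP [jJ nAj]].
by rewrite (big_rem j)//= indicE memNset// mul0r.
Qed.

Lemma fine_prob_bigcap (I : eqType) (J : seq I) (A : I -> set Omega) (S : set Omega) :
  Pr S = (\prod_(j <- J) Pr (A j))%E -> (forall j, measurable (A j)) ->
  fine (Pr S) = \prod_(j <- J) fine (Pr (A j)).
Proof.
move=> -> mA; rewrite (eq_bigr (fun j => (fine (Pr (A j)))%:E)); last first.
  by move=> j _; rewrite fineK// fin_num_measure.
by rewrite prodEFin.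
Qed.

Variable X : nat -> Omega -> R.
Hypothesis mX : forall i, measurable_fun setT (X i).
Hypothesis indX : mutually_independent Pr X.

(** Independence of events becomes independence of functions one index at a time:
    the indices in [J2] still carry indicators, and moving one of them to [J1] is
    an instance of [mean_factor]. *)
Lemma mean_prod_independent_mixed (f : nat -> R -> R) (J1 J2 : seq nat) (B : nat -> set R) :
  (forall i, measurable_fun setT (f i)) -> (forall i x, 0 <= f i x <= 1) ->
  uniq (J1 ++ J2) -> (forall i, measurable (B i)) ->
  E (fun a => \prod_(i <- J1) f i (X i a) * \prod_(j <- J2) \1_(X j @^-1` B j) a) =
  \prod_(i <- J1) E (fun a => f i (X i a)) * \prod_(j <- J2) fine (Pr (X j @^-1` B j)).
Proof.
move=> mf f01; elim: J1 J2 B => [|i J1 IH] J2 B /=.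
  move=> uJ mB; rewrite big_nil mul1r.
  under eq_fun do rewrite big_nil mul1r prod_indic.
  have mXB j : measurable (X j @^-1` B j) by exact: measurable_preimage.
  rewrite mean_indic; last exact: bigcap_measurableType.
  by apply: fine_prob_bigcap => //; exact: indX.
move=> /andP[iJ uJ] mB.
have iJ1 : i \notin J1 by move: iJ; rewrite mem_cat negb_or => /andP[].
have iJ2 : i \notin J2 by move: iJ; rewrite mem_cat negb_or => /andP[].
rewrite big_cons -mulrA; under eq_fun do rewrite big_cons -mulrA.
have prod01 (I : Type) (r : seq I) (F : I -> R) :
    (forall k, 0 <= F k <= 1) -> 0 <= \prod_(k <- r) F k <= 1.
  move=> F01; apply/andP; split; first by apply: prodr_ge0 => k _; case/andP: (F01 k).
  by apply: prodr_ile1 => k _; exact: F01.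
have ind01 A a : 0 <= (\1_A a : R) <= 1.
  by rewrite indicE; case: (_ \in _); rewrite ?lexx ?ler01.
have Ef01 k : 0 <= E (fun a => f k (X k a)) <= 1.
  have bk := brv_comp (mX k) (mf k) (f01 k).
  have f0 a : cst 0 a <= f k (X k a) by case/andP: (f01 k (X k a)).
  have f1 a : f k (X k a) <= cst 1 a by case/andP: (f01 k (X k a)).
  have := le_mean Pr (brv_cst 0) bk f0; have := le_mean Pr bk (brv_cst 1) f1.
  by rewrite !mean_cst => -> ->.
apply: mean_factor => //.
- apply: brvM; apply: brv_prod => k; first exact: brv_comp.
  exact/brv_indic/measurable_preimage.
- move=> a.
  have /andP[p0 p1] := prod01 _ J1 (fun k => f k (X k a)) (fun k => f01 k _).
  have /andP[q0 q1] := prod01 _ J2 (fun k => \1_(X k @^-1` B k) a) (fun k => ind01 _ _ a).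
  by rewrite ger0_norm ?mulr_ge0// mulr_ile1.
- have /andP[p0 p1] := prod01 _ J1 _ Ef01.
  have P01 k : 0 <= fine (Pr (X k @^-1` B k)) <= 1.
    rewrite fine_ge0//= -lee_fin fineK ?fin_num_measure ?probability_le1//;
      exact: measurable_preimage.
  have /andP[q0 q1] := prod01 _ J2 _ P01.
  by rewrite ger0_norm ?mulr_ge0// mulr_ile1.
- move=> C mC; pose B' k := if k == i then C else B k.
  have B'E k : k \in J2 -> B' k = B k.
    by move=> kJ2; rewrite /B' ifN//; apply: contraNneq iJ2 => <-.
  have uJ' : uniq (J1 ++ i :: J2) by rewrite -cat1s uniq_catCA /= iJ.
  have mB' k : measurable (B' k) by rewrite /B'; case: ifP.
  have := IH (i :: J2) B' uJ' mB'.
  have -> : \prod_(j <- i :: J2) fine (Pr (X j @^-1` B' j)) =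
      fine (Pr (X i @^-1` C)) * \prod_(j <- J2) fine (Pr (X j @^-1` B j)).
    rewrite big_cons {1}/B' eqxx; congr (_ * _).
    by apply: eq_big_seq => k /B'E ->.
  rewrite mulrCA => <-; congr (mean Pr _); apply/funext => a.
  rewrite mulrCA big_cons {1}/B' eqxx; congr (_ * (_ * _)).
  by apply: eq_big_seq => k /B'E ->.
Qed.

Lemma mean_prod_independent (f : nat -> R -> R) (J : seq nat) :
  (forall i, measurable_fun setT (f i)) -> (forall i x, 0 <= f i x <= 1) -> uniq J ->
  E (fun a => \prod_(i <- J) f i (X i a)) = \prod_(i <- J) E (fun a => f i (X i a)).
Proof.
move=> mf f01 uJ.
have := @mean_prod_independent_mixed f J [::] (fun=> setT) mf f01.
rewrite cats0 big_nil mulr1 => /(_ uJ (fun=> measurableT)) <-.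
by congr (mean Pr _); apply/funext => a; rewrite big_nil mulr1.
Qed.

End independence.

(** * Concentration and a strong law for arrays *)

Section expR_bounds.
Context {R : realType}.

Lemma expR_quadratic (u : R) : `|u| <= 2^-1 -> expR u <= 1 + u + 2 * u ^+ 2.
Proof.
rewrite ler_norml => /andP[u1 u2].
have h : expR u * (1 - u) <= 1.
  rewrite -[X in _ <= X](expRxMexpNx_1 u) ler_wpM2l ?expR_ge0//.
  exact: expR_ge1Dx.
have := sqr_ge0 u; have := expR_gt0 u; rewrite expr2 in h *; nra.
Qed.

(** Centered Bernoulli variables are sub-Gaussian. *)
Lemma bernoulli_mgf (u p : R) : `|u| <= 2^-1 -> 0 <= p <= 1 ->
  (1 + (expR u - 1) * p) * expR (- (u * p)) <= expR (2 * u ^+ 2).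
Proof.
move=> u2 /andP[p0 p1].
apply: le_trans (_ : expR ((expR u - 1) * p) * expR (- (u * p)) <= _).
  by rewrite ler_wpM2r ?expR_ge0// expR_ge1Dx.
rewrite -expRD ler_expR.
have := expR_quadratic u2; have := sqr_ge0 u.
have -> : (expR u - 1) * p + - (u * p) = (expR u - 1 - u) * p by ring.
by nra.
Qed.

End expR_bounds.

Section concentration.
Context {R : realType} {d : measure_display} {Omega : measurableType d}.
Variable Pr : probability Omega R.
Local Notation E := (mean Pr).
Variables (n : nat) (Ev : 'I_n -> set Omega) (c p : 'I_n -> R).
Hypothesis mEv : forall i, measurable (Ev i).
Hypothesis c01 : forall i, 0 <= c i <= 1.
Hypothesis p01 : forall i, 0 <= p i <= 1.
Hypothesis ind : forall J : {set 'I_n},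
  E (fun a => \prod_(i in J) \1_(Ev i) a) = \prod_(i in J) p i.

Definition deviation (a : Omega) : R := \sum_(i < n) c i * (\1_(Ev i) a - p i).

Lemma brv_deviation : bounded_rv deviation.
Proof.
apply: brv_sum => i; apply: brvM; first exact: brv_cst.
by apply: brvB; [exact: brv_indic|exact: brv_cst].
Qed.

(** Expanding the product reduces to the product rule for subfamilies. *)
Lemma mean_prod_affine (v : 'I_n -> R) :
  E (fun a => \prod_(i < n) (v i * \1_(Ev i) a + 1)) = \prod_(i < n) (v i * p i + 1).
Proof.
rewrite bigA_distr /=.
under eq_fun do rewrite bigA_distr /=.
have splitE (J : {set 'I_n}) (F : 'I_n -> R) :
    \prod_i (if i \in J then v i * F i else 1) =
    \prod_(i in J) v i * \prod_(i in J) F i.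
  by rewrite -big_split/= [RHS]big_mkcond.
rewrite mean_sum => [|J]; last first.
  apply: brv_prod => i; case: (i \in J); last exact: brv_cst.
  by apply: brvM; [exact: brv_cst|exact: brv_indic].
apply: eq_bigr => J _; rewrite splitE -ind -meanZ.
  by congr (mean Pr _); apply/funext => a; rewrite splitE.
by apply: brv_prod => i; exact: brv_indic.
Qed.

(** The exponential of an indicator is an affine function of it. *)
Lemma expR_deviation s a : expR (s * deviation a) =
  \prod_(i < n) ((expR (s * c i) - 1) * \1_(Ev i) a + 1) *
  \prod_(i < n) expR (- (s * c i * p i)).
Proof.
rewrite /deviation mulr_sumr expR_sum -big_split /=; apply: eq_bigr => i _.
rewrite indicE; case: (_ \in _) => /=.
  rewrite mulr1 subrK -expRD; congr expR; ring.
have -> : (expR (s * c i) - 1) * 0 + 1 = 1 by ring.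
by rewrite mul1r; congr expR; ring.
Qed.

Lemma brv_expR_deviation s : bounded_rv (fun a => expR (s * deviation a)).
Proof.
under eq_fun do rewrite expR_deviation.
apply: brvM; last exact: brv_cst.
apply: brv_prod => i; apply: brvD; last exact: brv_cst.
by apply: brvM; [exact: brv_cst|exact: brv_indic].
Qed.

Lemma chernoff_mgf s : `|s| <= 2^-1 ->
  E (fun a => expR (s * deviation a)) <= expR (2 * s ^+ 2) ^+ n.
Proof.
move=> s2; under eq_fun do rewrite expR_deviation mulrC.
rewrite meanZ; last first.
  apply: brv_prod => i; apply: brvD; last exact: brv_cst.
  by apply: brvM; [exact: brv_cst|exact: brv_indic].
rewrite mean_prod_affine mulrC -big_split /=.
rewrite -[X in _ ^+ X]card_ord -prodr_const; apply: ler_prod => i _.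
have /andP[c0 c1] := c01 i; have /andP[p0 p1] := p01 i.
have sc : `|s * c i| <= 2^-1.
  by rewrite normrM (ger0_norm c0); apply: le_trans s2; rewrite ler_piMr.
apply/andP; split.
  rewrite mulr_ge0 ?expR_ge0//.
  have := expR_ge1Dx (s * c i); move: sc; rewrite ler_norml => /andP[? ?] ?.
  nra.
rewrite addrC; apply: le_trans (bernoulli_mgf sc (p01 i)) _.
rewrite ler_expR ler_wpM2l// exprMn ler_piMr ?sqr_ge0//.
by rewrite expr_le1.
Qed.

(** Markov's inequality for the exponential; the sign of [s] selects the upper or
    the lower deviations. *)
Lemma chernoff_upper (s e : R) : 0 < e -> e <= 1 -> `|s| = e / 4 ->
  fine (Pr [set a | n%:R * (e * (e / 4)) <= s * deviation a]) <=
  expR (- (e ^+ 2 / 8)) ^+ n.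
Proof.
move=> e0 e1 se; set A := [set a | _].
have mdev : measurable_fun setT (fun a => s * deviation a).
  by case: (brvM (brv_cst s) brv_deviation).
have mA : measurable A.
  rewrite -[A]setTI (_ : A = (fun a => s * deviation a) @^-1`
    `[n%:R * (e * (e / 4)), +oo[); last first.
    by apply/seteqP; split => a; rewrite /A /= in_itv/= andbT.
  by apply: mdev => //; exact: measurable_itv.
have s2 : `|s| <= 2^-1 by rewrite se; lra.
have h := chernoff_mgf s2.
have markov : fine (Pr A) * expR (n%:R * (e * (e / 4))) <=
    E (fun a => expR (s * deviation a)).
  rewrite mulrC -(mean_indic Pr mA) -meanZ; last exact: brv_indic.
  apply: le_mean; last first.
  - move=> a; rewrite indicE; have [aA|aA] := boolP (a \in A).
      by rewrite mulr1 ler_expR; move: aA; rewrite inE.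
    by rewrite mulr0 expR_ge0.
  - exact: brv_expR_deviation.
  - by apply: brvM; [exact: brv_cst|exact: brv_indic].
have {markov h} := le_trans markov h.
rewrite -ler_pdivlMr ?expR_gt0// -expRN => /le_trans; apply.
rewrite -!expRM_natl -expRD ler_expR.
have -> : s ^+ 2 = (e / 4) ^+ 2 by rewrite -se real_normK// num_real.
rewrite le_eqVlt; apply/orP; left; apply/eqP.
by rewrite !expr2; field.
Qed.

End concentration.

Section borel_cantelli.
Context {R : realType} {d : measure_display} {Omega : measurableType d}.
Variable Pr : probability Omega R.

Lemma ae_eventually_not (F : nat -> set Omega) (C q : R) :
  (forall n, measurable (F n)) -> 0 <= C -> 0 <= q < 1 ->
  (forall n, fine (Pr (F n)) <= C * q ^+ n) ->
  {ae Pr, forall a, \forall n \near \oo, ~ F n a}.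
Proof.
move=> mF C0 /andP[q0 q1] Fq.
have sumF : (\sum_(n <oo) Pr (F n) < +oo)%E.
  apply: (@le_lt_trans _ _ (\sum_(n <oo) (C * q ^+ n)%:E)%E).
    apply: lee_nneseries => n _ //.
    by rewrite -[X in (X <= _)%E]fineK ?fin_num_measure// lee_fin.
  have cv : cvgn (series (geometric C q)).
    by apply: is_cvg_geometric_series; rewrite ger0_norm.
  rewrite (_ : (\sum_(n <oo) _)%E = (limn (series (geometric C q)))%:E) ?ltry//.
  rewrite -EFin_lim//; congr (limn _); apply/funext => n /=.
  by rewrite /series /= sumEFin.
have mL : measurable (lim_sup_set F).
  apply: bigcap_measurableType => n _; apply: bigcup_measurable => k _.
  exact: mF.
have [N [mN N0 subN]] := (negligibleP Pr mL).2 (lim_sup_set_cvg0 mF sumF).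
exists N; split => // a /= na; apply: subN => n _.
apply: contrapT => nF; apply: na; exists n => // k /= nk Fk.
by apply: nF; exists k.
Qed.

End borel_cantelli.

Section strong_law.
Context {R : realType} {d : measure_display} {Omega : measurableType d}.
Variable Pr : probability Omega R.
Variables (Ev : forall n, 'I_n -> set Omega) (c p : forall n, 'I_n -> R).
Hypothesis mEv : forall n i, measurable (@Ev n i).
Hypothesis c01 : forall n i, 0 <= @c n i <= 1.
Hypothesis p01 : forall n i, 0 <= @p n i <= 1.
Hypothesis ind : forall n (J : {set 'I_n}),
  mean Pr (fun a => \prod_(i in J) \1_(@Ev n i) a) = \prod_(i in J) @p n i.

(** The rows of the array may depend on each other in any way, as the bounds on
    their deviations are summable. *)
Lemma strong_law_rows : {ae Pr, forall a,
  (fun n => n%:R^-1 * deviation (@Ev n) (@c n) (@p n) a) @ \oo --> (0 : R)}.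
Proof.
have ev (s : bool) (k : nat) : {ae Pr, forall a, \forall n \near \oo,
    ~ (n%:R * (k.+1%:R^-1 * (k.+1%:R^-1 / 4)) <=
       (if s then k.+1%:R^-1 / 4 else - (k.+1%:R^-1 / 4)) *
       deviation (@Ev n) (@c n) (@p n) a)}.
  set e : R := k.+1%:R^-1; set ss := if s then _ else _.
  have e0 : 0 < e by rewrite /e invr_gt0 ltr0n.
  have e1 : e <= 1 by rewrite /e invf_le1 ?ltr0n// ler1n.
  have se : `|ss| = e / 4.
    by rewrite /ss; case: (s); rewrite ?normrN gtr0_norm// divr_gt0.
  apply: (@ae_eventually_not _ _ _ Pr (fun n => [set a |
    n%:R * (e * (e / 4)) <= ss * deviation (@Ev n) (@c n) (@p n) a])
    1 (expR (- (e ^+ 2 / 8)))).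
  - move=> n.
    have mdev : measurable_fun setT (fun a => ss * deviation (@Ev n) (@c n) (@p n) a).
      by case: (brvM (brv_cst ss) (brv_deviation (@c n) (@p n) (@mEv n))).
    rewrite -[X in measurable X]setTI (_ : [set a | _] =
      (fun a => ss * deviation (@Ev n) (@c n) (@p n) a) @^-1`
      `[n%:R * (e * (e / 4)), +oo[); last first.
      by apply/seteqP; split => a; rewrite /= in_itv/= andbT.
    by apply: mdev => //; exact: measurable_itv.
  - exact: ler01.
  - by rewrite expR_ge0 -expR0 ltr_expR oppr_lt0 divr_gt0// exprn_gt0.
  - move=> n; rewrite mul1r.
    exact: (chernoff_upper (@mEv n) (@c01 n) (@p01 n) (@ind n) e0 e1 se).
have := ae_foralln (ev true); have := ae_foralln (ev false).
apply: filterS2 => a hN hP; apply/cvgrPdist_lt => e e0.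
have [k ke] : exists k : nat, k.+1%:R^-1 < e.
  have /cvgrPdist_lt /(_ e e0) [k _ /(_ k (leqnn k))] := @cvg_harmonic R.
  by rewrite /= sub0r normrN ger0_norm ?invr_ge0// => h; exists k.
near=> n; rewrite sub0r normrN.
have n0 : (0 : R) < n%:R by rewrite ltr0n; near: n; exists 1%N.
apply: le_lt_trans ke.
have h1 : ~ (n%:R * (k.+1%:R^-1 * (k.+1%:R^-1 / 4)) <=
       - (k.+1%:R^-1 / 4) * deviation (@Ev n) (@c n) (@p n) a).
  by near: n; exact: (hN k).
have h2 : ~ (n%:R * (k.+1%:R^-1 * (k.+1%:R^-1 / 4)) <=
       k.+1%:R^-1 / 4 * deviation (@Ev n) (@c n) (@p n) a).
  by near: n; exact: (hP k).
have q0 : (0 : R) < k.+1%:R^-1 by rewrite invr_gt0 ltr0n.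
move: h1 h2 q0; move: (k.+1%:R^-1) => q h1 h2 q0.
rewrite normrM ger0_norm ?invr_ge0 ?(ltW n0)// ler_pdivrMl//.
move/negP : h1; move/negP : h2; rewrite -!ltNge.
move: (deviation _ _ _ _) => D.
have q4 : 0 < q / 4 by lra.
have -> : n%:R * (q * (q / 4)) = q / 4 * (n%:R * q) by ring.
rewrite ltr_pM2l// mulNr -mulrN ltr_pM2l// => h1 h2.
by rewrite ler_norml; lra.
Unshelve. all: by end_near. Qed.

End strong_law.

(** * Conditional sampling of the phases *)

Section conditional_density.
Context {R : realType}.
Variable rho0 : R * R * R -> R.
Hypothesis crho0 : G_continuous rho0.
Hypothesis rho0_ge0 : forall P, Gset P -> 0 <= rho0 P.
Hypothesis rho0_int1 : forall om x : R, 0 <= x <= 1 ->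
  (\int[lebesgue_measure]_(phi in circle) (rho0 (phi, om, x))%:E = 1)%E.
Hypothesis rho0_unif : forall eps : R, 0 < eps -> exists2 delta : R, 0 < delta &
  forall x1 x2 : R, 0 <= x1 <= 1 -> 0 <= x2 <= 1 -> `|x1 - x2| < delta ->
  forall th om : R, circle th ->
    `|rho0 (th, om, x1) - rho0 (th, om, x2)| < eps.

Lemma G_extension_continuous : continuous (G_extension rho0).
Proof.
apply: (cts_within_comp (h := fun P : R * R * R => (P.1.1, P.1.2, clamp01 P.2)) crho0).
  apply: cts_pair; last exact: (cts_comp clamp01_continuous cts_pos).
  by apply: cts_pair; [exact: cts_theta|exact: cts_omega].
by move=> P; rewrite /= in_itv/= clamp01_itv.
Qed.

Lemma G_extension_ge0 P : 0 <= G_extension rho0 P.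
Proof.
apply: rho0_ge0; split => /=; first exact: circle_repr_circle.
by rewrite in_itv/= clamp01_itv.
Qed.

Lemma measurable_circle : measurable (@circle R).
Proof. exact: measurable_itv. Qed.

Lemma measurable_density_theta l x :
  measurable_fun setT (fun a : R => G_extension rho0 (a, l, x)).
Proof.
apply: continuous_measurable_fun; apply: (cts_comp G_extension_continuous).
apply: cts_pair; last exact: cst_continuous.
by apply: cts_pair; [move=> y; exact: cvg_id|exact: cst_continuous].
Qed.

Lemma conditional_integralE (A : set R) l x : 0 <= x <= 1 ->
  (\int[lebesgue_measure]_(phi in A `&` circle) (rho0 (phi, l, x))%:E =
   \int[lebesgue_measure]_(phi in A `&` circle) (G_extension rho0 (phi, l, x))%:E)%E.
Proof.
by move=> x01; apply: eq_integral => phi /[!inE] -[_ cphi]; rewrite G_extensionE.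
Qed.

Lemma conditional_integral_le1 (A : set R) l x : measurable A -> 0 <= x <= 1 ->
  (0 <= \int[lebesgue_measure]_(phi in A `&` circle) (rho0 (phi, l, x))%:E <= 1)%E.
Proof.
move=> mA x01; rewrite conditional_integralE//.
have mc := measurable_circle.
have d0 phi : (0 <= (G_extension rho0 (phi, l, x))%:E)%E by rewrite lee_fin G_extension_ge0.
apply/andP; split; first by apply: integral_ge0 => phi _; exact: d0.
have h := conditional_integralE setT l x01; rewrite setTI rho0_int1// in h.
rewrite [X in (_ <= X)%E]h; apply: ge0_subset_integral => //.
- exact: measurableI.
- by apply/measurable_EFinP; apply: measurable_funTS; exact: measurable_density_theta.
Qed.

Definition conditional_prob (A : set R) (l x : R) : R :=
  \int[lebesgue_measure]_(phi in A `&` circle) rho0 (phi, l, x).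

Lemma conditional_probE A l x : measurable A -> 0 <= x <= 1 ->
  (conditional_prob A l x)%:E =
  (\int[lebesgue_measure]_(phi in A `&` circle) (rho0 (phi, l, x))%:E)%E.
Proof.
move=> mA x01; rewrite /conditional_prob /Rintegral fineK//.
have /andP[h0 h1] := conditional_integral_le1 l mA x01.
by rewrite ge0_fin_numE// (le_lt_trans h1) ?ltry.
Qed.

Lemma conditional_prob_itv A l x : measurable A -> 0 <= x <= 1 ->
  0 <= conditional_prob A l x <= 1.
Proof.
move=> mA x01; rewrite -!lee_fin conditional_probE//.
exact: conditional_integral_le1.
Qed.

Lemma conditional_probT l x : 0 <= x <= 1 -> conditional_prob setT l x = 1.
Proof.
by move=> x01; rewrite /conditional_prob setTI /Rintegral rho0_int1.
Qed.

Lemma conditional_prob_measurable A x : measurable A -> 0 <= x <= 1 ->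
  measurable_fun setT (fun l => conditional_prob A l x).
Proof.
move=> mA x01.
pose f (z : R * R) : \bar R := (\1_(A `&` circle) z.1 * G_extension rho0 (z.1, z.2, x))%:E.
have mi : measurable_fun setT (\1_(A `&` circle) : R -> R).
  by apply: measurable_indic; apply: measurableI => //; exact: measurable_circle.
have mf : measurable_fun setT f.
  apply/measurable_EFinP; apply: measurable_funM.
    exact: (measurableT_comp mi measurable_fst).
  have -> : (fun z : R * R => G_extension rho0 (z.1, z.2, x)) =
    (G_extension rho0) \o (fun z : R * R => (z, x)) by apply/funext => -[].
  apply: measurableT_comp; first exact: continuous_measurable3 G_extension_continuous.
  exact: measurable_pair2.
have f0 z : (0 <= f z)%E.
  by rewrite lee_fin mulr_ge0 ?G_extension_ge0// indicE ler0n.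
have mG := measurable_fun_fubini_tonelli_G (m1 := @lebesgue_measure R) f mf f0.
have := measurableT_comp (fine_measurable measurableT) mG.
apply: eq_measurable_fun => l _ /=.
rewrite /conditional_prob /Rintegral /fubini_G; congr fine.
rewrite conditional_integralE// [RHS]integral_mkcond; apply: eq_integral => phi _.
by rewrite /f /= patchE indicE; case: ifP => _; rewrite ?mul1r ?mul0r.
Qed.

End conditional_density.

Section sampled_events.
Context {R : realType} {d : measure_display} {Omega : measurableType d}.
Variables (Pr : probability Omega R) (g : R -> R) (rho0 : R * R * R -> R).
Hypothesis cg : continuous g.
Hypothesis g0 : forall x, 0 <= g x.
Hypothesis g1 : (\int[lebesgue_measure]_x (g x)%:E = 1)%E.
Hypothesis crho0 : G_continuous rho0.
Hypothesis rho0_ge0 : forall P, Gset P -> 0 <= rho0 P.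
Hypothesis rho0_int1 : forall om x : R, 0 <= x <= 1 ->
  (\int[lebesgue_measure]_(phi in circle) (rho0 (phi, om, x))%:E = 1)%E.
Variable omega : nat -> Omega -> R.
Hypothesis momega : forall i, measurable_fun setT (omega i).
Hypothesis domega : forall i, has_density Pr (omega i) g.
Hypothesis iomega : mutually_independent Pr omega.
Local Notation E := (mean Pr).
Local Notation q := (conditional_prob rho0).

Definition frequency_mean (u : R -> R) : R := \int[lebesgue_measure]_l (u l * g l).

Let mg : measurable_fun setT g.
Proof. exact: continuous_measurable_fun. Qed.

Let gT0 (x : R) : [set: R] x -> 0 <= g x.
Proof. by move=> _; exact: g0. Qed.

Lemma bounded_functional_frequency : bounded_functional frequency_mean.
Proof. exact: (bounded_functional_weighted (mu := lebesgue_measure) measurableT mg gT0 g1). Qed.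

Lemma mean_omega i (f : R -> R) : measurable_fun setT f ->
  (forall x, 0 <= f x <= 1) -> E (fun a => f (omega i a)) = frequency_mean f.
Proof.
move=> mf f01.
have bX (u : R -> R) : bounded_rv u -> bounded_rv (fun a => u (omega i a)).
  move=> [mu [b ub]]; split; first exact: measurableT_comp.
  by exists b => a.
apply: (@bounded_functional_ext _ _ _ (fun u => E (fun a => u (omega i a)))) => //.
- split.
  + by move=> u v bu bv; rewrite meanD//; exact: bX.
  + by move=> k u bu; rewrite meanZ//; exact: bX.
  + by move=> u b bu ub; apply: mean_norm_le; [exact: bX|].
- exact: bounded_functional_frequency.
- move=> B mB; have := mean_indic Pr (measurable_preimage (momega i) mB) => /= ->.
  rewrite domega// /frequency_mean /Rintegral; congr fine.
  rewrite [LHS]integral_mkcond; congr (integral _ _ _); apply/funext => l.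
  by rewrite patchE indicE; case: ifP => _; rewrite ?mul1r ?mul0r.
Qed.

Section row.
Variables (n : nat) (xi : 'I_n -> R) (Y : 'I_n -> Omega -> R) (A B : set R).
Hypothesis xi01 : forall i, 0 <= xi i <= 1.
Hypothesis mY : forall i, measurable_fun setT (Y i).
Hypothesis sampled : conditionally_sampled Pr rho0 omega xi Y.
Hypotheses (mA : measurable A) (mB : measurable B).

Definition cell_event (i : 'I_n) : set Omega :=
  Y i @^-1` A `&` omega i @^-1` B.

Lemma measurable_cell_event i : measurable (cell_event i).
Proof. by apply: measurableI; exact: measurable_preimage. Qed.

Let w (x l : R) := \1_B l * q A l x.

Let mw x : 0 <= x <= 1 -> measurable_fun setT (w x).
Proof.
move=> x01; apply: measurable_funM; first exact: measurable_indic.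
exact: conditional_prob_measurable.
Qed.

Let w01 x l : 0 <= x <= 1 -> 0 <= w x l <= 1.
Proof.
move=> x01; have := conditional_prob_itv crho0 rho0_ge0 rho0_int1 l mA x01.
by rewrite /w indicE; case: (_ \in _); rewrite ?mul1r// mul0r lexx ler01.
Qed.

Lemma sampled_generated (J : {set 'I_n}) :
  generated_sigma_algebra omega
    (\bigcap_(i in [set i : 'I_n | i \in J]) (omega i @^-1` B)).
Proof.
rewrite /generated_sigma_algebra; set G := [set _ | _].
suff : measurable ((\bigcap_(i in [set i : 'I_n | i \in J]) (omega i @^-1` B))
  : set (g_sigma_algebraType G)) by [].
apply: fin_bigcap_measurable; first exact: finite_finset.
by move=> i _; apply: sub_sigma_algebra; exists i, B.
Qed.

(** Conditioning on the frequencies; the particles outside [J] enter the sampling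
    hypothesis with the trivial event. *)
Lemma mean_cell_events (J : {set 'I_n}) :
  E (fun a => \prod_(i in J) \1_(cell_event i) a) =
  E (fun a => \prod_(i in J) w (xi i) (omega i a)).
Proof.
set F := \bigcap_(i in [set i : 'I_n | i \in J]) (omega i @^-1` B).
pose A' i := if i \in J then A else setT.
have mA' i : measurable (A' i) by rewrite /A'; case: ifP.
set S := F `&` \bigcap_(i in [set: 'I_n]) (Y i @^-1` A' i).
have prS := sampled (sampled_generated J) mA'.
have mF : measurable F.
  apply: fin_bigcap_measurable; first exact: finite_finset.
  by move=> i _; exact: measurable_preimage.
have mS : measurable S.
  apply: measurableI => //; apply: fin_bigcap_measurable; first exact: finite_finset.
  by move=> i _; exact: measurable_preimage.
have indS a : \prod_(i in J) \1_(cell_event i) a = \1_S a :> R.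
  have [aS|naS] := pselect (S a).
    rewrite indicE mem_set// big1// => i iJ; rewrite indicE mem_set//; split.
      by have := aS.2 i I; rewrite /A' iJ.
    exact: aS.1 i iJ.
  rewrite [RHS]indicE memNset//.
  suff : exists2 i, i \in J & ~ cell_event i a.
    move=> [i iJ nai]; rewrite (bigD1 i)//= indicE memNset// mul0r//.
  apply: contrapT => /forall2NP h; apply: naS; split => i /= iJ.
    by have [] := h i => // /contrapT [].
  rewrite /A'; case: ifP => // iJ'.
  by have [] := h i => // /contrapT [].
have indF a : \prod_(i in J) \1_B (omega i a) = \1_F a :> R.
  have [aF|naF] := pselect (F a).
    by rewrite [RHS]indicE mem_set// big1// => i iJ; rewrite indicE mem_set//; exact: aF.
  rewrite [RHS]indicE memNset//.
  move/existsNP : naF => [i /not_implyP [iJ nai]].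
  by rewrite (bigD1 i)//= indicE memNset// mul0r.
under eq_fun do rewrite indS.
rewrite mean_indic// prS /mean /Rintegral; congr fine.
rewrite [LHS]integral_mkcond; apply: eq_integral => a _; rewrite patchE.
have -> : (\prod_(i < n) \int[lebesgue_measure]_(phi in A' i `&` circle)
    (rho0 (phi, omega i a, xi i))%:E = (\prod_(i in J) q A (omega i a) (xi i))%:E)%E.
  rewrite -prodEFin [RHS]big_mkcond; apply: eq_bigr => i _.
  rewrite -(conditional_probE crho0 rho0_ge0 rho0_int1)// /A'.
  by case: ifP => // _; rewrite conditional_probT.
rewrite big_split/= indF indicE.
by case: ifP => _; rewrite ?mul1r ?mul0r.
Qed.

Definition cell_prob (x : R) : R := frequency_mean (w x).

Lemma cell_prob_itv i : 0 <= cell_prob (xi i) <= 1.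
Proof.
have mwi := mw (xi01 i); have wi01 l := w01 l (xi01 i).
rewrite /cell_prob -(mean_omega i mwi wi01).
have bk := brv_comp (momega i) mwi wi01.
have f0 a : cst 0 a <= w (xi i) (omega i a) by case/andP: (wi01 (omega i a)).
have f1 a : w (xi i) (omega i a) <= cst 1 a by case/andP: (wi01 (omega i a)).
have := le_mean Pr (brv_cst 0) bk f0; have := le_mean Pr bk (brv_cst 1) f1.
by rewrite !mean_cst => -> ->.
Qed.

(** Given the frequencies, the probabilities of the cell events are functions of
    independent variables. *)
Lemma cell_events_independent (J : {set 'I_n}) :
  E (fun a => \prod_(i in J) \1_(cell_event i) a) = \prod_(i in J) cell_prob (xi i).
Proof.
rewrite mean_cell_events.
(* The frequencies are a sequence: the points are extended by 0 beyond [n]. *)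
pose xi' (k : nat) : R := oapp xi 0 (insub k).
have xi'E (i : 'I_n) : xi' i = xi i by rewrite /xi' valK.
have xi'01 k : 0 <= xi' k <= 1.
  by rewrite /xi'; case: insubP => //= _; rewrite lexx ler01.
pose s := [seq val i | i <- enum J].
have us : uniq s by rewrite map_inj_uniq ?enum_uniq//; exact: val_inj.
have -> : (fun a => \prod_(i in J) w (xi i) (omega i a)) =
    (fun a => \prod_(k <- s) w (xi' k) (omega k a)).
  apply/funext => a; rewrite /s big_map big_enum /=.
  by apply: eq_bigr => i _; rewrite xi'E.
rewrite (mean_prod_independent momega iomega (f := fun k => w (xi' k)))//.
- rewrite /s big_map big_enum /=; apply: eq_bigr => i _.
  rewrite xi'E /cell_prob -(mean_omega i)//.
  + exact: mw.
  + by move=> l; exact: w01.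
- by move=> k; exact: mw.
- by move=> k l; exact: w01.
Qed.

End row.
End sampled_events.

(** * Law of large numbers in a cell *)

Section initial_lln.
Context {R : realType} {d : measure_display} {Omega : measurableType d}.
Variables (T K : R) (W : R * R -> R) (rho : R -> R * R * R -> R).
Variables (Pr : probability Omega R) (g : R -> R) (rho0 : R * R * R -> R).
Hypothesis T0 : 0 < T.
Hypothesis rho_weak : weak_solution T K W (fun P => rho0 P * g P.1.2) rho.
Hypothesis cg : continuous g.
Hypothesis g0 : forall x, 0 <= g x.
Hypothesis g1 : (\int[lebesgue_measure]_x (g x)%:E = 1)%E.
Hypothesis crho0 : G_continuous rho0.
Hypothesis rho0_ge0 : forall P, Gset P -> 0 <= rho0 P.
Hypothesis rho0_int1 : forall om x : R, 0 <= x <= 1 ->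
  (\int[lebesgue_measure]_(phi in circle) (rho0 (phi, om, x))%:E = 1)%E.
Hypothesis rho0_unif : forall eps : R, 0 < eps -> exists2 delta : R, 0 < delta &
  forall x1 x2 : R, 0 <= x1 <= 1 -> 0 <= x2 <= 1 -> `|x1 - x2| < delta ->
  forall th om : R, circle th ->
    `|rho0 (th, om, x1) - rho0 (th, om, x2)| < eps.
Local Notation q := (conditional_prob rho0).
Local Notation fmean := (frequency_mean g).

Section cell.
Variables (A B : set R) (c : R -> R).
Hypotheses (mA : measurable A) (mB : measurable B).
Hypotheses (cc : continuous c) (c01 : forall x, 0 <= c x <= 1).

Let w (x l : R) := \1_B l * q A l x.

Let brv_w x : 0 <= x <= 1 -> bounded_rv (w x).
Proof.
move=> x01; split.
  apply: measurable_funM; first exact: measurable_indic.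
  exact: conditional_prob_measurable.
exists 1 => l; have := conditional_prob_itv crho0 rho0_ge0 rho0_int1 l mA x01.
by rewrite /w indicE; case: (_ \in _); rewrite ?mul1r ?mul0r ?normr0// ler_norml; lra.
Qed.

Lemma conditional_prob_close (e x y l : R) : 0 <= e -> 0 <= x <= 1 -> 0 <= y <= 1 ->
  (forall th, circle th -> `|rho0 (th, l, x) - rho0 (th, l, y)| <= e) ->
  q A l x <= q A l y + 2 * pi * e.
Proof.
move=> e0 x01 y01 close.
have mc := @measurable_circle R.
have mAc : measurable (A `&` circle) by exact: measurableI.
rewrite -lee_fin EFinD !conditional_probE//.
apply: (@le_trans _ _ (\int[lebesgue_measure]_(phi in A `&` circle)
  ((G_extension rho0 (phi, l, y))%:E + e%:E))%E).
  rewrite conditional_integralE//; apply: ge0_le_integral => //.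
  - by move=> phi _; rewrite lee_fin G_extension_ge0.
  - by apply/measurable_EFinP; apply: measurable_funTS; exact: measurable_density_theta.
  - apply: emeasurable_funD => //; apply/measurable_EFinP; apply: measurable_funTS.
    exact: measurable_density_theta.
  - move=> phi [_ cphi]; rewrite -EFinD lee_fin !G_extensionE//.
    by have := close _ cphi; rewrite ler_norml; lra.
rewrite ge0_integralD//; last 2 first.
- by move=> phi _; rewrite lee_fin G_extension_ge0.
- by apply/measurable_EFinP; apply: measurable_funTS; exact: measurable_density_theta.
rewrite -conditional_integralE// leeD2l// integral_cst//.
rewrite muleC EFinM lee_wpmul2r ?lee_fin//.
apply: (@le_trans _ _ (lebesgue_measure (@circle R))).
  by apply: le_measure; rewrite ?inE.
by rewrite lebesgue_measure_itv /= lte_fin twopi_gt0 sube0.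
Qed.

Lemma cell_prob_close (e x y : R) : 0 <= e -> 0 <= x <= 1 -> 0 <= y <= 1 ->
  (forall th l, circle th -> `|rho0 (th, l, x) - rho0 (th, l, y)| <= e) ->
  `|cell_prob g rho0 A B x - cell_prob g rho0 A B y| <= 2 * pi * e.
Proof.
move=> e0 x01 y01 close; have [mD mZ mN] := bounded_functional_frequency cg g0 g1.
have bx := brv_w x01; have by' := brv_w y01.
have -> : cell_prob g rho0 A B x - cell_prob g rho0 A B y =
    fmean (fun l => w x l + -1 * w y l).
  rewrite mD//; last by apply: brvM => //; exact: brv_cst.
  by rewrite mZ// mulN1r.
apply: mN; first by apply: brvD => //; apply: brvM => //; exact: brv_cst.
move=> l; rewrite mulN1r -mulrBr normrM.
have pe : 0 <= 2 * pi * e by rewrite mulr_ge0// ltW// twopi_gt0.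
have h1 := conditional_prob_close e0 x01 y01 (fun th => close th l).
have h2 : q A l y <= q A l x + 2 * pi * e.
  by apply: conditional_prob_close => // th cth; rewrite distrC; exact: close.
rewrite indicE; case: (_ \in _); last by rewrite normr0 mul0r.
by rewrite normr1 mul1r ler_norml; lra.
Qed.

Lemma cell_prob_continuous :
  continuous (fun x => cell_prob g rho0 A B (clamp01 x)).
Proof.
move=> x; apply/cvgrPdist_lt => e e0.
have p0 := @twopi_gt0 R.
have e'0 : 0 < e / (2 * pi) / 2 by rewrite !divr_gt0.
have [dl dl0 close] := rho0_unif e'0.
have : \forall y \near x, ball x dl y by exact: nbhsx_ballx.
apply: filterS => y; rewrite /ball/= => xy.
apply: (@le_lt_trans _ _ (2 * pi * (e / (2 * pi) / 2))); last first.
  by rewrite mulrA mulrCA divff ?gt_eqF// mulr1; lra.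
apply: cell_prob_close; rewrite ?clamp01_itv ?ltW//.
move=> th l cth; apply/ltW; apply: close => //; rewrite ?clamp01_itv//.
exact: le_lt_trans (clamp01_lip _ _) xy.
Qed.

Definition cell_fun (P : R * R * R) : R := \1_A P.1.1 * \1_B P.1.2 * c P.2.

Lemma cell_fun_bm : bounded_measurable cell_fun.
Proof.
split.
  apply: measurable_funM; last first.
    apply: (measurableT_comp (f := c)); first exact: continuous_measurable_fun.
    exact: measurable_snd.
  have mi (S : set R) : measurable S -> measurable_fun setT (\1_S : R -> R).
    by move=> mS; exact: measurable_indic.
  apply: measurable_funM.
    exact: (measurableT_comp (mi _ mA) (measurableT_comp measurable_fst measurable_fst)).
  exact: (measurableT_comp (mi _ mB) (measurableT_comp measurable_snd measurable_fst)).
exists 1 => P _; have /andP[c0 c1] := c01 P.2.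
rewrite /cell_fun !indicE; do 2 case: (_ \in _);
  by rewrite ?mul1r ?mul0r ?normr0// ger0_norm.
Qed.

Lemma cell_pairing : pairing (rho 0) cell_fun =
  \int[lebesgue_measure]_(x in `[0, 1]) (c x * cell_prob g rho0 A B (clamp01 x)).
Proof.
have rd0 : G_probability_density (rho 0).
  by have := rho_density T0 rho_weak 0; rewrite clampT_id ?lexx ?ltW.
have [mD mZ mN] := bounded_functional_frequency cg g0 g1.
rewrite -(pairing_fubini rd0 cell_fun_bm).
apply: eq_Rintegral => y; rewrite inE/= in_itv/= => y01.
rewrite clamp01_id//.
transitivity (fmean (fun l => c y * w y l)); last by rewrite mZ//; exact: brv_w.
apply: eq_Rintegral => l _.
have /andP[cy0 _] := c01 y.
have -> : c y * w y l * g l = (\1_B l * c y * g l) * q A l y by rewrite /w; ring.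
set k := \1_B l * c y * g l.
have k0 : 0 <= k by rewrite /k mulr_ge0// mulr_ge0// indicE ler0n.
transitivity (fine (k%:E * \int[lebesgue_measure]_(phi in A `&` circle)
    (rho0 (phi, l, y))%:E)%E); last first.
  by rewrite -(conditional_probE crho0 rho0_ge0 rho0_int1).
rewrite conditional_integralE// -ge0_integralZl//; last 3 first.
- by apply: measurableI => //; exact: measurable_circle.
- by apply/measurable_EFinP; apply: measurable_funTS; exact: measurable_density_theta.
- by move=> phi _; rewrite lee_fin G_extension_ge0.
rewrite /Rintegral integral_mkcond [X in _ = fine X]integral_mkcond; congr fine.
apply: eq_integral => phi _; rewrite !patchE.
have [cphi|ncphi] := boolP (phi \in circle); last first.
  rewrite ifN//; apply: contra ncphi; rewrite !inE; by case.
have cphi' : circle phi by move: cphi; rewrite inE.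
have Gphi : Gset (phi, l, y) by split => //=; rewrite in_itv.
have -> : rho 0 (phi, l, y) = rho0 (phi, l, y) * g l.
  by case: rho_weak => _ _ /(_ _ Gphi) -> _.
rewrite /cell_fun /= indicE; have [Aphi|nAphi] := boolP (phi \in A).
  rewrite ifT; last by rewrite inE; split; [move: Aphi; rewrite inE|].
  by rewrite -EFinM G_extensionE// /k; congr (_%:E); rewrite mul1r; ring.
rewrite ifN; last by apply: contra nAphi; rewrite !inE; case.
by rewrite !mul0r.
Qed.

Variable omega : nat -> Omega -> R.
Hypothesis momega : forall i, measurable_fun setT (omega i).
Hypothesis domega : forall i, has_density Pr (omega i) g.
Hypothesis iomega : mutually_independent Pr omega.
Variables (xi : forall n : nat, 'I_n -> R) (theta0 : forall n : nat, 'I_n -> Omega -> R).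
Hypothesis xi01 : forall n (i : 'I_n), 0 <= xi i <= 1.
Hypothesis xi_equi : forall f : R -> R, {within `[0, 1], continuous f} ->
  (fun n : nat => n%:R^-1 * \sum_(i < n) f (xi i)) @ \oo -->
    \int[lebesgue_measure]_(x in `[0, 1]) f x.
Hypothesis mtheta0 : forall n (i : 'I_n), measurable_fun setT (theta0 i).
Hypothesis sampled : forall n,
  conditionally_sampled Pr rho0 omega (@xi n) (@theta0 n).

(** The fluctuations around the mean are handled by independence, the means by
    the equidistribution of the points [xi]. *)
Lemma cell_lln : {ae Pr, forall a,
  (fun n => sample_mean (fun i : 'I_n => (theta0 i a, omega i a, xi i)) cell_fun)
    @ \oo --> pairing (rho 0) cell_fun}.
Proof.
pose Ev n (i : 'I_n) := cell_event omega (@theta0 n) A B i.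
have mEv n (i : 'I_n) : measurable (Ev n i) by exact: measurable_cell_event.
have p01 n (i : 'I_n) : 0 <= cell_prob g rho0 A B (xi i) <= 1.
  exact: (cell_prob_itv cg g0 g1 crho0 rho0_ge0 rho0_int1 momega domega (@xi01 n) mA mB).
have ind n (J : {set 'I_n}) := cell_events_independent cg g0 g1 crho0 rho0_ge0
  rho0_int1 momega domega iomega (@xi01 n) (@mtheta0 n) (@sampled n) mA mB J.
have := @strong_law_rows _ _ _ Pr Ev (fun n i => c (@xi n i))
  (fun n i => cell_prob g rho0 A B (@xi n i)) mEv (fun n i => c01 _) p01 ind.
apply: filterS => a lln.
have := xi_equi (f := fun x => c x * cell_prob g rho0 A B (clamp01 x)).
move=> /(_ _); rewrite -cell_pairing => equi.
have {}equi := equi (continuous_subspaceT (ctsM cc cell_prob_continuous)).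
have h := cvgD lln equi; rewrite add0r in h.
rewrite (_ : (fun n => sample_mean _ _) = (fun n => n%:R^-1 *
    deviation (Ev n) (fun i => c (@xi n i)) (fun i => cell_prob g rho0 A B (@xi n i)) a
  + n%:R^-1 * \sum_(i < n) c (xi i) * cell_prob g rho0 A B (clamp01 (xi i)))); last first.
  apply/funext => n; rewrite /deviation /sample_mean -mulrDr -big_split /=.
  congr (_ * _); apply: eq_bigr => i _; rewrite clamp01_id//.
  rewrite -mulrDr subrK /cell_fun /= mulrC; congr (_ * _).
  rewrite /Ev /cell_event !indicE -natrM mulnb; congr (nat_of_bool _)%:R.
  by rewrite in_setI; congr (_ && _); apply/idP/idP; rewrite !inE.
exact: h.
Qed.

End cell.
End initial_lln.

(** * Grid approximation of test functions *)

Section grid.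
Context {R : realType}.

Lemma indic_step (a h x : R) (j : nat) : 0 < h ->
  \1_(`[a + j%:R * h, a + j.+1%:R * h[%classic) x =
  (a + j%:R * h <= x)%R%:R - (a + j.+1%:R * h <= x)%R%:R :> R.
Proof.
move=> h0; rewrite indicE.
have hj : a + j%:R * h < a + j.+1%:R * h by rewrite ltrD2l ltr_pM2r// ltr_nat.
have [ax|ax] := leP (a + j%:R * h) x; have [bx|bx] := leP (a + j.+1%:R * h) x.
- by rewrite memNset ?subrr//= in_itv/= => /andP[_]; rewrite ltNge bx.
- by rewrite mem_set ?subr0//= in_itv/= ax.
- by have := lt_le_trans ax (le_trans (ltW hj) bx); rewrite ltxx.
- by rewrite memNset ?subr0//= in_itv/= leNgt ax.
Qed.

Lemma sum_indic_steps (a h x : R) (m : nat) : 0 < h ->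
  \sum_(j < m) \1_(`[a + j%:R * h, a + j.+1%:R * h[%classic) x =
  (a <= x)%R%:R - (a + m%:R * h <= x)%R%:R :> R.
Proof.
move=> h0; under eq_bigr do rewrite indic_step//.
elim: m => [|m IH]; first by rewrite big_ord0 mul0r addr0 subrr.
by rewrite big_ord_recr /= IH; ring.
Qed.

Lemma clamp01_mono (x y : R) : x <= y -> clamp01 x <= clamp01 y.
Proof.
move=> xy; rewrite /clamp01 ge_max le_max lexx /= le_max.
by apply/orP; right; rewrite le_min !ge_min xy lexx orbT.
Qed.

Lemma clamp01_ge1 (x : R) : 1 <= x -> clamp01 x = 1.
Proof. by move=> x1; rewrite /clamp01 (min_idPr x1); apply/max_idPr. Qed.

Lemma clamp01_le0 (x : R) : x <= 0 -> clamp01 x = 0.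
Proof. by move=> x0; rewrite /clamp01; apply/max_idPl; rewrite ge_min x0. Qed.

(** The piecewise linear function with peak [1] at [l / m], supported in
    [(l - 1) / m, (l + 1) / m], written as a telescoping difference. *)
Definition tent (m l : nat) (x : R) : R :=
  clamp01 (m%:R * x - l%:R + 1) - clamp01 (m%:R * x - l%:R).

Lemma tent_itv m l x : 0 <= tent m l x <= 1.
Proof.
have /andP[a0 a1] := clamp01_itv (m%:R * x - l%:R + 1).
have /andP[b0 b1] := clamp01_itv (m%:R * x - l%:R).
have : clamp01 (m%:R * x - l%:R) <= clamp01 (m%:R * x - l%:R + 1).
  by apply: clamp01_mono; rewrite lerDl.
by rewrite /tent; lra.
Qed.

Lemma tent_continuous m l : continuous (tent m l).
Proof.
have c1 : continuous (fun x : R => m%:R * x - l%:R).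
  apply: ctsB; last exact: cts_cst.
  by apply: ctsM; [exact: cts_cst|move=> x; exact: cvg_id].
apply: ctsB; first apply: (cts_comp clamp01_continuous).
  by apply: ctsD => //; exact: cts_cst.
exact: (cts_comp clamp01_continuous c1).
Qed.

Lemma sum_tent m x : 0 <= x <= 1 -> \sum_(l < m.+1) tent m l x = 1.
Proof.
move=> /andP[x0 x1].
have H k : \sum_(l < k) tent m l x = clamp01 (m%:R * x + 1) - clamp01 (m%:R * x - k%:R + 1).
  elim: k => [|k IH]; first by rewrite big_ord0 subr0 subrr.
  rewrite big_ord_recr /= IH /tent -natr1.
  by rewrite (_ : m%:R * x - (k%:R + 1) + 1 = m%:R * x - k%:R); ring.
have mx : m%:R * x <= m%:R by rewrite ler_piMr.
have mx0 : 0 <= m%:R * x by rewrite mulr_ge0.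
rewrite H clamp01_ge1; last by rewrite lerDr.
rewrite clamp01_le0 ?subr0// -natr1; lra.
Qed.

Lemma tent_support m l x : (0 < m)%N -> tent m l x != 0 ->
  `|x - l%:R / m%:R| <= m%:R^-1.
Proof.
move=> m0 tx; have m0' : (0 : R) < m%:R by rewrite ltr0n.
have -> : x - l%:R / m%:R = m%:R^-1 * (m%:R * x - l%:R).
  by rewrite mulrBr mulrA mulVf ?mul1r ?gt_eqF// mulrC.
rewrite normrM gtr0_norm ?invr_gt0// ler_piMr ?invr_ge0 ?(ltW m0')//.
rewrite ler_norml; apply/andP; split; rewrite leNgt; apply: contra tx => h; apply/eqP.
  by rewrite /tent !clamp01_le0 ?subrr//; lra.
by rewrite /tent !clamp01_ge1 ?subrr//; lra.
Qed.

Lemma indic_step_support (a h x : R) (j : nat) : 0 < h ->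
  (\1_(`[a + j%:R * h, a + j.+1%:R * h[%classic) x : R) != 0 ->
  `|x - (a + j%:R * h)| <= h.
Proof.
move=> h0; rewrite indicE; case: (boolP (x \in _)) => [|_]; last by rewrite eqxx.
rewrite inE/= in_itv/= -natr1 mulrDl mul1r => /andP[? ?] _.
by rewrite ler_norml; lra.
Qed.

End grid.

Section grid_approximation.
Context {R : realType}.
Variables (M : R) (m : nat).
Hypotheses (M0 : 0 < M) (m0 : (0 < m)%N).

(** The leading [0 +] gives [theta_cell] and [omega_cell] the common form of
    [sum_indic_steps]. *)
Definition theta_cell (j : nat) : set R :=
  `[0 + j%:R * (2 * pi / m%:R), 0 + j.+1%:R * (2 * pi / m%:R)[%classic.
Definition omega_cell (k : nat) : set R :=
  `[- M + k%:R * (2 * M / m%:R), - M + k.+1%:R * (2 * M / m%:R)[%classic.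

(** Indicators are replaced by tents in [x], because the points [xi] are
    equidistributed with respect to continuous functions. *)
Definition grid_cell (s : 'I_m * 'I_m * 'I_m.+1) : R * R * R -> R :=
  cell_fun (theta_cell s.1.1) (omega_cell s.1.2) (tent m s.2).

Definition grid_point (s : 'I_m * 'I_m * 'I_m.+1) : R * R * R :=
  (0 + s.1.1%:R * (2 * pi / m%:R), - M + s.1.2%:R * (2 * M / m%:R), s.2%:R / m%:R).

Definition grid_fun (f : R * R * R -> R) (P : R * R * R) : R :=
  \sum_s f (grid_point s) * grid_cell s P.

Definition grid_error : R := (2 * pi + 2 * M + 1) / m%:R.

Let mR : (0 : R) < m%:R. Proof. by rewrite ltr0n. Qed.

Let dpi0 : 0 < 2 * pi / m%:R :> R.
Proof. by rewrite divr_gt0// twopi_gt0. Qed.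

Let dM0 : 0 < 2 * M / m%:R.
Proof. by rewrite divr_gt0// mulr_gt0. Qed.

Lemma grid_cell_bm s : bounded_measurable (grid_cell s).
Proof.
apply: cell_fun_bm; [exact: measurable_itv|exact: measurable_itv| |].
- exact: tent_continuous.
- exact: tent_itv.
Qed.

Lemma grid_cell_ge0 s P : 0 <= grid_cell s P.
Proof.
rewrite /grid_cell /cell_fun !indicE mulr_ge0// ?mulr_ge0// ?ler0n//.
by case/andP: (tent_itv m s.2 P.2).
Qed.

(** The cells form a partition of unity on [- M <= omega < M]. *)
Lemma sum_grid_cell P : Gset P ->
  \sum_s grid_cell s P = (- M <= P.1.2)%R%:R - (M <= P.1.2)%R%:R.
Proof.
case: P => -[a b] x [/=]; rewrite /circle /= !in_itv/= => /andP[a0 a2] x01.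
have -> : \sum_s grid_cell s (a, b, x) =
   \sum_(j < m) \sum_(k < m) \sum_(l < m.+1)
     \1_(theta_cell j) a * \1_(omega_cell k) b * tent m l x.
  rewrite pair_bigA /= pair_bigA /=; apply: eq_bigr => -[[j k] l] _.
  by [].
under eq_bigr do under eq_bigr do rewrite -mulr_sumr sum_tent// mulr1.
under eq_bigr do rewrite -mulr_sumr.
rewrite -mulr_suml /theta_cell sum_indic_steps// /omega_cell sum_indic_steps//.
have -> : 0 + m%:R * (2 * pi / m%:R) = 2 * pi :> R.
  by rewrite add0r mulrC divfK// gt_eqF.
have -> : - M + m%:R * (2 * M / m%:R) = M.
  by rewrite [m%:R * _]mulrC divfK ?gt_eqF//; ring.
by rewrite a0 leNgt a2 subr0 mul1r.
Qed.

Lemma grid_approx f P : BL_cutoff M f -> Gset P ->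
  `|f P - grid_fun f P| <= grid_error.
Proof.
move=> [f1 fl fp fv] GP; have sumE := sum_grid_cell GP.
have err0 : 0 <= grid_error.
  by rewrite /grid_error divr_ge0 ?(ltW mR)// addr_ge0// addr_ge0 ?ltW ?twopi_gt0 ?mulr_gt0.
have cell_ne s : grid_cell s P != 0 ->
    [/\ (\1_(theta_cell s.1.1) P.1.1 : R) != 0, (\1_(omega_cell s.1.2) P.1.2 : R) != 0 &
        tent m s.2 P.2 != 0].
  by rewrite /grid_cell /cell_fun !mulf_eq0 !negb_or => /andP[/andP[-> ->] ->].
have [oM|oM] := boolP ((- M <= P.1.2) && (P.1.2 < M)).
  have sum1 : \sum_s grid_cell s P = 1.
    by rewrite sumE; case/andP: oM => -> oM; rewrite leNgt oM subr0.
  have -> : f P - grid_fun f P = \sum_s (f P - f (grid_point s)) * grid_cell s P.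
    rewrite -[X in X - _]mulr1 -sum1 mulr_sumr /grid_fun -sumrB.
    by apply: eq_bigr => s _; rewrite mulrBl.
  apply: le_trans (ler_norm_sum _ _ _) _.
  rewrite -[X in _ <= X]mulr1 -sum1 mulr_sumr; apply: ler_sum => s _.
  rewrite normrM (ger0_norm (grid_cell_ge0 s P)).
  have [->|/cell_ne [h1 h2 h3]] := eqVneq (grid_cell s P) 0; first by rewrite !mulr0.
  rewrite ler_wpM2r ?grid_cell_ge0//; apply: le_trans (fl _ _) _.
  have k1 := indic_step_support dpi0 h1; have k2 := indic_step_support dM0 h2.
  have k3 := tent_support m0 h3.
  have -> : grid_error = 2 * pi / m%:R + 2 * M / m%:R + m%:R^-1.
    by rewrite /grid_error [LHS]mulrDl mul1r; congr (_ + _); rewrite [LHS]mulrDl.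
  exact: (lerD (lerD k1 k2) k3).
have sum0 : \sum_s grid_cell s P = 0.
  rewrite sumE; move: oM; rewrite negb_and -ltNge -leNgt => /orP[oM|oM].
    have oM' : P.1.2 < M by apply: lt_trans oM _; rewrite gtrN.
    by rewrite leNgt oM /= leNgt oM' subrr.
  have oM' : - M <= P.1.2 by apply: le_trans oM; rewrite ge0_cp ?ltW.
  by rewrite oM oM' subrr.
have cell0 s : grid_cell s P = 0.
  have := psumr_eq0P (fun s _ => grid_cell_ge0 s P) sum0.
  by apply.
have fP0 : f P = 0.
  apply: fv; move: oM; rewrite negb_and -ltNge -leNgt => /orP[oM|oM].
    by rewrite ler_normr lerNr (ltW oM) orbT.
  by rewrite (le_trans oM)// ler_norm.
by rewrite fP0 /grid_fun big1 ?subrr ?normr0// => s _; rewrite cell0 mulr0.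
Qed.

Lemma averaging_sum (av : (R * R * R -> R) -> R) (I : Type) (r : seq I)
    (F : I -> R * R * R -> R) : averaging av -> (forall i, bounded_measurable (F i)) ->
  bounded_measurable (fun P => \sum_(i <- r) F i P) /\
  av (fun P => \sum_(i <- r) F i P) = \sum_(i <- r) av (F i).
Proof.
move=> aav bF; have [aB aZ _ _] := aav; elim: r => [|i r [bIH IH]].
  under eq_fun do rewrite big_nil; rewrite big_nil; split.
    exact: bounded_measurable_cst.
  exact: averaging_cst aav 0.
under eq_fun do rewrite big_cons; rewrite big_cons; split.
  exact: bounded_measurableD.
rewrite -IH (_ : (fun P => F i P + _) =
    (fun P => F i P - (-1 * \sum_(i <- r) F i P))); last first.
  by apply/funext => P; rewrite mulN1r opprK.
by rewrite aB ?aZ ?mulN1r ?opprK//; exact: bounded_measurableZ.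
Qed.

(** Finitely many cell averages control the distance, up to the mesh size. *)
Lemma grid_close av1 av2 : averaging av1 -> averaging av2 ->
  BL_close M (2 * grid_error + \sum_s `|av1 (grid_cell s) - av2 (grid_cell s)|) av1 av2.
Proof.
move=> a1 a2 f Bf; have [f1 fl fp fv] := Bf.
have bcell s : bounded_measurable (fun P => f (grid_point s) * grid_cell s P).
  by apply: bounded_measurableZ; exact: grid_cell_bm.
have bf := BL_cutoff_bounded_measurable Bf.
have approx av : averaging av ->
    `|av f - \sum_s f (grid_point s) * av (grid_cell s)| <= grid_error.
  move=> aav; have [aB aZ _ _] := aav.
  have [bg Eg] := averaging_sum (index_enum _) aav bcell.
  have -> : \sum_s f (grid_point s) * av (grid_cell s) = av (grid_fun f).
    rewrite /grid_fun Eg; apply: eq_bigr => s _.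
    by rewrite aZ//; exact: grid_cell_bm.
  rewrite -aB//; apply: (averaging_bound aav); first exact: bounded_measurableB.
  by move=> P GP; exact: grid_approx.
have h1 := approx _ a1; have h2 := approx _ a2.
have h3 : `|\sum_s f (grid_point s) * av1 (grid_cell s) -
    \sum_s f (grid_point s) * av2 (grid_cell s)| <=
    \sum_s `|av1 (grid_cell s) - av2 (grid_cell s)|.
  rewrite -sumrB; apply: le_trans (ler_norm_sum _ _ _) _.
  by apply: ler_sum => s _; rewrite -mulrBr normrM ler_piMl.
move: h1 h2 h3; rewrite !ler_norml => /andP[? ?] /andP[? ?] /andP[? ?].
by apply/andP; split; lra.
Qed.

End grid_approximation.

(** * Bounded Lipschitz distance between measures and averages *)

Lemma density_semi_sigma_additive d (T : measurableType d) (R : realType)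
    (mu : {measure set T -> \bar R}) (G : set T) (r : T -> R) :
  measurable G -> measurable_fun G r -> (forall P, G P -> 0 <= r P) ->
  semi_sigma_additive (fun A => \int[mu]_(P in A `&` G) (r P)%:E)%E.
Proof.
move=> mG mr r0; rewrite (_ : (fun A => _) =
    (fun A => \int[mu]_(P in A) ((EFin \o r) \_ G) P)%E).
  apply: semi_sigma_additive_nng_induced.
    by apply/(measurable_restrictT _ mG); exact/measurable_EFinP.
  by move=> P; rewrite patchE; case: ifPn => // /[!inE] GP; rewrite lee_fin r0.
by apply/funext => A; rewrite integral_mkcondr.
Qed.

Section density_measure_facts.
Context {R : realType}.
Variable r : R * R * R -> R.
Hypothesis r_density : G_probability_density r.

Let mr := let: And3 mr _ _ := r_density in mr.
Let r0 := let: And3 _ r0 _ := r_density in r0.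
Let r1 := let: And3 _ _ r1 := r_density in r1.

Let density_measure0 : density_measure r set0 = 0%E.
Proof. by rewrite /density_measure set0I integral_set0. Qed.

Let density_measure_ge0 A : (0 <= density_measure r A)%E.
Proof. by apply: integral_ge0 => P [_ GP]; rewrite lee_fin r0. Qed.

Let density_measure_sigma_additive : semi_sigma_additive (density_measure r).
Proof.
exact: (@density_semi_sigma_additive _ _ R (@lebesgue3 R) Gset r measurable_Gset mr r0).
Qed.

HB.instance Definition _ := isMeasure.Build _ _ _ (density_measure r)
  density_measure0 density_measure_ge0 density_measure_sigma_additive.

(** Both sides are bounded functionals of [f] which agree on indicators. *)
Lemma integral_density_measure (f : R * R * R -> R) : measurable_fun setT f ->
  (forall P, 0 <= f P <= 1) ->
  (\int[density_measure r]_(P in Gset) (f P)%:E = (pairing r f)%:E)%E.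
Proof.
move=> mf f01; pose nu : {measure set (R * R * R) -> \bar R} := density_measure r.
have mG := @measurable_Gset R.
have nu1 : (\int[nu]_(P in Gset) (cst 1 P)%:E = 1)%E.
  rewrite [LHS](integral_cst nu mG 1%E) mul1e.
  by rewrite /nu /= /density_measure setIid r1.
have m1 : measurable_fun Gset (cst 1 : R * R * R -> R) by exact: measurable_cst.
have c0 P : Gset P -> 0 <= (cst 1 : R * R * R -> R) P by rewrite /=.
have bf : bounded_measurable_on Gset f.
  by split => //; exists 1 => P _; have := f01 P; rewrite ler_norml; lra.
have bnu := bounded_functional_weighted mG m1 c0 nu1.
have inu := @wint_integrable _ _ _ nu Gset mG _ m1 c0 nu1 _ bf.
transitivity (weighted_integral nu Gset (cst 1) f)%:E.
  rewrite /weighted_integral /Rintegral fineK ?integrable_fin_num//.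
  by apply: eq_integral => P _; rewrite mulr1.
congr EFin; apply: (bounded_functional_ext bnu) => //.
  have bm u : bounded_rv u -> bounded_measurable u.
    by move=> [mu_ [b ub]]; split => //; exists b => P _.
  split.
  - by move=> u v /bm bu /bm bv; exact: pairingD.
  - by move=> k u /bm bu; exact: pairingZ.
  - by move=> u b /bm bu ub; apply: pairing_norm_le.
move=> B mB; rewrite /weighted_integral /pairing /Rintegral; congr fine.
transitivity (nu (B `&` Gset)).
  by rewrite -integral_indic//; apply: eq_integral => P _; rewrite mulr1.
rewrite /nu /= /density_measure -setIA setIid setIC integral_mkcondr.
apply: eq_integral => P _; rewrite patchE indicE.
by case: ifP => _; rewrite ?mul1r ?mul0r.
Qed.

End density_measure_facts.

Section empirical.
Context {R : realType}.

Lemma integral_empirical n (p : 'I_n -> R * R * R) (f : R * R * R -> R) :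
  (0 < n)%N -> (forall i, Gset (p i)) -> measurable_fun setT f ->
  (forall P, 0 <= f P <= 1) ->
  (\int[empirical_measure p]_(P in Gset) (f P)%:E = (sample_mean p f)%:E)%E.
Proof.
case: n p => // n p _ pG mf f01.
have k0 : 0 <= n.+1%:R^-1 :> R by [].
pose m : nat -> {measure set (R * R * R) -> \bar R} := fun i => \d_(p (inord i)).
pose nu : {measure set (R * R * R) -> \bar R} := mscale (NngNum k0) (msum m n.+1).
have -> : empirical_measure p = nu.
  apply/funext => A; rewrite /empirical_measure /nu /= /mscale /msum /=; congr (_ * _)%E.
  by apply: eq_bigr => i _; rewrite /m inord_val.
have mf' : measurable_fun Gset (EFin \o f).
  by apply/measurable_EFinP; exact: measurable_funTS.
have f0' P : Gset P -> (0 <= (f P)%:E)%E by rewrite lee_fin; case/andP: (f01 P).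
rewrite (@ge0_integral_mscale _ _ _ _ _ measurable_Gset)// ge0_integral_measure_sum//; last first.
  exact: measurable_Gset.
rewrite /sample_mean EFinM -sumEFin; congr (_ * _)%E; apply: eq_bigr => i _.
rewrite /m inord_val integral_dirac//; last exact: measurable_Gset.
by rewrite diracE mem_set// mul1e.
Qed.

End empirical.

Section BL_extension.
Context {R : realType}.
Implicit Types (f : R * R * R -> R) (P Q : R * R * R).

Lemma G_repr_Gset P : 0 <= P.2 <= 1 -> Gset (G_repr P).
Proof. by move=> P2; split; [exact: circle_repr_circle|rewrite /= in_itv]. Qed.

(** If [a] and [b] are reduced by different multiples of [2 pi], then [|a - b|] is
    at least the length of the complementary arc. *)
Lemma dS_repr_le (a b : R) :
  0 <= dS (circle_repr a) (circle_repr b) <= `|a - b|.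
Proof.
have p0 := @twopi_gt0 R.
have := circle_repr_circle a; have := circle_repr_circle b.
rewrite /circle /= !in_itv/= => /andP[b0 b2] /andP[a0 a2].
have uv : `|circle_repr a - circle_repr b| < 2 * pi by rewrite ltr_norml; lra.
rewrite /dS le_min normr_ge0 subr_ge0 (ltW uv) /= ge_min.
set k := Num.floor (a / (2 * pi)); set l := Num.floor (b / (2 * pi)).
have E : a - b = circle_repr a - circle_repr b + 2 * pi * (k - l)%:~R.
  by rewrite /circle_repr -/k -/l intrB; ring.
have [kl|kl] := eqVneq k l.
  by rewrite E kl subrr mulr0z mulr0 addr0 lexx.
apply/orP; right.
have h1 : 2 * pi <= `|2 * pi * (k - l)%:~R| :> R.
  rewrite normrM (gtr0_norm p0) ler_peMr ?(ltW p0)// -intr_norm.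
  rewrite -[1]/(1%:~R) ler_int -gtz0_ge1 normr_gt0 subr_eq0//.
have := ler_normB (a - b) (circle_repr a - circle_repr b).
rewrite [X in `|X|](_ : _ = 2 * pi * (k - l)%:~R); last by rewrite E; ring.
by lra.
Qed.

Lemma dG_repr_le P Q : dG (G_repr P) (G_repr Q) <= dist1 P Q.
Proof.
rewrite /dG /dist1 /G_repr /=; have /andP[s0 s1] := dS_repr_le P.1.1 Q.1.1.
set s := dS _ _ in s0 s1 *.
have u0 := normr_ge0 (P.1.2 - Q.1.2); have v0 := normr_ge0 (P.2 - Q.2).
apply: (@le_trans _ _ (s + `|P.1.2 - Q.1.2| + `|P.2 - Q.2|)); last by lra.
rewrite -(ger0_norm (addr_ge0 (addr_ge0 s0 u0) v0)) -sqrtr_sqr.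
apply: ler_wsqrtr; rewrite -(real_normK (num_real (P.1.2 - Q.1.2))).
rewrite -(real_normK (num_real (P.2 - Q.2))); nra.
Qed.

Section extension.
Variable f : R * R * R -> R.
Hypothesis BLf : BL_class f.

Lemma BL_extension_itv P : 0 <= G_extension f P <= 1.
Proof. by case: BLf => f01 _; apply/f01/G_repr_Gset/clamp01_itv. Qed.

Lemma BL_extension_lip P Q :
  `|G_extension f P - G_extension f Q| <= dist1 P Q.
Proof.
case: BLf => _ fl; apply: le_trans (fl _ _ _ _) _;
  [exact/G_repr_Gset/clamp01_itv|exact/G_repr_Gset/clamp01_itv|].
apply: le_trans (dG_repr_le _ _) _.
by rewrite /dist1 /= lerD2l clamp01_lip.
Qed.

Lemma BL_extension_periodic : theta_periodic (G_extension f).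
Proof.
move=> a b c; rewrite /G_extension /G_repr /circle_repr /=.
have p0 := @twopi_gt0 R.
have -> : (a + 2 * pi) / (2 * pi) = a / (2 * pi) + 1.
  by rewrite [LHS]mulrDl divff// gt_eqF.
rewrite floorDrz ?int_num1// floor1 intrD.
by congr (f (_, _, _)); ring.
Qed.

Lemma BL_extension_Gset P : Gset P -> G_extension f P = f P.
Proof.
by case: P => -[a b] c [/= ca]; rewrite in_itv/= => c01; rewrite G_extensionE.
Qed.

Lemma BL_extension_measurable : measurable_fun setT (G_extension f).
Proof.
apply: continuous_measurable3; apply: (@lipschitz_continuous3 _ _ 1) => P Q.
by rewrite mul1r BL_extension_lip.
Qed.

End extension.

Lemma BL_class0 : BL_class (cst 0 : R * R * R -> R).
Proof.
by split => *; rewrite /cst ?lexx ?ler01// subrr normr0 /dG sqrtr_ge0.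
Qed.

Lemma dBL_le n (p : 'I_n -> R * R * R) (r : R * R * R -> R) (b : R) :
  (0 < n)%N -> (forall i, Gset (p i)) -> G_probability_density r ->
  (forall f, BL_class f ->
    `|sample_mean p (G_extension f) - pairing r (G_extension f)| <= b) ->
  (0 <= dBL (empirical_measure p) (density_measure r) <= b%:E)%E.
Proof.
move=> n0 pG r_density close.
have ext (m : set (R * R * R) -> \bar R) f : BL_class f ->
    (\int[m]_(P in Gset) (f P)%:E = \int[m]_(P in Gset) (G_extension f P)%:E)%E.
  move=> _; rewrite /integral.
  have /eq_restrictP -> // : {in Gset, (fun P => (f P)%:E) =1 (fun P => (G_extension f P)%:E)}.
  by move=> P /[!inE] GP; rewrite BL_extension_Gset.
have E f : BL_class f ->
  (`| \int[empirical_measure p]_(P in Gset) (f P)%:E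
      - \int[density_measure r]_(P in Gset) (f P)%:E | =
  (`|sample_mean p (G_extension f) - pairing r (G_extension f)|)%:E)%E.
  move=> BLf; rewrite (ext (empirical_measure p) f BLf) (ext (density_measure r) f BLf).
  have mf := BL_extension_measurable BLf; have f01 := BL_extension_itv BLf.
  rewrite integral_empirical//.
  suff -> : (\int[density_measure r]_(P in Gset) (G_extension f P)%:E =
    (pairing r (G_extension f))%:E)%E by [].
  exact: integral_density_measure.
apply/andP; split.
  apply: le_ereal_sup_tmp; exists (`|sample_mean p (G_extension (cst 0)) -
    pairing r (G_extension (cst 0))|)%:E; last by rewrite lee_fin.
  by exists (cst 0); [exact: BL_class0|exact: (E _ BL_class0)].
by apply: ge_ereal_sup => _ [f BLf <-]; rewrite E// lee_fin; exact: close.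
Qed.

End BL_extension.

(** * Convergence *)

Section tails.
Context {R : realType}.

(** Dominated convergence: the cutoffs increase to 1. *)
Lemma tail_cvg0 (r : R * R * R -> R) : G_probability_density r ->
  (fun k => tail (pairing r) k%:R) @ \oo --> (0 : R).
Proof.
move=> rd; have [mr r0 r1] := rd.
have mG := @measurable_Gset R.
have := @dominated_convergence _ _ R (@lebesgue3 R) Gset mG
  (fun k P => (cutoff k%:R P * r P)%:E) (EFin \o r) (EFin \o r).
case.
- move=> k; apply/measurable_EFinP; apply: measurable_funM => //.
  by apply: measurable_funTS; case: (cutoff_bm (k%:R : R)).
- exact/measurable_EFinP.
- apply: aeW => P GP; apply: (cvg_near_cst (EFin (r P))).
  near=> k; congr EFin; rewrite /cutoff clamp01_ge1 ?mul1r//.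
  rewrite lerBrDr; near: k; exact: nbhs_infty_ger.
- exact: density_integrable.
- apply: aeW => P k GP; rewrite /= lee_fin normrM (ger0_norm (r0 _ GP)).
  have /andP[c0 c1] := cutoff_itv (k%:R : R) P.
  by rewrite (ger0_norm c0) ler_piMl ?r0.
move=> _ _; rewrite /= r1 => /fine_cvg h.
rewrite -[X in _ --> X](subrr 1); apply: cvgB; first exact: cvg_cst.
exact: h.
Unshelve. all: by end_near.
Qed.

End tails.

Section stability_constant.
Context {R : realType}.
Variables (T K B L : R) (rho : R -> R * R * R -> R).
Hypotheses (T0 : 0 < T) (B0 : 0 < B) (L0 : 0 <= L).
Local Notation eta M := (tail (pairing (rho (clampT T 0))) M).

(** The Gronwall bound is linear in the three small parameters. *)
Lemma stability_constant : exists2 C : R, 0 < C &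
  forall M D N, 0 <= M -> 0 <= eta M -> 0 <= D -> (0 < N)%N ->
  2 * ((D + T * drift T K rho B L M D (T / N%:R)) * expR (T * growth K B L)) +
    (eta M *+ 2 + D) <= C * (eta M + D + (M + `|K| * B) / N%:R).
Proof.
pose c := expR (T * growth K B L); pose k := `|K|.
have c0 : 0 <= c by exact: expR_ge0.
have k0 : 0 <= k by exact: normr_ge0.
have cT : 0 <= 2 * c * T by rewrite !mulr_ge0// ltW.
have kB : 0 <= k * B by rewrite mulr_ge0// ltW.
have kL : 0 <= k * L by rewrite mulr_ge0.
pose C1 := 2 * c * T * (6 * (k * B)) + 2.
pose C2 := 2 * c + 2 * c * T * (3 * (k * B)) + 1.
pose C3 := 2 * c * T * (4 * (k * B) + k * L) * T.
have C10 : 0 <= C1 by rewrite addr_ge0// mulr_ge0// mulr_ge0.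
have C20 : 0 <= C2 by apply: addr_ge0 => //; apply: addr_ge0; rewrite mulr_ge0// mulr_ge0.
have C30 : 0 <= C3 by rewrite mulr_ge0 ?(ltW T0)// mulr_ge0// addr_ge0// mulr_ge0.
exists (C1 + C2 + C3 + 1); first by rewrite ltr_wpDl// addr_ge0// addr_ge0.
move=> M D N M0 eta0 D0 N0; rewrite /drift -/c -/k.
have V0 : 0 <= (M + k * B) / N%:R by rewrite divr_ge0 ?addr_ge0.
rewrite [X in X <= _](_ : _ = C1 * eta M + C2 * D + C3 * ((M + k * B) / N%:R)).
  move: (eta M) eta0 => e e0; set v := _ / _ in V0 *.
  have e1 : C1 * e <= (C1 + C2 + C3 + 1) * e by apply: ler_wpM2r => //; lra.
  have e2 : C2 * D <= (C1 + C2 + C3 + 1) * D by apply: ler_wpM2r => //; lra.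
  have e3 : C3 * v <= (C1 + C2 + C3 + 1) * v by apply: ler_wpM2r => //; lra.
  by rewrite !mulrDr; lra.
by rewrite /C1 /C2 /C3; ring.
Qed.

End stability_constant.

Section kernel_constants.
Context {R : realType}.

Lemma lipschitz_square_bounds (W : R * R -> R) :
  [lipschitz W z | z in `[0, 1] `*` `[0, 1]] ->
  exists B L : R, [/\ 0 < B, 0 <= L,
    forall x y, 0 <= x <= 1 -> 0 <= y <= 1 -> `|W (x, y)| <= B &
    forall x y x' y', 0 <= x <= 1 -> 0 <= y <= 1 ->
      0 <= x' <= 1 -> 0 <= y' <= 1 ->
      `|W (x, y) - W (x', y')| <= L * (`|x - x'| + `|y - y'|)].
Proof.
move=> [L0 [_ lipL]]; pose L := `|L0| + 1.
have L00 : 0 <= L by rewrite addr_ge0.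
have lip x y x' y' : 0 <= x <= 1 -> 0 <= y <= 1 -> 0 <= x' <= 1 -> 0 <= y' <= 1 ->
    `|W (x, y) - W (x', y')| <= L * (`|x - x'| + `|y - y'|).
  move=> x01 y01 x01' y01'.
  have LL : L0 < L by rewrite /L (le_lt_trans (ler_norm _))// ltrDl.
  have /(_ ((x, y), (x', y'))) := lipL _ LL.
  move=> /(_ _) h; apply: (le_trans (h _)) => {h}.
    by do 2 split => /=; rewrite in_itv.
  rewrite ler_wpM2l// [`|_|]/Num.norm /= ge_max.
  by rewrite lerDl lerDr !normr_ge0.
exists (`|W (0, 0)| + L * 2 + 1), L; split => //.
- by rewrite ltr_wpDl// addr_ge0// mulr_ge0.
- move=> x y /[dup] x01 /andP[x0 x1] /[dup] y01 /andP[y0 y1].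
  have z01 : (0 : R) <= (0 : R) <= 1 by rewrite lexx ler01.
  have := lip _ _ _ _ x01 y01 z01 z01; rewrite !subr0 (ger0_norm x0) (ger0_norm y0) => h.
  have := ler_normD (W (x, y) - W (0, 0)) (W (0, 0)); rewrite subrK.
  have : L * (x + y) <= L * 2 by rewrite ler_wpM2l//; lra.
  by move: h; lra.
Qed.

End kernel_constants.

Section initial_closeness.
Context {R : realType}.

Lemma grid_error_small (M e : R) : 0 < M -> 0 < e ->
  exists m : nat, 2 * grid_error M m.+1 <= e.
Proof.
move=> M0 e0; pose c : R := 2 * (2 * pi + 2 * M + 1).
have c0 : 0 < c.
  by rewrite mulr_gt0// addr_gt0// addr_gt0 ?twopi_gt0// mulr_gt0.
have /cvgrPdist_le /(_ (e / c) (divr_gt0 e0 c0)) [m _ /(_ m (leqnn m))] := @cvg_harmonic R.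
rewrite /= sub0r normrN ger0_norm ?invr_ge0// => me; exists m.
rewrite /grid_error mulrA -/c -(@ler_pdivlMl _ c)//.
by rewrite [X in _ <= X]mulrC.
Qed.

(** Finitely many convergent cell averages, chosen for a fine enough mesh,
    make the bounded Lipschitz distance eventually small. *)
Lemma eventually_BL_close (M e : R) (av : nat -> (R * R * R -> R) -> R)
    (av_lim : (R * R * R -> R) -> R) : 0 < M -> 0 < e ->
  (forall n, (0 < n)%N -> averaging (av n)) -> averaging av_lim ->
  (forall m j k l, (fun n => av n (cell_fun (theta_cell m.+1 j)
      (omega_cell M m.+1 k) (tent m.+1 l))) @ \oo -->
    av_lim (cell_fun (theta_cell m.+1 j) (omega_cell M m.+1 k) (tent m.+1 l))) ->
  \forall n \near \oo, BL_close M e (av n) av_lim.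
Proof.
move=> M0 e0 a1 a2 lim; have e20 : 0 < e / 2 by rewrite divr_gt0.
have [m me] := grid_error_small M0 e20.
pose S := ('I_m.+1 * 'I_m.+1 * 'I_m.+2)%type.
have d0 : 0 < e / 2 / #|{: S}|.+1%:R by rewrite divr_gt0.
have near_cell (s : S) : \forall n \near \oo,
    `|av_lim (grid_cell M s) - av n (grid_cell M s)| < e / 2 / #|{: S}|.+1%:R.
  by have /cvgrPdist_lt /(_ _ d0) := lim m s.1.1 s.1.2 s.2.
near=> n; have n0 : (0 < n)%N by near: n; exact: nbhs_infty_gt.
have cells (s : S) : `|av_lim (grid_cell M s) - av n (grid_cell M s)| <
    e / 2 / #|{: S}|.+1%:R.
  by move: s; near: n; exact: filter_forall.
have := grid_close M0 (ltn0Sn m) (a1 _ n0) a2.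
move=> close f Bf; apply: le_trans (close f Bf) _.
rewrite [X in _ <= X](splitr e); apply: lerD => //.
apply: (@le_trans _ _ (\sum_(s : S) (e / 2 / #|{: S}|.+1%:R))).
  by apply: ler_sum => s _; rewrite distrC ltW.
rewrite sumr_const -[X in X <= _](mulr_natr (e / 2 / _)) -(mulrA (e / 2)).
by rewrite ler_piMr ?(ltW e20)// mulrC ler_pdivrMr// mul1r ler_nat.
Unshelve. all: by end_near.
Qed.

End initial_closeness.

Lemma squeeze_cvge0 (R : realType) (u : nat -> \bar R) :
  (forall e : R, 0 < e -> \forall n \near \oo, (0 <= u n <= e%:E)%E) ->
  u @ \oo --> 0%E.
Proof.
move=> ue; apply/fine_cvgP; split.
  near=> n; have /andP[u0 u1] : (0 <= u n <= 1%:E)%E.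
    by near: n; exact: ue.
  by rewrite ge0_fin_numE// (le_lt_trans u1)// ltry.
apply/cvgrPdist_le => e e0; near=> n.
have /andP[u0 u1] : (0 <= u n <= e%:E)%E by near: n; exact: ue.
have uf : u n \is a fin_num by rewrite ge0_fin_numE// (le_lt_trans u1)// ltry.
by rewrite /= sub0r normrN ger0_norm ?fine_ge0// -lee_fin fineK.
Unshelve. all: by end_near.
Qed.

Section deterministic_limit.
Context {R : realType}.
Variables (T K : R) (W : R * R -> R) (rho : R -> R * R * R -> R).
Variables (rho_init : R * R * R -> R).
Hypothesis T0 : 0 < T.
Hypothesis lipW : [lipschitz W z | z in `[0, 1] `*` `[0, 1]].
Hypothesis rho_weak : weak_solution T K W rho_init rho.
Variables (xi om th0 : forall n : nat, 'I_n -> R).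
Variable th : forall n : nat, 'I_n -> R -> R.
Arguments xi : clear implicits.
Arguments om : clear implicits.
Arguments th0 : clear implicits.
Arguments th : clear implicits.
Hypothesis xi01 : forall n i, 0 <= xi n i <= 1.
Hypothesis sol : forall n, kuramoto_solution T K W (xi n) (om n) (th0 n) (th n).

(** The parameters of the stability bound are chosen in the order: cutoff of the
    frequencies, number of steps, sample size. *)
Lemma mean_field_limit :
  (forall (k : nat) (e : R), 0 < e -> \forall n \near \oo,
     BL_close k.+1%:R e (sample_mean (fun i : 'I_n => (th0 n i, om n i, xi n i)))
       (pairing (rho 0))) ->
  (fun n : nat => ereal_sup
     [set dBL (empirical_measure
                 (fun i : 'I_n => G_repr (th n i t, om n i, xi n i)))
              (density_measure (rho t)) | t in `[0, T]]) @ \oo --> 0%E.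
Proof.
move=> init; have [B [L [B0 L0 WB WL]]] := lipschitz_square_bounds lipW.
have [C C0 bound] := stability_constant K rho T0 B0 L0.
have rd0 := rho_density T0 rho_weak 0.
have c00 : clampT T 0 = 0 by rewrite clampT_id// lexx ltW.
apply: squeeze_cvge0 => e e0.
have e30 : 0 < e / (3 * C) by rewrite divr_gt0// mulr_gt0.
have [k etak] : exists k : nat, tail (pairing (rho (clampT T 0))) k.+1%:R <= e / (3 * C).
  have /cvgrPdist_le /(_ _ e30) [k _ /(_ k.+1 (leqnSn k))] := tail_cvg0 rd0.
  by rewrite /= sub0r normrN => h; exists k; apply: le_trans (ler_norm _) h.
set eta := tail _ _ in etak; pose V : R := k.+1%:R + `|K| * B.
have eta0 : 0 <= eta by exact: tail_ge0 (averaging_pairing rd0).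
have V0 : 0 < V by rewrite ltr_wpDr// mulr_ge0// ltW.
have [N VN] : exists N : nat, V / N.+1%:R <= e / (3 * C).
  have /cvgrPdist_le /(_ (e / (3 * C) / V) (divr_gt0 e30 V0)) [N _ /(_ N (leqnn N))] :=
    @cvg_harmonic R.
  rewrite /= sub0r normrN ger0_norm ?invr_ge0// => h; exists N.
  by rewrite mulrC -ler_pdivlMr.
near=> n; have n0 : (0 < n)%N by near: n; exact: nbhs_infty_gt.
have close : BL_close k.+1%:R (e / (3 * C))
    (sample_mean (fun i : 'I_n => (th0 n i, om n i, xi n i))) (pairing (rho 0)).
  by near: n; exact: init.
have close0 : BL_close k.+1%:R (e / (3 * C))
    (sample_mean (fun i : 'I_n => G_repr (particle (xi n) (om n) (th n) 0 i)))
    (pairing (rho (clampT T 0))).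
  rewrite c00 (_ : (fun i => _) = (fun i : 'I_n => (th0 n i, om n i, xi n i)))//.
  apply/funext => i; rewrite /G_repr /particle /=.
  by have [-> _ _] := sol i.
have small : C * (eta + e / (3 * C) + V / N.+1%:R) <= e.
  have eE : C * (e / (3 * C) + e / (3 * C) + e / (3 * C)) = e.
    by field; rewrite gt_eqF.
  rewrite -[X in _ <= X]eE.
  by rewrite ler_wpM2l ?(ltW C0)// lerD// lerD.
have le_e t : 0 <= t <= T ->
  (0 <= dBL (empirical_measure (fun i : 'I_n => G_repr (th n i t, om n i, xi n i)))
      (density_measure (rho t)) <= e%:E)%E.
  move=> t0T; apply: dBL_le => //.
  - by move=> i; apply: G_repr_Gset; exact: xi01.
  - by case: rho_weak => + _ _ _; exact.
  move=> f BLf; have := bounded_lipschitz_stability T0 WB WL B0 L0 rho_weak n0 (xi01 (n := n)) (@sol n)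
    (ler0n _ _) close0 t0T (ltn0Sn N) _ (BL_extension_lip BLf) (BL_extension_periodic f).
  rewrite clampT_id// => h; apply: (le_trans (h _)) => {h}.
    by move=> P; have := BL_extension_itv BLf P; rewrite ler_norml; lra.
  apply: le_trans small; apply: bound => //; exact: ltW.
apply/andP; split.
  apply: le_ereal_sup_tmp; have z0T : (0 : R) <= (0 : R) <= T by rewrite lexx ltW.
  exists (dBL (empirical_measure (fun i : 'I_n => G_repr (th n i 0, om n i, xi n i)))
      (density_measure (rho 0))); last by case/andP: (le_e 0 z0T).
  by exists 0 => //=; rewrite in_itv.
apply: ge_ereal_sup => _ [t /= + <-]; rewrite in_itv/= => /le_e.
by case/andP.
Unshelve. all: by end_near.
Qed.

End deterministic_limit.

Theorem corollary2p3 (R : realType) (T K : R) (W : R * R -> R)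
    (xi : forall n : nat, 'I_n -> R) (g : R -> R) (rho0 : R * R * R -> R)
    (d : measure_display) (Omega : measurableType d) (Pr : probability Omega R)
    (omega : nat -> {RV Pr >-> R})
    (theta0 : forall n : nat, 'I_n -> {RV Pr >-> R})
    (theta : forall n : nat, 'I_n -> Omega -> R -> R)
    (rho : R -> R * R * R -> R) :
  0 < T ->
  (* the kernel W : I^2 -> R *)
  (forall x y : R, 0 <= x <= 1 -> 0 <= y <= 1 -> W (x, y) = W (y, x)) ->
  [lipschitz W z | z in `[0, 1] `*` `[0, 1]] ->
  (* the points xi_{ni} *)
  (forall n (i : 'I_n), 0 <= xi n i <= 1) ->
  (forall f : R -> R, {within `[0, 1], continuous f} ->
    (fun n : nat => n%:R^-1 * \sum_(i < n) f (xi n i)) @ \oo -->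
      \int[lebesgue_measure]_(x in `[0, 1]) f x) ->
  (* the density g and the frequencies omega_i *)
  continuous g ->
  (forall x, 0 <= g x) ->
  (\int[lebesgue_measure]_x (g x)%:E = 1)%E ->
  (forall i, has_density Pr (omega i) g) ->
  mutually_independent Pr (fun i => omega i) ->
  (* the conditional density rho0 *)
  G_continuous rho0 ->
  (forall P, Gset P -> 0 <= rho0 P) ->
  (forall om x : R, 0 <= x <= 1 ->
    (\int[lebesgue_measure]_(phi in circle) (rho0 (phi, om, x))%:E = 1)%E) ->
  (forall eps : R, 0 < eps -> exists2 delta : R, 0 < delta &
    forall x1 x2 : R, 0 <= x1 <= 1 -> 0 <= x2 <= 1 -> `|x1 - x2| < delta ->
    forall th om : R, circle th ->
      `|rho0 (th, om, x1) - rho0 (th, om, x2)| < eps) ->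
  (* the initial phases *)
  (forall n (i : 'I_n) a, circle (theta0 n i a)) ->
  (forall n, conditionally_sampled Pr rho0 (fun i => omega i) (xi n)
               (fun i => theta0 n i)) ->
  (* the solutions of the Kuramoto model *)
  (forall n a, kuramoto_solution T K W (xi n) (fun i => omega i a)
                 (fun i => theta0 n i a) (fun i => theta n i a)) ->
  (* the weak solution of the mean field equation *)
  weak_solution T K W (fun P => rho0 P * g P.1.2) rho ->
  {ae Pr, forall a,
    (fun n : nat =>
       ereal_sup
         [set dBL (empirical_measure
                     (fun i : 'I_n => G_repr (theta n i a t, omega i a, xi n i)))
                  (density_measure (rho t)) | t in `[0, T]]) @ \oo --> 0%E}.

Proof.
move=> T0 _ lipW xi01 xi_equi cg g0 g1 domega iomega crho0 rho0_ge0 rho0_int1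
  rho0_unif theta0_circle sampled sol rho_weak.
have lln (k m j1 j2 l : nat) : {ae Pr, forall a,
    (fun n => sample_mean (fun i : 'I_n => (theta0 n i a, omega i a, xi n i))
      (cell_fun (theta_cell m.+1 j1) (omega_cell k.+1%:R m.+1 j2) (tent m.+1 l))) @ \oo -->
    pairing (rho 0) (cell_fun (theta_cell m.+1 j1) (omega_cell k.+1%:R m.+1 j2) (tent m.+1 l))}.
  have mA : measurable (theta_cell m.+1 j1 : set R) by exact: measurable_itv.
  have mB : measurable (omega_cell (k.+1%:R : R) m.+1 j2) by exact: measurable_itv.
  have momega i : measurable_fun setT (omega i) by exact: measurable_funPT.
  have mtheta0 n (i : 'I_n) : measurable_fun setT (theta0 n i) by exact: measurable_funPT.
  exact: (cell_lln T0 rho_weak cg g0 g1 crho0 rho0_ge0 rho0_int1 rho0_unif mA mB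
    (@tent_continuous _ m.+1 l) (@tent_itv _ m.+1 l) momega domega iomega xi01
    xi_equi mtheta0 sampled).
have {lln} : {ae Pr, forall a, forall k m j1 j2 l : nat,
    (fun n => sample_mean (fun i : 'I_n => (theta0 n i a, omega i a, xi n i))
      (cell_fun (theta_cell m.+1 j1) (omega_cell k.+1%:R m.+1 j2) (tent m.+1 l))) @ \oo -->
    pairing (rho 0) (cell_fun (theta_cell m.+1 j1) (omega_cell k.+1%:R m.+1 j2) (tent m.+1 l))}.
  by do 5 apply/ae_foralln => ?; exact: lln.
apply: filterS => a lim.
apply: (mean_field_limit T0 lipW rho_weak (om := fun n i => omega i a) xi01
  (fun n => sol n a)) => k e e0.
have rd0 := rho_density T0 rho_weak 0.
rewrite clampT_id ?lexx ?ltW// in rd0.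
apply: eventually_BL_close => //; last exact: averaging_pairing.
move=> n n0; apply: averaging_sample_mean => // i; split => /=; first exact: theta0_circle.
by rewrite in_itv/=; exact: xi01.
Qed.
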